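(* Assume $-m<\delta_{\min}\le\delta_{\max}$ are known and $\delta_0,\delta_1\in(\delta_{\min},\delta_{\max})$. Let $Q(G_n)=N_m(n)-n\,p_m(\hat\delta_n)$. Let $a_n$ be a positive diverging sequence such that $a_n=\omega(\sqrt n\log n)$ and $a_n=n^{\frac12+o(1)}$, and define the test $$\phi(G_n)=\mathbf 1\{|Q(G_n)|\ge a_n\}.$$ The type-I error of this test converges to zero: $\mathbb P_0(\phi(G_n)\ne0)=o(1)$ as $n\to\infty$. Furthermore, when $\delta_0\ne\delta_1$ and $\tfrac12<\gamma<1$, the type-II error vanishes: $\mathbb P_1(\phi(G_n)=0)=o(1)$ as $n\to\infty$.
   Context: Model. Fix an integer $m\ge1$ and a function $\delta:\mathbb N\to(-m,\infty)$. A random sequence of undirected loopless graphs $(G_t)_{t\ge1}$ (multiple edges allowed, degrees counted with multiplicity) is built as follows. $G_1$ has vertices $v_0,v_1$ joined by $m$ edges. For $t\ge2$, $G_{t,0}$ is $G_{t-1}$ plus an isolated vertex $v_t$; for $i=1,\dots,m$, given $G_{t,i-1}$, a vertex $v_{t,i}\in\{v_0,\dots,v_{t-1}\}$ is sampled with $\mathbb P(v_{t,i}=v\mid G_{t,i-1})=\frac{D_v(G_{t,i-1})+\delta(t)}{\sum_{j=0}^{t-1}(D_{v_j}(G_{t,i-1})+\delta(t))}$, where $D_v(G)$ is the degree of $v$ in $G$, and $G_{t,i}$ is $G_{t,i-1}$ plus the edge $\{v_{t,i},v_t\}$; finally $G_t=G_{t,m}$. Vertices are identified with $[n]=\{0,1,\dots,n\}$,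 $D_v(t)=D_v(G_t)$, $N_k(t)=\#\{v\in[t]:D_v(t)=k\}$, and $N_{>k}(t)=\sum_{j>k}N_j(t)$. Null model ($\mathbb P_0,\mathbb E_0$): $\delta(t)=\delta_0$ for all $t$. Alternative model ($\mathbb P_1,\mathbb E_1$): $\delta(t)=\delta_0$ for $t\le\tau_n$ and $\delta(t)=\delta_1$ for $t>\tau_n$, with $\delta_0,\delta_1>-m$ and $\tau_n=n-cn^\gamma$ (rounded down to an integer), $c>0$, $\gamma\in(0,1)$. The constants $m,\delta_0,\delta_1,c,\gamma$ are fixed as $n\to\infty$. $p_m(\delta)=\dfrac{2+\delta/m}{m+\delta+2+\delta/m}$ for $\delta>-m$. The estimator is $\hat\delta_n=\arg\max_{\delta\in[\delta_{\min},\delta_{\max}]}\iota_n(\delta)$, where, with $S_{t,i-1}(\delta)=t\delta+2m(t-1)+(i-1)$, $$\iota_n(\delta)=\frac1{n+1}\sum_{k=m}^\infty\log(k+\delta)\,N_{>k}(n)-\frac1{n+1}\sum_{t=2}^n\sum_{i=1}^m\log S_{t,i-1}(\delta).$$ Equivalently, for large $n$ (with high probability) $\hat\delta_n$ is the solution of $\iota_n'(\delta)=0$ in $[\delta_{\min},\delta_{\max}]$. $a_n=\omega(b_n)$ means $b_n/a_n\to0$. *)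

(* Defs.v *)
From HB Require Import structures.
From mathcomp Require Import all_boot all_order all_algebra.
From mathcomp Require Import all_classical all_reals all_analysis.

Set Implicit Arguments.
Unset Strict Implicit.
Unset Printing Implicit Defensive.

Import Order.TTheory GRing.Theory Num.Theory.
Import numFieldNormedType.Exports.

Local Open Scope classical_set_scope.
Local Open Scope ring_scope.

(* A finite multigraph on the vertices 0, ..., nvert - 1. The edge list keeps
   repetitions (multiple edges). *)
Record multigraph := MGraph { nvert : nat ; edges : seq (nat * nat) }.

Definition add_vertex (G : multigraph) : multigraph :=
  MGraph (nvert G).+1 (edges G).

Definition add_edge (G : multigraph) (u v : nat) : multigraph :=
  MGraph (nvert G) (rcons (edges G) (u, v)).

Definition deg (G : multigraph) (v : nat) : nat :=
  (\sum_(e <- edges G) ((e.1 == v) + (e.2 == v)))%N.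

Definition N_eq (G : multigraph) (k : nat) : nat :=
  count (fun v => deg G v == k) (iota 0 (nvert G)).

Section Model.
Context {R : realType}.

(* A law with finite support is a list of weighted outcomes (an outcome may
   occur several times, its weights then add up). *)
Definition dist (A : Type) := seq (R * A).

Definition dret A (x : A) : dist A := [:: (1, x)].

Definition dbind A B (d : dist A) (k : A -> dist B) : dist B :=
  flatten [seq [seq (x.1 * y.1, y.2) | y <- k x.2] | x <- d].

Definition prob A (d : dist A) (E : pred A) : R := \sum_(x <- d | E x.2) x.1.

Definition attach_prob (delta : R) (t : nat) (G : multigraph) (v : nat) : R :=
  ((deg G v)%:R + delta) / \sum_(0 <= j < t) ((deg G j)%:R + delta).

(* The transition from G_{t,i-1} to G_{t,i}. *)
Definition attach_edge (delta : R) (t : nat) (G : multigraph) :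
    dist multigraph :=
  [seq (attach_prob delta t G v, add_edge G v t) | v <- iota 0 t].

(* The law of G_{t,i} given G_{t-1} = G. *)
Fixpoint attach (delta : R) (t i : nat) (G : multigraph) : dist multigraph :=
  if i is i'.+1 then dbind (attach delta t i' G) (attach_edge delta t)
  else dret (add_vertex G).

Definition G1 (m : nat) : multigraph := MGraph 2 (nseq m (0%N, 1%N)).

(* The law of G_t, for t >= 1; the value at t = 0 is irrelevant. *)
Fixpoint PA_law (m : nat) (delta : nat -> R) (t : nat) : dist multigraph :=
  match t with
  | 0 | 1 => dret (G1 m)
  | t'.+1 => dbind (PA_law m delta t') (attach (delta t) t m)
  end.

Definition tau (c gamma : R) (n : nat) : int :=
  Num.floor (n%:R - c * n%:R `^ gamma).

Definition delta_null (delta0 : R) (t : nat) : R := delta0.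

Definition delta_alt (delta0 delta1 c gamma : R) (n t : nat) : R :=
  if (t%:Z <= tau c gamma n)%R then delta0 else delta1.

Definition P_null (m : nat) (delta0 : R) (n : nat) (E : pred multigraph) : R :=
  prob (PA_law m (delta_null delta0) n) E.

Definition P_alt (m : nat) (delta0 delta1 c gamma : R) (n : nat)
    (E : pred multigraph) : R :=
  prob (PA_law m (delta_alt delta0 delta1 c gamma n) n) E.

Definition p_m (m : nat) (delta : R) : R :=
  (2 + delta / m%:R) / (m%:R + delta + 2 + delta / m%:R).

Definition N_gt (G : multigraph) (k : nat) : R :=
  \big[+%R/0]_(k.+1 <= j <oo) ((N_eq G j)%:R : R).

Definition S_norm (m t j : nat) (delta : R) : R :=
  t%:R * delta + (2 * m * t.-1)%:R + j%:R.

(* The series over k has finitely many nonzero terms. *)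
Definition loglik (m n : nat) (G : multigraph) (delta : R) : R :=
  (n.+1)%:R^-1 * \big[+%R/0]_(m <= k <oo) (ln (k%:R + delta) * N_gt G k : R)
  - (n.+1)%:R^-1 *
    \sum_(2 <= t < n.+1) \sum_(1 <= i < m.+1) ln (S_norm m t i.-1 delta).

Definition is_argmax_on (A : set R) (f : R -> R) (x : R) : Prop :=
  A x /\ forall y, A y -> f y <= f x.

(* An estimator is any selection of a maximizer, as a function of the observed
   graph; the maximizer need not be unique. *)
Definition is_estimator (m : nat) (dmin dmax : R)
    (dhat : nat -> multigraph -> R) : Prop :=
  forall n G, is_argmax_on `[dmin, dmax] (loglik m n G) (dhat n G).

Definition Q (m : nat) (dhat : nat -> multigraph -> R) (n : nat)
    (G : multigraph) : R :=
  (N_eq G m)%:R - n%:R * p_m m (dhat n G).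

Definition test (m : nat) (dhat : nat -> multigraph -> R) (a : nat -> R)
    (n : nat) (G : multigraph) : nat :=
  nat_of_bool (a n <= `|Q m dhat n G|)%R.

(* a_n = omega(b_n) *)
Definition omega (a b : nat -> R) : Prop := b n / a n @[n --> \oo] --> (0 : R).

(* a_n = n^(p + o(1)) *)
Definition eq_pow_o1 (a : nat -> R) (p : R) : Prop :=
  exists2 e : nat -> R, e n @[n --> \oo] --> (0 : R) &
    \forall n \near \oo, a n = n%:R `^ (p + e n).

End Model.

(* Main.v *)
(* Three facts drive the proof.

   1. L2 control. Let F be a sum over the vertices of a function of the degree,
   and c a deterministic prediction of F along the edge additions. The L2 norm
   of F - c grows by at most the L2 error of the predicted conditional
   increments, up to a fluctuation of order sqrt n. By induction on k this gives
   N_k(t) = p_k t + O(sqrt t) before the changepoint, and after it a drift that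
   can be computed to order n^gamma, both for N_m and for the score (the
   derivative of the log-likelihood).

   2. Quasi-concavity. With H(d) = (2m + d)^2 L'(d), the identities
   (2m+d)^2/(k+d) = (2m-k)^2/(k+d) + 4m - k + d (for a vertex) and its analogue
   for log S cancel the linear terms, and H decreases with slope at most
   -(const #{v : D_v > m} - const), deterministically. So the sign of the score
   at one point d locates the maximizer on one side of d.

   3. Under P_0 the score at delta_0 is a martingale of size sqrt n, whence
   |dhat - delta_0| = O(n^(-1/2)) in probability. Under P_1 the maximizer moves
   by s n^(gamma-1), s = c (delta_1 - delta_0)(2m + delta_0)/(2m + delta_1), to
   first order, because the drift of the score and its slope contain the same
   variance factor. The count N_m moves as if delta had moved by
   (s / p_m(delta_0)) n^(gamma-1). As p_m(delta_0) < 1 the two shifts differ, so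
   |Q| is of order n^gamma. *)
Require Import Defs.
From HB Require Import structures.
From mathcomp Require Import all_boot all_order all_algebra.
From mathcomp Require Import all_classical all_reals all_analysis.
From mathcomp Require Import ring lra zify.

Set Implicit Arguments.
Unset Strict Implicit.
Unset Printing Implicit Defensive.

Import Order.TTheory GRing.Theory Num.Theory.
Import numFieldNormedType.Exports.

Local Open Scope classical_set_scope.
Local Open Scope ring_scope.

(** Bounded in absolute value instead, it would feed a Gronwall growth by a power of t and in
    general lose the rate sqrt t. Probability then enters only through two Chebyshev bounds, for N_m
    and for the score at one deterministic point; off these two events the argument is
    deterministic, and no uniformity in d is needed. Two obstacles shape the alternative. The score
    involves all degrees, while N_k is controlled for one k at a time with constants depending on k:
    degrees from m + K on are cut off at the price of a relative error 1/K, and the constants are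
    chosen in the order K, eps, n. Moreover the coarse counts are off by O(1) per step after the
    changepoint, which adds up to n^gamma, the size of the signal; the refined predictions use these
    counts only divided by t, which leaves n^(2 gamma - 1). *)

Ltac nonneg := repeat first
  [ assumption | apply: ltW; assumption | apply: sqrtr_ge0 | apply: normr_ge0
  | apply: ler0n | apply: ler01 | apply: sqr_ge0 | apply: addr_ge0
  | apply: mulr_ge0 | rewrite invr_ge0 ].

(** * Laws with finite support *)

Section FiniteLaw.
Context {R : realType}.

(** [P] is bundled with the law because the attachment weights are nonnegative, and the estimates
    valid, only on graphs satisfying a structural invariant; comparisons of expectations need then
    be proved only under [P]. *)
Definition is_law A (P : pred A) (d : @dist R A) : Prop :=
  all (fun x => (0 <= x.1) && P x.2) d /\ \sum_(x <- d) x.1 = 1.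

Definition expect A (d : @dist R A) (f : A -> R) : R :=
  \sum_(x <- d) x.1 * f x.2.

Definition nrm A (d : @dist R A) (f : A -> R) : R :=
  Num.sqrt (expect d (fun x => f x ^+ 2)).

Lemma expect_dbind A B (d : @dist R A) (k : A -> @dist R B) f :
  expect (dbind d k) f = expect d (fun x => expect (k x) f).
Proof.
rewrite /expect /dbind big_flatten big_map; apply: eq_bigr => x _.
rewrite big_map mulr_sumr; apply: eq_bigr => y _ /=.
by rewrite mulrA.
Qed.

Lemma expect_dret A (x : A) (f : A -> R) : expect (dret x) f = f x.
Proof. by rewrite /expect /dret big_seq1 mul1r. Qed.

Lemma eq_expect A (d : @dist R A) f g : f =1 g -> expect d f = expect d g.
Proof. by move=> fg; apply: eq_bigr => x _; rewrite fg. Qed.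

Lemma is_law_dret A (P : pred A) x : P x -> is_law P (@dret R A x).
Proof. by move=> Px; split; rewrite /= ?ler01 ?Px ?big_seq1. Qed.

Lemma is_law_dbind A B (P : pred A) (P' : pred B) (d : @dist R A) k :
  is_law P d -> (forall x, P x -> is_law P' (k x)) -> is_law P' (dbind d k).
Proof.
move=> [dP d1] kP; split.
  rewrite /dbind; elim: d dP {d1} => //= x d IHd /andP[/andP[x0 Px] dP].
  rewrite all_cat IHd // andbT all_map; have [+ _] := kP _ Px.
  by apply: sub_all => y /= /andP[y0 ->]; rewrite mulr_ge0.
have -> : \sum_(x <- dbind d k) x.1 = expect (dbind d k) (fun=> 1).
  by apply: eq_bigr => x _; rewrite mulr1.
rewrite expect_dbind -[RHS]d1 /expect.
elim: d dP {d1} => [|x d IHd] /=; first by rewrite !big_nil.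
move=> /andP[/andP[x0 Px] dP]; rewrite !big_cons IHd //.
have [_ kx1] := kP _ Px.
by under eq_bigr do rewrite mulr1; rewrite kx1 mulr1.
Qed.

Section Law.
Variables (A : Type) (P : pred A) (d : @dist R A).
Hypothesis dP : is_law P d.

Lemma expect_le f g : (forall x, P x -> f x <= g x) -> expect d f <= expect d g.
Proof.
move=> fg; case: dP => + _; rewrite /expect.
elim: (d) => [|x s IHs] /=; first by rewrite !big_nil.
move=> /andP[/andP[x0 Px] sP]; rewrite !big_cons lerD ?IHs //.
by rewrite ler_wpM2l // fg.
Qed.

Lemma eq_expect_law f g :
  (forall x, P x -> f x = g x) -> expect d f = expect d g.
Proof.
by move=> fg; apply/eqP; rewrite eq_le !expect_le // => x /fg ->.
Qed.

Lemma expect_ge0 f : (forall x, P x -> 0 <= f x) -> 0 <= expect d f.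
Proof.
move=> f0; apply: (le_trans _ (expect_le (f := fun=> 0) f0)).
by rewrite /expect big1 // => x _; rewrite mulr0.
Qed.

Lemma expectD f g : expect d (fun x => f x + g x) = expect d f + expect d g.
Proof. by rewrite /expect -big_split; apply: eq_bigr => x _; rewrite /= mulrDr. Qed.

Lemma expectZ a f : expect d (fun x => a * f x) = a * expect d f.
Proof. by rewrite /expect mulr_sumr; apply: eq_bigr => x _; ring. Qed.

Lemma expect_cst a : expect d (fun=> a) = a.
Proof. by case: dP => _ d1; rewrite /expect -mulr_suml d1 mul1r. Qed.

Lemma nrm_ge0 f : 0 <= nrm d f. Proof. exact: sqrtr_ge0. Qed.

Lemma sqr_nrm f : nrm d f ^+ 2 = expect d (fun x => f x ^+ 2).
Proof. by rewrite sqr_sqrtr // expect_ge0 // => x _; exact: sqr_ge0. Qed.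

Lemma nrm_le f g : (forall x, P x -> `|f x| <= g x) -> nrm d f <= nrm d g.
Proof.
move=> fg; apply: ler_wsqrtr; apply: expect_le => x Px.
by rewrite -[f x ^+ 2]real_normK ?num_real // lerXn2r ?nnegrE ?(le_trans _ (fg _ Px)) // fg.
Qed.

Lemma nrm_cst a : nrm d (fun=> a) = `|a|.
Proof. by rewrite /nrm expect_cst sqrtr_sqr. Qed.

Lemma nrmZ a f : nrm d (fun x => a * f x) = `|a| * nrm d f.
Proof.
rewrite /nrm -sqrtr_sqr -sqrtrM ?sqr_ge0 // -expectZ; congr Num.sqrt.
by apply: eq_expect => x; rewrite exprMn.
Qed.

Lemma nrm_norm f : nrm d (fun x => `|f x|) = nrm d f.
Proof. by congr Num.sqrt; apply: eq_expect => x; rewrite real_normK ?num_real. Qed.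

Lemma cauchy_schwarz f g : expect d (fun x => f x * g x) <= nrm d f * nrm d g.
Proof.
have key (s t : R) : 0 <= s ^+ 2 * nrm d f ^+ 2
    - 2 * s * t * expect d (fun x => f x * g x) + t ^+ 2 * nrm d g ^+ 2.
  rewrite !sqr_nrm -mulNr -!expectZ -!expectD; apply: expect_ge0 => x _.
  by apply: le_trans (sqr_ge0 (s * f x - t * g x)) _; rewrite le_eqVlt; apply/orP; left; apply/eqP; ring.
have := nrm_ge0 f; have := nrm_ge0 g.
set E := expect _ _ in key *; set b := nrm d g in key *.
set a := nrm d f in key * => b0 a0.
(* If a norm vanishes, the quadratic form is affine in the matching variable; a positive E would
   then allow a value making it equal to - b^2 - 2 (or - a^2 - 2). *)
have [a_eq|an] := eqVneq a 0.
  rewrite a_eq mul0r leNgt; apply/negP => E0.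
  have := key ((b ^+ 2 + 1) / E) 1; rewrite a_eq expr0n /= mulr0 add0r.
  have -> : - (2 * ((b ^+ 2 + 1) / E) * 1 * E) + 1 ^+ 2 * b ^+ 2 = - b ^+ 2 - 2.
    by field; rewrite gt_eqF.
  by rewrite leNgt => /negP; apply; have := sqr_ge0 b; lra.
have [b_eq|bn] := eqVneq b 0.
  rewrite b_eq mulr0 leNgt; apply/negP => E0.
  have := key 1 ((a ^+ 2 + 1) / E); rewrite b_eq expr0n /= mulr0 addr0.
  have -> : 1 ^+ 2 * a ^+ 2 - 2 * 1 * ((a ^+ 2 + 1) / E) * E = - a ^+ 2 - 2.
    by field; rewrite gt_eqF.
  by rewrite leNgt => /negP; apply; have := sqr_ge0 a; lra.
have a1 : 0 < a by rewrite lt_neqAle eq_sym an.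
have b1 : 0 < b by rewrite lt_neqAle eq_sym bn.
have := key b a.
have -> : b ^+ 2 * a ^+ 2 - 2 * b * a * E + a ^+ 2 * b ^+ 2 =
  (2 * (a * b)) * (a * b - E) by ring.
by rewrite pmulr_rge0 ?subr_ge0 // !mulr_gt0.
Qed.

Lemma nrmD f g : nrm d (fun x => f x + g x) <= nrm d f + nrm d g.
Proof.
have h : 0 <= nrm d f + nrm d g by rewrite addr_ge0 ?nrm_ge0.
rewrite -(@ler_pXn2r _ 2) ?nnegrE ?nrm_ge0 //.
rewrite sqr_nrm sqrrD !sqr_nrm.
have -> : expect d (fun x => (f x + g x) ^+ 2) =
   expect d (fun x => f x ^+ 2) + 2 * expect d (fun x => f x * g x)
   + expect d (fun x => g x ^+ 2).
  by rewrite -expectZ -!expectD; apply: eq_expect => x; ring.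
have := cauchy_schwarz f g; rewrite -mulr_natl; lra.
Qed.

Lemma eq_nrm f g : f =1 g -> nrm d f = nrm d g.
Proof. by move=> fg; congr Num.sqrt; apply: eq_expect => x; rewrite fg. Qed.

Lemma prob_expect (E : pred A) : prob d E = expect d (fun x => (E x)%:R).
Proof.
rewrite /prob /expect big_mkcond; apply: eq_bigr => x _.
by case: (E x.2); rewrite ?mulr1 ?mulr0.
Qed.

Lemma prob_ge0 (E : pred A) : 0 <= prob d E.
Proof. by rewrite prob_expect expect_ge0 // => x _; rewrite ler0n. Qed.

Lemma chebyshev f (l : R) : 0 < l ->
  prob d (fun x => l <= `|f x|) <= (nrm d f / l) ^+ 2.
Proof.
move=> l0; rewrite prob_expect exprMn sqr_nrm mulrC -expectZ.
apply: expect_le => x _ /=; case: (leP l `|f x|) => h.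
  rewrite exprVn mulrC ler_pdivlMr ?exprn_gt0 // mul1r.
  by rewrite -[f x ^+ 2]real_normK ?num_real // lerXn2r ?nnegrE // ltW.
by rewrite mulr_ge0 ?sqr_ge0.
Qed.

Lemma prob_le2 (E E1 E2 : pred A) :
  (forall x, P x -> E x -> E1 x || E2 x) ->
  prob d E <= prob d E1 + prob d E2.
Proof.
move=> EE; rewrite !prob_expect -expectD; apply: expect_le => x Px.
have := EE x Px; case: (E x) => [/(_ isT)|_]; last by rewrite addr_ge0 ?ler0n.
by case: (E1 x); case: (E2 x) => //= _; rewrite ?addr0 ?add0r // lerDl ler01.
Qed.

End Law.
End FiniteLaw.

(** * One attachment step *)

(* Deterministic facts about G_{t,i}; the degree of the new vertex t is i. *)
Definition inv (m t i : nat) (G : multigraph) : bool :=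
  [&& nvert G == t.+1, all (fun v => m <= deg G v)%N (iota 0 t), deg G t == i,
      \sum_(0 <= v < t) deg G v == 2 * m * t.-1 + i &
      all (fun e => (e.1 <= t) && (e.2 <= t)) (edges G)]%N.

Lemma deg_add_edge G u v x :
  deg (add_edge G u v) x = (deg G x + ((u == x) + (v == x)))%N.
Proof. by rewrite /deg /= -cats1 big_cat big_seq1. Qed.

(** The bound on the edge ends in [inv] makes a vertex isolated at the moment it is added, which
    fixes its degree at i after i edges. *)
Lemma inv_degS m t i G : inv m t i G -> deg G t.+1 = 0%N.
Proof.
move=> /and5P[_ _ _ _ /allP h]; rewrite /deg big_seq big1 // => e /h /andP[h1 h2].
by rewrite !ltn_eqF // ltnS.
Qed.

Lemma inv_deg_ge m t i G v : inv m t i G -> (v < t)%N -> (m <= deg G v)%N.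
Proof. by move=> /and5P[_ /allP h _ _ _] vt; apply: h; rewrite mem_iota add0n. Qed.

Lemma inv_add_vertex m t G : (0 < t)%N -> inv m t m G -> inv m t.+1 0 (add_vertex G).
Proof.
move=> t0 iG; have dS := inv_degS iG; move: iG.
move=> /and5P[/eqP h1 /allP h2 /eqP h3 /eqP h4 /allP h5].
apply/and5P; split.
- by rewrite /= h1.
- apply/allP => v; rewrite mem_iota add0n => /andP[_]; rewrite ltnS leq_eqVlt => /orP[/eqP ->|vt].
    by have -> : deg (add_vertex G) t = deg G t by []; rewrite h3.
  by apply: h2; rewrite mem_iota add0n.
- by apply/eqP.
- by apply/eqP; rewrite big_nat_recr //= -[deg _ t]/(deg G t) h3 [X in (X + _)%N]h4; nia.
- by apply/allP => e /h5 /andP[e1 e2]; rewrite !leqW.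
Qed.

Lemma inv_add_edge m t i G v : (v < t)%N -> inv m t i G -> inv m t i.+1 (add_edge G v t).
Proof.
move=> vt /and5P[/eqP h1 /allP h2 /eqP h3 /eqP h4 /allP h5].
apply/and5P; split.
- by rewrite /= h1.
- by apply/allP => u /h2 h; rewrite deg_add_edge (leq_trans h) // leq_addr.
- by rewrite deg_add_edge h3 (ltn_eqF vt) eqxx; apply/eqP; lia.
- under eq_bigr do rewrite deg_add_edge.
  rewrite big_split /= h4; apply/eqP.
  suff -> : (\sum_(0 <= i0 < t) ((v == i0) + (t == i0)) = 1)%N by lia.
  rewrite (bigD1_seq v) ?mem_index_iota ?iota_uniq //= eqxx (gtn_eqF vt).
  by rewrite big_seq_cond big1 // => u; rewrite mem_index_iota; lia.
- rewrite /= all_rcons /= leqnn (ltnW vt); apply/allP => e; exact: h5.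
Qed.

Lemma inv_G1 m : inv m 1 m (G1 m).
Proof.
have h v : (v < 2)%N -> deg (G1 m) v = m.
  move=> v2; rewrite /deg /=; elim: m => [|k IHk] /=; first by rewrite big_nil.
  by rewrite big_cons IHk; case: v v2 {IHk} => [|[|v]].
apply/and5P; split => //=; rewrite ?h ?andbT //.
  by rewrite big_nat1 h // muln0.
by apply/allP => e /nseqP[-> _].
Qed.

Section Model.
Context {R : realType}.
Variable m : nat.
Implicit Types (delta : nat -> R) (x y : R).

(** The normalizing constant of the attachment law. The new vertex is excluded from the degree sum,
    so each of the i edges adds only 1. *)
Definition Snorm t i x : R := t%:R * x + (2 * m * t.-1 + i)%:R.

(** The range excludes the vertex [t] being attached; it enters, with value [f m], when [t] moves to
    [t.+1]. *)
Definition vsum (f : nat -> R) t (G : multigraph) : R :=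
  \sum_(0 <= v < t) f (deg G v).

(** The conditional mean of the increment of [vsum f t] caused by one edge. *)
Definition drift x (f : nat -> R) t i (G : multigraph) : R :=
  (Snorm t i x)^-1 * vsum (fun k => (k%:R + x) * (f k.+1 - f k)) t G.

(* The law of G_{t,i}. *)
Definition step_law delta t i : dist multigraph :=
  dbind (PA_law m delta t.-1) (attach (delta t) t i).

(** Since 2m(t - 1) >= mt for t >= 2, the normalizer grows linearly in t even for negative x. *)
Lemma Snorm_ge t i x : (2 <= t)%N -> t%:R * (m%:R + x) <= Snorm t i x.
Proof.
case: t => [|[|t]] // _; rewrite /Snorm /= !natrD !natrM.
have := ler0n R t; have := ler0n R m; have := ler0n R i; rewrite -!natr1; nra.
Qed.

Lemma Snorm_gt0 t i x : - m%:R < x -> (2 <= t)%N -> 0 < Snorm t i x.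
Proof.
move=> xm t2; apply: lt_le_trans (Snorm_ge i x t2).
by rewrite mulr_gt0 ?ltr0n 1?(leq_trans _ t2) //; lra.
Qed.

Lemma attach_norm t i x G : inv m t i G ->
  \sum_(0 <= j < t) ((deg G j)%:R + x) = Snorm t i x.
Proof.
move=> /and5P[_ _ _ /eqP h _]; rewrite big_split /= -natr_sum h /Snorm addrC.
by rewrite sumr_const_nat subn0 mulr_natl.
Qed.

Lemma expect_attach_edge x t i G f : inv m t i G ->
  expect (attach_edge x t G) f =
  \sum_(0 <= v < t) ((deg G v)%:R + x) / Snorm t i x * f (add_edge G v t).
Proof.
move=> iG; rewrite /expect /attach_edge big_map /index_iota subn0.
by apply: eq_bigr => v _; rewrite /attach_prob (attach_norm _ iG).
Qed.

Lemma is_law_attach_edge x t i G : - m%:R < x -> (2 <= t)%N -> inv m t i G ->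
  is_law (inv m t i.+1) (attach_edge x t G).
Proof.
move=> xm t2 iG; have S0 := Snorm_gt0 i xm t2; split.
  rewrite all_map; apply/allP => v; rewrite mem_iota add0n => /andP[_ vt] /=.
  rewrite inv_add_edge // andbT /attach_prob (attach_norm _ iG).
  rewrite divr_ge0 ?ltW //.
  by have := inv_deg_ge iG vt; rewrite -(ler_nat R); lra.
rewrite big_map; under eq_bigr do rewrite /= /attach_prob (attach_norm _ iG).
rewrite -mulr_suml -{1}[t]subn0 (attach_norm _ iG) divff //.
by rewrite gt_eqF.
Qed.

Lemma is_law_attach x t i G : - m%:R < x -> (2 <= t)%N -> inv m t.-1 m G ->
  is_law (inv m t i) (attach x t i G).
Proof.
move=> xm t2 iG; elim: i => [|i IHi] /=.
  by apply: is_law_dret; case: t t2 iG => [|[|t]] // _; apply: inv_add_vertex.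
by apply: is_law_dbind IHi _ => H; apply: is_law_attach_edge.
Qed.

Section Laws.
Variable delta : nat -> R.
Hypothesis delta_gt : forall t, - m%:R < delta t.

Lemma is_law_PA t : (1 <= t)%N -> is_law (inv m t m) (PA_law m delta t).
Proof.
case: t => // t _; elim: t => [|t IHt]; first by apply/is_law_dret/inv_G1.
by apply: is_law_dbind IHt _ => G iG; apply: is_law_attach.
Qed.

Lemma is_law_step t i : (2 <= t)%N -> is_law (inv m t i) (step_law delta t i).
Proof.
move=> t2; apply: is_law_dbind (is_law_PA _) _; first by case: t t2 => [|[]].
by move=> G; apply: is_law_attach.
Qed.

Lemma expect_step_edge t i f : (2 <= t)%N ->
  expect (step_law delta t i.+1) f =
  expect (step_law delta t i) (fun G => expect (attach_edge (delta t) t G) f).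
Proof.
move=> t2; rewrite !expect_dbind; apply: eq_expect => G /=.
by rewrite expect_dbind.
Qed.

Lemma expect_step_vertex t f : (1 <= t)%N ->
  expect (step_law delta t.+1 0) f =
  expect (PA_law m delta t) (fun G => f (add_vertex G)).
Proof.
move=> t1; rewrite expect_dbind; apply: eq_expect => G /=.
by rewrite expect_dret.
Qed.

Lemma PA_law_step t : (2 <= t)%N -> PA_law m delta t = step_law delta t m.
Proof. by case: t => [|[|t]]. Qed.

Lemma vsum_recr f t i G : inv m t i G -> vsum f t.+1 G = vsum f t G + f i.
Proof. by move=> /and5P[_ _ /eqP h _ _]; rewrite /vsum big_nat_recr //= h. Qed.

Lemma vsum_add_edge f t G v : (v < t)%N ->
  vsum f t (add_edge G v t) = vsum f t G + (f (deg G v).+1 - f (deg G v)).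
Proof.
move=> vt; rewrite /vsum !(@big_cat_nat _ _ _ v 0 t) //= 1?ltnW //.
rewrite !(@big_ltn _ _ _ v t) //= deg_add_edge eqxx (gtn_eqF vt) addn0 addn1.
have h u : (u < t)%N -> u != v -> deg (add_edge G v t) u = deg G u.
  by move=> ut uv; rewrite deg_add_edge; lia.
rewrite (@eq_big_nat _ _ _ 0 v _ (fun u => f (deg G u))); last first.
  by move=> u uv; rewrite h //; lia.
rewrite (@eq_big_nat _ _ _ v.+1 t _ (fun u => f (deg G u))); last first.
  by move=> u uv; rewrite h //; lia.
by ring.
Qed.

(** Expand the square around the present deviation: the linear term averages to the drift minus [u],
    and the quadratic one is at most [C ^+ 2] outcome by outcome. *)
Lemma edge_second_moment x f t i (c u C : R) G :
  - m%:R < x -> (2 <= t)%N -> inv m t i G ->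
  (forall k, (m <= k)%N -> `|f k.+1 - f k - u| <= C) ->
  expect (attach_edge x t G) (fun H => (vsum f t H - (c + u)) ^+ 2) <=
  (vsum f t G - c) ^+ 2
  + 2 * ((vsum f t G - c) * (drift x f t i G - u)) + C ^+ 2.
Proof.
move=> xm t2 iG fC; have S0 := Snorm_gt0 i xm t2.
have aux := is_law_attach_edge xm t2 iG.
set Y := vsum f t G - c.
pose d v := f (deg G v).+1 - f (deg G v).
pose p v := ((deg G v)%:R + x) / Snorm t i x.
have p1 : \sum_(0 <= v < t) p v = 1.
  by rewrite -mulr_suml (attach_norm _ iG) divff // gt_eqF.
have dE : drift x f t i G = \sum_(0 <= v < t) p v * d v.
  rewrite /drift /vsum mulr_sumr; apply: eq_bigr => v _.
  by rewrite /p /d; ring.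
rewrite (expect_attach_edge _ _ iG) dE.
have -> : Y ^+ 2 + 2 * (Y * (\sum_(0 <= v < t) p v * d v - u)) + C ^+ 2 =
   \sum_(0 <= v < t) p v * (Y ^+ 2 + 2 * (Y * (d v - u)) + C ^+ 2).
  transitivity (\sum_(0 <= v < t) (p v * (Y ^+ 2 - 2 * Y * u + C ^+ 2)
     + 2 * Y * (p v * d v))); last by apply: eq_bigr => v _; ring.
  by rewrite big_split /= -mulr_suml p1 -mulr_sumr; ring.
apply: ler_sum_nat => v /= vt; apply: ler_wpM2l.
  rewrite divr_ge0 ?ltW //.
  by have := inv_deg_ge iG vt; rewrite -(ler_nat R); lra.
rewrite vsum_add_edge // -/(d v).
have -> : (vsum f t G + d v - (c + u)) ^+ 2 =
  Y ^+ 2 + 2 * (Y * (d v - u)) + (d v - u) ^+ 2 by rewrite /Y; ring.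
rewrite lerD2l -[(d v - u) ^+ 2]real_normK ?num_real // lerXn2r ?nnegrE //.
  by apply: le_trans (fC _ (inv_deg_ge iG vt)).
by apply: fC; apply: inv_deg_ge iG vt.
Qed.

(* If [c t i] is a deterministic prediction of [vsum f t G_{t,i}], then the L2
   norm of the deviation grows by at most the L2 prediction error [e t] of each
   increment, plus a fluctuation of order the square root of the number of
   edges. *)
Theorem L2_growth f (c : nat -> nat -> R) (e : nat -> R) (C : R) :
  (forall t, 0 <= e t) -> 0 <= C ->
  (forall t, (2 <= t)%N -> c t.+1 0%N = c t m + f m) ->
  (forall t i k, (2 <= t)%N -> (i < m)%N -> (m <= k)%N ->
     `|f k.+1 - f k - (c t i.+1 - c t i)| <= C) ->
  (forall t i, (2 <= t)%N -> (i < m)%N ->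
     expect (step_law delta t i) (fun G => (vsum f t G - c t i) *
        (drift (delta t) f t i G - (c t i.+1 - c t i)))
     <= nrm (step_law delta t i) (fun G => vsum f t G - c t i) * e t) ->
  forall t i, (2 <= t)%N -> (i <= m)%N ->
    nrm (step_law delta t i) (fun G => vsum f t G - c t i)
    <= C * Num.sqrt (m * t)%:R + `|2 * f m - c 2%N 0%N|
       + m%:R * \sum_(2 <= s < t.+1) e s.
Proof.
move=> e0 C0 cS fC drC.
pose x t i := nrm (step_law delta t i) (fun G => vsum f t G - c t i).
pose b := `|2 * f m - c 2%N 0%N|.
(* The norm is carried as sqrt A + E: fluctuations add up in squares inside A, prediction errors
   linearly in E. Merging the two earlier would turn the square root into a linear bound. *)
suff key : forall t i, (2 <= t)%N -> (i <= m)%N ->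
    x t i <= Num.sqrt (C ^+ 2 * (m * (t - 2) + i)%:R) +
      (b + m%:R * \sum_(2 <= s < t) e s + i%:R * e t).
  move=> t i t2 im; apply: (le_trans (key t i t2 im)).
  rewrite sqrtrM ?sqr_ge0 // sqrtr_sqr ger0_norm // -!addrA; apply: lerD.
    rewrite ler_wpM2l // ler_wsqrtr // ler_nat.
    by move: t2 im; case: t => [|[|t]] // _; nia.
  rewrite lerD2l big_nat_recr //= mulrDr lerD2l ler_wpM2r //.
  by rewrite ler_nat.
have edge t i : (2 <= t)%N -> (i < m)%N -> forall A E, 0 <= A -> 0 <= E ->
    x t i <= Num.sqrt A + E -> x t i.+1 <= Num.sqrt (A + C ^+ 2) + (E + e t).
  move=> t2 im A E A0 E0 xAE.
  have law := is_law_step i t2; have lawS := is_law_step i.+1 t2.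
  have xx : x t i.+1 ^+ 2 <= x t i ^+ 2 + 2 * (x t i * e t) + C ^+ 2.
    rewrite (sqr_nrm lawS) expect_step_edge //.
    apply: (@le_trans _ _ (expect (step_law delta t i) (fun G =>
       (vsum f t G - c t i) ^+ 2 + 2 * ((vsum f t G - c t i) *
        (drift (delta t) f t i G - (c t i.+1 - c t i))) + C ^+ 2))).
      apply: (expect_le law) => G iG.
      have -> : (fun H => (vsum f t H - c t i.+1) ^+ 2) =
         (fun H => (vsum f t H - (c t i + (c t i.+1 - c t i))) ^+ 2).
        by apply/funext => H; congr (_ ^+ 2); ring.
      apply: edge_second_moment => // k mk; exact: fC.
    rewrite !expectD expectZ (expect_cst law) -(sqr_nrm law) lerD2r lerD2l.
    by rewrite ler_pM2l // drC.
  have x0 : 0 <= x t i by apply: nrm_ge0.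
  have xS0 : 0 <= x t i.+1 by apply: nrm_ge0.
  have et := e0 t.
  set s1 := Num.sqrt (A + _).
  have h1 : s1 ^+ 2 = A + C ^+ 2 by rewrite sqr_sqrtr // addr_ge0 ?sqr_ge0.
  have h2 : Num.sqrt A ^+ 2 = A by rewrite sqr_sqrtr.
  have s10 : 0 <= s1 by apply: sqrtr_ge0.
  have s20 := sqrtr_ge0 A.
  have h3 : Num.sqrt A <= s1 by apply: ler_wsqrtr; rewrite lerDl sqr_ge0.
  rewrite -(@ler_pXn2r _ 2) ?nnegrE ?addr_ge0 //; apply: (le_trans xx).
  have h4 : (x t i + e t) ^+ 2 <= (Num.sqrt A + E + e t) ^+ 2.
    by rewrite lerXn2r ?nnegrE ?addr_ge0 // lerD2r.
  have h5 : Num.sqrt A * (E + e t) <= s1 * (E + e t).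
    by rewrite ler_wpM2r // addr_ge0.
  have h6 : (Num.sqrt A + E + e t) ^+ 2 =
    A + 2 * (Num.sqrt A * (E + e t)) + (E + e t) ^+ 2.
    by move: (Num.sqrt A) h2 => q <-; ring.
  have h7 : (s1 + (E + e t)) ^+ 2 =
    A + C ^+ 2 + 2 * (s1 * (E + e t)) + (E + e t) ^+ 2.
    by move: s1 h1 {s10 h3 h5} => q <-; ring.
  have h8 : (x t i + e t) ^+ 2 = x t i ^+ 2 + 2 * (x t i * e t) + e t ^+ 2 by ring.
  by have := sqr_ge0 (e t); rewrite h7; rewrite h8 h6 in h4; lra.
have E0 t i : 0 <= b + m%:R * \sum_(2 <= s < t) e s + i%:R * e t.
  by rewrite !addr_ge0 ?mulr_ge0 ?normr_ge0 ?sumr_ge0.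
have inner t : (2 <= t)%N ->
    x t 0%N <= Num.sqrt (C ^+ 2 * (m * (t - 2))%:R) + (b + m%:R * \sum_(2 <= s < t) e s) ->
    forall i, (i <= m)%N -> x t i <= Num.sqrt (C ^+ 2 * (m * (t - 2) + i)%:R) +
      (b + m%:R * \sum_(2 <= s < t) e s + i%:R * e t).
  move=> t2 h0; elim=> [|i IHi] im; first by rewrite addn0 mul0r addr0.
  have := edge t i t2 im _ _ _ (E0 t i) (IHi (ltnW im)).
  rewrite mulr_ge0 ?sqr_ge0 // => /(_ isT) /le_trans; apply.
  by rewrite addnS -!natr1 mulrDr mulr1 mulrDl mul1r !addrA.
move=> t i t2 im; apply: (inner _ t2 _ _ im); case: t t2 => [|[|t]] // _ {i im}.
elim: t => [|t IHt].
  (* At t = 2, before any new edge, both vertices of G_1 have degree m, so the deviation is a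
     constant. *)
  rewrite subnn muln0 mulr0 sqrtr0 add0r big_geq // mulr0 addr0.
  have law := is_law_step 0%N (leqnn 2).
  rewrite /x -[b]normr_id -(nrm_cst law); apply: (nrm_le law) => G iG /=.
  rewrite /b /vsum.
  have d0 := inv_deg_ge iG (isT : 0 < 2)%N.
  have d1 := inv_deg_ge iG (isT : 1 < 2)%N.
  have : \sum_(0 <= v < 2) deg G v = (2 * m)%N.
    by case/and5P: iG => _ _ _ /eqP -> _; rewrite addn0 muln1.
  rewrite big_nat_recr //= big_nat1 => d01.
  have d0m : deg G 0 = m by lia.
  have d1m : deg G 1 = m by lia.
  rewrite big_nat_recr //= big_nat1 d0m d1m.
  by rewrite mulrDl mul1r.
have := inner t.+2 isT IHt m (leqnn m); rewrite /x.
set n1 := nrm _ _; set n2 := nrm _ _ => n1le.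
(* Passing from (t, m) to (t + 1, 0) draws nothing: the finished vertex, of degree m, enters the
   sum, and [c] moves by the same [f m]. *)
have -> : n2 = n1.
  rewrite /n2 /n1 /nrm expect_step_vertex // PA_law_step //; congr Num.sqrt.
  apply: (eq_expect_law (is_law_step m (isT : 1 < t.+2)%N)) => G iG.
  rewrite cS // -[vsum f t.+3 _]/(vsum f t.+3 G) (vsum_recr _ iG).
  by congr (_ ^+ 2); ring.
apply: (le_trans n1le).
have h : Num.sqrt (C ^+ 2 * (m * (t.+2 - 2) + m)%:R)
    <= Num.sqrt (C ^+ 2 * (m * (t.+3 - 2))%:R).
  by rewrite ler_wsqrtr // ler_wpM2l ?sqr_ge0 // ler_nat; nia.
by rewrite [in leRHS]big_nat_recr //= mulrDr; lra.
Qed.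
End Laws.
End Model.

(** * Sums of the per-step errors *)

Section RealSums.
Context {R : realType}.

Lemma sqrt_nat_ge1 t : (1 <= t)%N -> 1 <= Num.sqrt (t%:R : R).
Proof. by move=> t1; rewrite -{1}sqrtr1 ler_wsqrtr // ler1n. Qed.

Lemma inv_le_inv_sqrt t : (1 <= t)%N -> (t%:R : R)^-1 <= (Num.sqrt t%:R)^-1.
Proof.
move=> t1; have s1 := sqrt_nat_ge1 t1.
rewrite lef_pV2 ?posrE ?ltr0n ?(lt_le_trans ltr01) //.
by rewrite -[leRHS](sqr_sqrtr (ler0n R t)) expr2 ler_peMr // ltW ?(lt_le_trans ltr01).
Qed.

Lemma sqrt_div_nat t : (1 <= t)%N -> Num.sqrt t%:R / t%:R = (Num.sqrt t%:R)^-1 :> R.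
Proof.
move=> t1; have s1 : 0 < Num.sqrt (t%:R : R) by rewrite sqrtr_gt0 ltr0n.
rewrite -[X in _ / X](sqr_sqrtr (ler0n R t)).
by field; rewrite gt_eqF.
Qed.

Lemma sum_inv_sqrt t : (1 <= t)%N ->
  \sum_(2 <= s < t.+1) (Num.sqrt (s%:R : R))^-1 <= 2 * Num.sqrt t%:R.
Proof.
case: t => // t _; elim: t => [|t IHt]; first by rewrite big_geq // mulr_ge0 ?sqrtr_ge0.
rewrite big_nat_recr //=; apply: (le_trans (lerD IHt (lexx _))).
set a := Num.sqrt (t.+1%:R : R); set b := Num.sqrt (t.+2%:R : R).
have a0 : 0 <= a by apply: sqrtr_ge0.
have b0 : 0 < b by rewrite sqrtr_gt0 ltr0n.
have a2 : a ^+ 2 = t.+1%:R by rewrite sqr_sqrtr.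
have b2 : b ^+ 2 = t.+1%:R + 1 by rewrite sqr_sqrtr // -natr1.
rewrite -lerBrDl -(ler_pM2r b0) mulVf ?gt_eqF //.
have : 0 <= (a - b) ^+ 2 by apply: sqr_ge0.
have -> : (a - b) ^+ 2 = a ^+ 2 + b ^+ 2 - 2 * (a * b) by ring.
have -> : (2 * b - 2 * a) * b = 2 * b ^+ 2 - 2 * (a * b) by ring.
by rewrite a2 b2; lra.
Qed.

Lemma sum_after T t :
  \sum_(2 <= s < t.+1) (T < s)%N%:R <= (t - T)%N%:R :> R.
Proof.
elim: t => [|t IHt]; first by rewrite big_geq.
have [t0|t0] := leqP 2 t.+1; last by rewrite big_geq.
rewrite big_nat_recr //=; apply: (le_trans (lerD IHt (lexx _))).
by rewrite -natrD ler_nat; case: ltnP; lia.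
Qed.

Lemma after_div_le T t : (1 <= t)%N -> (t - T)%N%:R / t%:R <= (T < t)%N%:R :> R.
Proof.
move=> t1; rewrite ler_pdivrMr ?ltr0n //.
by rewrite -natrM ler_nat; case: ltnP; lia.
Qed.

End RealSums.

(** * Degree counts *)

Section DegreeCounts.
Context {R : realType}.
Variable m : nat.
Variables delta0 delta1 : R.
Hypothesis d0m : - m%:R < delta0.
Hypothesis d1m : - m%:R < delta1.

Definition dseq T (t : nat) : R := if (t <= T)%N then delta0 else delta1.

Lemma dseq_gt T t : - m%:R < dseq T t.
Proof. by rewrite /dseq; case: ifP. Qed.

Lemma dseq_diff T t : `|dseq T t - delta0| <= `|delta1 - delta0| * (T < t)%N%:R.
Proof.
by rewrite /dseq ltnNge; case: ifP => _ /=; rewrite ?subrr ?normr0 ?mulr0 ?mulr1.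
Qed.

Lemma SnormE t i (x : R) : (1 <= t)%N ->
  Snorm m t i x = t%:R * ((2 * m)%:R + x) - (2 * m)%:R + i%:R.
Proof. by case: t => // t _; rewrite /Snorm /=; ring. Qed.

Local Notation law T t i := (step_law m (dseq T) t i).

(** The truncated difference [(t - T)%N] counts the steps past the changepoint: up to [T] the error
    is of order sqrt t, and each later step may add a constant. *)
Definition err T t : R := Num.sqrt t%:R + (t - T)%N%:R.

Lemma err_ge1 T t : (1 <= t)%N -> 1 <= err T t.
Proof. by move=> t1; rewrite -[1]addr0 lerD ?sqrt_nat_ge1. Qed.

Lemma sum_err T t : (1 <= t)%N ->
  \sum_(2 <= s < t.+1) ((Num.sqrt (s%:R : R))^-1 + (T < s)%N%:R) <= 2 * err T t.
Proof.
move=> t1; rewrite big_split /=; apply: (le_trans (lerD (sum_inv_sqrt t1) (sum_after T t))).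
by rewrite /err mulrDr lerD2l ler_peMl ?ler0n ?ler1n.
Qed.

Lemma err_div_le T t : (1 <= t)%N ->
  err T t / t%:R <= (Num.sqrt t%:R)^-1 + (T < t)%N%:R.
Proof.
by move=> t1; rewrite mulrDl sqrt_div_nat // lerD2l after_div_le.
Qed.

(** The step of the induction on the degree. [f] and [fm] stand for the indicators of the degree [k]
    and of the next lower one [km], with proportions [p] and [pm]. The prediction is linear; the two
    equations for [g] say that the increment per edge matches the drift at [delta0], and that m
    edges together with the new vertex add [p]. *)
Lemma coarse_step (f fm : nat -> R) (p pm k km g Cm : R) :
  (forall l, (m <= l)%N -> `|f l.+1 - f l| <= 1) ->
  (forall x t i G, inv m t i G -> drift m x f t i G =
     ((km + x) * vsum fm t G - (k + x) * vsum f t G) / Snorm m t i x) ->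
  m%:R <= k ->
  ((2 * m)%:R + delta0) * g = (km + delta0) * pm - (k + delta0) * p ->
  m%:R * g = p - f m ->
  0 <= Cm ->
  (forall T t i, (2 <= t)%N -> (i <= m)%N ->
     nrm (law T t i) (fun G => vsum fm t G - pm * t%:R) <= Cm * err T t) ->
  exists2 C, 0 <= C & forall T t i, (2 <= t)%N -> (i <= m)%N ->
     nrm (law T t i) (fun G => vsum f t G - p * t%:R) <= C * err T t.
Proof.
move=> fC driftE mk gE pg Cm0 Hm.
pose mu := Num.min (m%:R + delta0) (m%:R + delta1).
have mu0 : 0 < mu by rewrite lt_min -!ltrBlDl !sub0r d0m d1m.
pose X := `|delta0| + `|delta1|.
have X0 : 0 <= X by rewrite addr_ge0.
have dX T t : `|dseq T t| <= X.
  by rewrite /dseq /X; case: ifP => _; rewrite ?lerDl ?lerDr.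
have muS T t i : (2 <= t)%N -> t%:R * mu <= Snorm m t i (dseq T t).
  move=> t2; apply: le_trans (Snorm_ge _ _ _ t2); rewrite ler_wpM2l //.
  by rewrite /dseq; case: ifP => _; rewrite ge_min lexx ?orbT.
pose A1 := (`|km| + X) / mu.
pose A2 := `|delta1 - delta0| * `|pm - p - g| / mu.
pose A3 := ((`|k| + X) * m%:R * `|g| + `|g| * (2 * m)%:R) / mu.
have A10 : 0 <= A1 by rewrite divr_ge0 ?addr_ge0 // ltW.
have A20 : 0 <= A2 by rewrite divr_ge0 ?mulr_ge0 // ltW.
have A30 : 0 <= A3 by rewrite divr_ge0 ?addr_ge0 ?mulr_ge0 ?addr_ge0 // ltW.
pose D := A1 * Cm + A2 + A3.
have D0 : 0 <= D by apply: addr_ge0 => //; apply: addr_ge0 => //; apply: mulr_ge0.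
pose e T t : R := D * ((Num.sqrt t%:R)^-1 + (T < t)%N%:R).
pose c t i : R := p * t%:R + i%:R * g.
have cS t i : c t i.+1 - c t i = g by rewrite /c -natr1; ring.
have rest_le T t i G : (2 <= t)%N -> (i <= m)%N -> inv m t i G ->
   (vsum f t G - c t i) * (drift m (dseq T t) f t i G - g) <=
   `|vsum f t G - c t i| * (A1 / t%:R * `|vsum fm t G - pm * t%:R|
       + (A2 * (T < t)%N%:R + A3 / t%:R)).
  move=> t2 im iG; have t0 : 0 < t%:R :> R by rewrite ltr0n ltnW.
  have S0 : 0 < Snorm m t i (dseq T t) by apply: Snorm_gt0 => //; apply: dseq_gt.
  have tS := muS T t i t2; have xd := dseq_diff T t; have xX := dX T t.
  have xm := dseq_gt T t.
  rewrite driftE //; set S := Snorm _ _ _ _ in S0 tS *; set x := dseq T t in xd xX xm *.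
  set Y := vsum f t G - c t i; set Z := vsum fm t G - pm * t%:R.
  (* What is left of the error once the multiple (k + x) / S of Y is split off: the error of the
     lower count, the change of parameter after T, and two bounded terms, from the offset i g and
     from S = t (2m + x) - (2m - i). After division by S >= t mu, these three groups are bounded
     through [A1], [A2] and [A3]. *)
  pose rest := ((km + x) * Z + t%:R * (x - delta0) * (pm - p - g)
     - (k + x) * i%:R * g - g * (i%:R - (2 * m)%:R)) / S.
  have SE : S = t%:R * ((2 * m)%:R + x) - (2 * m)%:R + i%:R.
    by rewrite /S SnormE // ltnW.
  have -> : ((km + x) * vsum fm t G - (k + x) * vsum f t G) / S - g =
     rest - (k + x) / S * Y.
    suff NE : (km + x) * Z + t%:R * (x - delta0) * (pm - p - g)
        - (k + x) * i%:R * g - g * (i%:R - (2 * m)%:R) =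
        (km + x) * vsum fm t G - (k + x) * vsum f t G - g * S + (k + x) * Y.
      by rewrite /rest NE; field; rewrite gt_eqF.
    rewrite SE /Y /Z /c.
    have -> : (km + x) * (vsum fm t G - pm * t%:R) = (km + x) * vsum fm t G
      - t%:R * ((km + delta0) * pm - (k + delta0) * p)
      - t%:R * (x - delta0) * pm - t%:R * (k + delta0) * p by ring.
    by rewrite -gE; ring.
  have kx : 0 <= (k + x) / S by apply: divr_ge0; [lra|exact: ltW].
  (* The term in Y ^ 2 has the good sign and is dropped. *)
  rewrite mulrBr.
  apply: (@le_trans _ _ (Y * rest)).
    have -> : Y * ((k + x) / S * Y) = (k + x) / S * Y ^+ 2 by ring.
    by rewrite gerBl mulr_ge0 ?sqr_ge0.
  apply: le_trans (ler_norm _) _; rewrite normrM ler_wpM2l //.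
  rewrite /rest normrM normfV (gtr0_norm S0) ler_pdivrMr //.
  set N := (A1 / t%:R * _ + _).
  have N0 : 0 <= N.
    apply: addr_ge0; first by apply: mulr_ge0 => //; apply: divr_ge0.
    by apply: addr_ge0; [apply: mulr_ge0|apply: divr_ge0].
  apply: (@le_trans _ _ (N * (t%:R * mu))); last by rewrite ler_wpM2l.
  have -> : N * (t%:R * mu) = (`|km| + X) * `|Z| + t%:R * (`|delta1 - delta0| * (T < t)%N%:R) * `|pm - p - g|
     + (`|k| + X) * m%:R * `|g| + `|g| * (2 * m)%:R.
    by rewrite /N /A1 /A2 /A3; field; rewrite !gt_eqF.
  apply: (le_trans (ler_normB _ _)); apply: lerD; last first.
    rewrite normrM ler_wpM2l // ler_norml.
    have : i%:R <= m%:R :> R by rewrite ler_nat.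
    by have := ler0n R i; rewrite natrM; have := ler0n R m; lra.
  apply: (le_trans (ler_normB _ _)); apply: lerD; last first.
    rewrite !normrM ler_wpM2r // ler_pM // ?normr_nat ?ler_nat //.
    by apply: (le_trans (ler_normD _ _)); rewrite lerD2l.
  apply: (le_trans (ler_normD _ _)); apply: lerD.
    rewrite normrM ler_wpM2r //.
    by apply: (le_trans (ler_normD _ _)); rewrite lerD2l.
  by rewrite !normrM ler_wpM2r // normr_nat ler_wpM2l.
pose C := (1 + `|g|) * Num.sqrt m%:R + `|2 * f m - c 2%N 0%N| + m%:R * D * 2 + m%:R * `|g|.
exists C; first by rewrite /C; nonneg.
move=> T t i t2 im.
have tt1 := ltnW t2.
have lawt := is_law_step (dseq_gt T) i t2.
have := @L2_growth R m (dseq T) (dseq_gt T) f c (e T) (1 + `|g|) _ _ _ _ _ t i t2 im.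
have e0 s : 0 <= e T s by rewrite /e; nonneg.
have cV s : (2 <= s)%N -> c s.+1 0%N = c s m + f m.
  by move=> _; rewrite /c pg -natr1; ring.
have fg s j l : (2 <= s)%N -> (j < m)%N -> (m <= l)%N ->
    `|f l.+1 - f l - (c s j.+1 - c s j)| <= 1 + `|g|.
  by move=> _ _ ml; rewrite cS; apply: (le_trans (ler_normB _ _)); rewrite lerD2r fC.
move=> /(_ e0 _ cV fg) H; apply: (@le_trans _ _
    (nrm (law T t i) (fun G => vsum f t G - c t i) + nrm (law T t i) (fun=> i%:R * g))).
  rewrite (@eq_nrm _ _ _ _ (fun G => vsum f t G - c t i + i%:R * g)) ?(nrmD lawt) //.
  by move=> G; rewrite /c; ring.
have E1 := err_ge1 T tt1.
have H2 : nrm (law T t i) (fun=> i%:R * g) <= m%:R * `|g| * err T t.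
  rewrite (nrm_cst lawt) normrM normr_nat.
  apply: (@le_trans _ _ (m%:R * `|g|)); first by rewrite ler_wpM2r // ler_nat.
  by rewrite ler_peMr ?mulr_ge0.
rewrite mulrDl; apply: lerD H2; apply: (le_trans (H _ _)); rewrite ?addr_ge0 //.
  move=> s j s2 jm; have laws := is_law_step (dseq_gt T) j s2.
  have ss1 := ltnW s2.
  apply: (@le_trans _ _ (expect (law T s j) (fun G => `|vsum f s G - c s j| *
     (A1 / s%:R * `|vsum fm s G - pm * s%:R| + (A2 * (T < s)%N%:R + A3 / s%:R))))).
    by apply: (expect_le laws) => G iG; rewrite cS rest_le // ltnW.
  apply: (le_trans (cauchy_schwarz laws _ _)); rewrite nrm_norm ler_wpM2l ?nrm_ge0 //.
  apply: (le_trans (nrmD laws _ _)); rewrite (nrm_cst laws) nrmZ nrm_norm.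
  have n1 : 0 <= A1 / s%:R by nonneg.
  have n2 : 0 <= A2 * (T < s)%N%:R + A3 / s%:R by nonneg.
  rewrite (ger0_norm n1) (ger0_norm n2).
  have h1 : A1 / s%:R * nrm (law T s j) (fun G => vsum fm s G - pm * s%:R) <=
      A1 * Cm * ((Num.sqrt s%:R)^-1 + (T < s)%N%:R).
    apply: (@le_trans _ _ (A1 / s%:R * (Cm * err T s))).
      by apply: (ler_wpM2l n1); apply: Hm => //; apply: ltnW.
    have -> : A1 / s%:R * (Cm * err T s) = A1 * Cm * (err T s / s%:R) by ring.
    by apply: ler_wpM2l; [nonneg|apply: err_div_le].
  have h2 : A3 / s%:R <= A3 * (Num.sqrt s%:R)^-1.
    by apply: ler_wpM2l => //; apply: inv_le_inv_sqrt.
  have h3 : 0 <= A2 * (Num.sqrt s%:R)^-1 by nonneg.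
  have h4 : 0 <= A3 * (T < s)%N%:R by nonneg.
  by rewrite /e /D; lra.
have h1 : (1 + `|g|) * Num.sqrt (m * t)%:R <= (1 + `|g|) * Num.sqrt m%:R * err T t.
  rewrite natrM sqrtrM // mulrA; apply: ler_wpM2l; first by nonneg.
  by rewrite lerDl.
have h2 : `|2 * f m - c 2%N 0%N| <= `|2 * f m - c 2%N 0%N| * err T t.
  by rewrite ler_peMr.
have h3 : m%:R * \sum_(2 <= s < t.+1) e T s <= m%:R * D * 2 * err T t.
  rewrite -mulr_sumr -!mulrA; apply: ler_wpM2l => //.
  by apply: ler_wpM2l => //; apply: sum_err.
by apply: (le_trans (lerD (lerD h1 h2) h3)); rewrite -!mulrDl.
Qed.

End DegreeCounts.

(** * Limiting degree proportions and their moments *)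

Section DegreeProportions.
Context {R : realType}.
Variable m : nat.
Hypothesis m1 : (1 <= m)%N.
Variables delta0 delta1 : R.
Hypothesis d0m : - m%:R < delta0.
Hypothesis d1m : - m%:R < delta1.
Local Notation law T t i := (step_law m (dseq delta0 delta1 T) t i).

(* The limiting proportion of vertices of degree m + j. *)
Definition pdeg x j : R :=
  iteri j (fun i p => p * (m%:R + i%:R + x) / (m%:R + i.+1%:R + x + 2 + x / m%:R))
    (p_m m x).

Lemma pdegS x j : pdeg x j.+1 =
  pdeg x j * (m%:R + j%:R + x) / (m%:R + j.+1%:R + x + 2 + x / m%:R).
Proof. by []. Qed.

Arguments pdeg : simpl never.

Definition ind j (k : nat) : R := (k == m + j)%N%:R.

Lemma drift_ind0 x t i G : inv m t i G ->
  drift m x (ind 0) t i G =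
  ((0 + x) * vsum (fun=> 0) t G - (m%:R + x) * vsum (ind 0) t G) / Snorm m t i x.
Proof.
move=> iG; rewrite /drift mulrC; congr (_ / _).
have -> : vsum (fun=> 0 : R) t G = 0 by rewrite /vsum big1.
rewrite mulr0 sub0r -mulNr /vsum mulr_sumr; apply: eq_big_nat => v /= vt.
have mv := inv_deg_ge iG vt; rewrite /ind addn0 [in X in X - _]gtn_eqF ?ltnS //.
by case: eqP => [->|_] /=; ring.
Qed.

Lemma drift_indS x t i j G :
  drift m x (ind j.+1) t i G =
  ((m%:R + j%:R + x) * vsum (ind j) t G
   - (m%:R + j.+1%:R + x) * vsum (ind j.+1) t G) / Snorm m t i x.
Proof.
rewrite /drift mulrC; congr (_ / _).
rewrite /vsum !mulr_sumr -sumrB; apply: eq_bigr => v _.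
rewrite /ind addnS eqSS -addnS -!natrD mulrBr; congr (_ - _).
  by case: eqP => [->|_]; rewrite ?mulr0.
by case: eqP => [->|_]; rewrite ?mulr0.
Qed.

(* The expected increment per edge of the number of vertices of degree m + j. *)
Definition gdeg j : R := (pdeg delta0 j - ind 0 (m + j)) / m%:R.

Lemma mgdeg j : m%:R * gdeg j = pdeg delta0 j - ind j m.
Proof.
rewrite /gdeg mulrC divfK ?pnatr_eq0 -?lt0n //; congr (_ - _).
by rewrite /ind addn0 eq_sym.
Qed.

Lemma gdegE0 : ((2 * m)%:R + delta0) * gdeg 0 =
  (0 + delta0) * 0 - (m%:R + delta0) * pdeg delta0 0.
Proof.
have mp : 1 <= m%:R :> R by rewrite ler1n.
have d := d0m.
rewrite /gdeg /ind addn0 eqxx /= /pdeg /= /p_m natrM; field.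
rewrite !gt_eqF //=; last lra.
have : 0 < m%:R * (m%:R + delta0) by rewrite mulr_gt0; lra.
by lra.
Qed.

Lemma gdegES j : ((2 * m)%:R + delta0) * gdeg j.+1 =
  (m%:R + j%:R + delta0) * pdeg delta0 j - (m%:R + j.+1%:R + delta0) * pdeg delta0 j.+1.
Proof.
have mp : 1 <= m%:R :> R by rewrite ler1n.
have d := d0m; have j0 : 0 <= j%:R :> R by [].
rewrite /gdeg /ind eqn_add2l pdegS /= subr0 natrM -[in LHS]natr1 -[in RHS]natr1; field.
rewrite !gt_eqF //=; last lra.
have : 0 < m%:R * (m%:R + delta0) by rewrite mulr_gt0; lra.
have : 0 <= j%:R * m%:R :> R by nonneg.
by lra.
Qed.

Lemma pdeg_gt0 j : 0 < pdeg delta0 j.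
Proof.
have mp : 1 <= m%:R :> R by rewrite ler1n.
have d := d0m.
have dm : - 1 < delta0 / m%:R by rewrite ltr_pdivlMr; lra.
elim: j => [|j IHj]; first by rewrite /pdeg /= /p_m divr_gt0 //; lra.
have j0 : 0 <= j%:R :> R by [].
by rewrite pdegS -natr1 divr_gt0 ?mulr_gt0 //; lra.
Qed.

Local Notation X := ((2 * m)%:R + delta0).
Local Notation flux K := (m%:R / X * ((m%:R + K%:R + delta0) * pdeg delta0 K)).

Lemma X_gt0 : 0 < X.
Proof.
have mp : 1 <= m%:R :> R by rewrite ler1n.
by have d := d0m; rewrite natrM; lra.
Qed.

(** The recursion telescopes: among the degrees up to m + K only the flow out of the top one
    remains. *)
Lemma sum_gdeg K :
  X * \sum_(0 <= j < K.+1) gdeg j = - ((m%:R + K%:R + delta0) * pdeg delta0 K).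
Proof.
elim: K => [|K IHK]; first by rewrite big_nat1 gdegE0; ring.
by rewrite big_nat_recr //= mulrDr IHK gdegES; ring.
Qed.

Lemma ind_m j : ind j m = (j == 0%N)%:R.
Proof. by rewrite /ind -{1}[m]addn0 eqn_add2l eq_sym. Qed.

(** The missing mass [flux K] is the proportion of vertices of degree above m + K, fed by the flow
    out of m + K along m edges per step. *)
Lemma sum_pdeg K : \sum_(0 <= j < K.+1) pdeg delta0 j = 1 - flux K.
Proof.
have X0 := X_gt0; have := sum_gdeg K.
have -> : \sum_(0 <= j < K.+1) gdeg j = (\sum_(0 <= j < K.+1) pdeg delta0 j - 1) / m%:R.
  rewrite /gdeg -mulr_suml sumrB; congr ((_ - _) / _).
  rewrite big_nat_recl //= big_nat big1 ?addr0 => [|j _].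
    by rewrite /ind addn0 eqxx.
  by rewrite /ind addn0 -[X in _ == X]addn0 eqn_add2l.
set P := \sum_(_ <= _ < _) _ => e.
have mp : m%:R != 0 :> R by rewrite pnatr_eq0 -lt0n.
apply/eqP; rewrite -subr_eq0; apply/eqP.
have -> : P - (1 - flux K) = (X * ((P - 1) / m%:R) + (m%:R + K%:R + delta0) * pdeg delta0 K) * m%:R / X.
  by field; rewrite mp -natrM gt_eqF.
by rewrite e; ring.
Qed.

(** Weighting the recursion by the degree and summing by parts reproduces the unknown moment, with
    total coefficient X - m = m + delta0 up to a factor m; hence the product on the left. *)
Lemma sum_degree_pdeg K :
  \sum_(0 <= j < K.+1) (m%:R + j%:R + delta0) * pdeg delta0 j * (m%:R + delta0)
  = X * (m%:R + delta0 - flux K * (m%:R + K.+1%:R + delta0)).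
Proof.
have X0 := X_gt0; have mp : m%:R != 0 :> R by rewrite pnatr_eq0 -lt0n.
rewrite -mulr_suml; set M := \sum_(_ <= _ < _) _.
have h : X * \sum_(0 <= j < K.+1) (m%:R + j%:R) * gdeg j =
    M - (m%:R + K.+1%:R) * ((m%:R + K%:R + delta0) * pdeg delta0 K).
  rewrite /M; elim: K {M} => [|K IHK].
    by rewrite !big_nat1 mulrCA gdegE0; ring.
  rewrite big_nat_recr //= mulrDr IHK [in RHS]big_nat_recr //= [X * (_ * gdeg _)]mulrCA gdegES.
  by rewrite -!natr1; ring.
have h2 : \sum_(0 <= j < K.+1) (m%:R + j%:R) * gdeg j =
   (M - delta0 * (1 - flux K) - m%:R) / m%:R.
  apply: (mulIf mp); rewrite divfK // -sum_pdeg /M.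
  rewrite big_distrl /= mulr_sumr -sumrB.
  transitivity (\sum_(0 <= j < K.+1) ((m%:R + j%:R) * pdeg delta0 j - (m%:R + j%:R) * ind j m)).
    by apply: eq_bigr => j _; rewrite -mulrA [_ * m%:R]mulrC mgdeg; ring.
  rewrite [LHS]sumrB; congr (_ - _); first by apply: eq_bigr => j _; ring.
  rewrite big_nat_recl //= big_nat big1 ?addr0 => [|j _].
    by rewrite ind_m eqxx ?addr0 mulr1.
  by rewrite ind_m mulr0.
have h3 : M * (m%:R + delta0) = (X * (M / m%:R) - M) * m%:R.
  by rewrite natrM; field.
have h4 : M = X * ((M - delta0 * (1 - flux K) - m%:R) / m%:R) +
   (m%:R + K.+1%:R) * ((m%:R + K%:R + delta0) * pdeg delta0 K).
  by rewrite -h2 h; ring.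
rewrite h3 [X in _ - X]h4 -natr1; field.
by rewrite mp -natrM gt_eqF.
Qed.

(** Up to the factor (x - y) / (2m + x), the drift per edge of the score at y when the parameter is
    x: the limiting average of 1 / (D_v + delta0), cut off at degree m + K, minus the limit of t /
    S. *)
Definition wlim K : R := \sum_(0 <= j < K) pdeg delta0 j / (m%:R + j%:R + delta0) - X^-1.

(* [wlim] is a truncated variance: up to the tail, it is the sum of
   p_k (k - 2m)^2 / (k + delta0) divided by (2m + delta0)^2; the k = m term is
   the lower bound. *)
Lemma wlim_ge K :
  pdeg delta0 0 * m%:R ^+ 2 / ((m%:R + delta0) * X ^+ 2) - 2 / K.+1%:R <= wlim K.+1.
Proof.
have X0 := X_gt0; have mp : 1 <= m%:R :> R by rewrite ler1n.
have d := d0m; have K0 : 0 <= K%:R :> R by [].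
have pos j : 0 < m%:R + j%:R + delta0 by have := ler0n R j; lra.
set P := \sum_(0 <= j < K.+1) pdeg delta0 j.
set M := \sum_(0 <= j < K.+1) (m%:R + j%:R + delta0) * pdeg delta0 j.
set A := \sum_(0 <= j < K.+1) pdeg delta0 j / (m%:R + j%:R + delta0).
have flux0 : 0 <= flux K.
  have pK := pos K; have qK := pdeg_gt0 K.
  by apply: mulr_ge0; apply: mulr_ge0; rewrite ?invr_ge0 ?ler0n ?ltW.
have ME : M * (m%:R + delta0) = X * (m%:R + delta0 - flux K * (m%:R + K.+1%:R + delta0)).
  by rewrite -sum_degree_pdeg mulr_suml.
have M0 : 0 <= M by apply: sumr_ge0 => j _; rewrite mulr_ge0 ?ltW ?pdeg_gt0.
have md : 0 < m%:R + delta0 by lra.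
have MX : M <= X.
  rewrite -(ler_pM2r md) ME ler_pM2l // gerBl mulr_ge0 //.
  exact/ltW/pos.
(* The tail bound follows from M >= 0, which by [ME] forces flux K (m + K + 1 + delta0) <= m +
   delta0. *)
have fluxK : flux K <= (m%:R + delta0) / K.+1%:R.
  rewrite ler_pdivlMr ?ltr0n //.
  have : 0 <= X * (m%:R + delta0 - flux K * (m%:R + K.+1%:R + delta0)).
    by rewrite -ME mulr_ge0 // ltW.
  rewrite pmulr_rge0 // subr_ge0; apply: le_trans.
  by rewrite ler_wpM2l //; lra.
(* Termwise expansion of (X - b)^2 / b with b = m + j + delta0, where X - b = m - j. *)
have TE : X ^+ 2 * A - 2 * X * P + M = \sum_(0 <= j < K.+1)
    pdeg delta0 j * (j%:R - m%:R) ^+ 2 / (m%:R + j%:R + delta0).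
  rewrite /A /P /M !mulr_sumr -sumrB -big_split /=; apply: eq_bigr => j _.
  by have := pos j => /lt0r_neq0 h; rewrite natrM; field.
have TT : pdeg delta0 0 * m%:R ^+ 2 / (m%:R + delta0) <= X ^+ 2 * A - 2 * X * P + M.
  rewrite TE big_nat_recl //= sub0r sqrrN addr0 lerDl sumr_ge0 // => j _.
  by have pj := pos j.+1; have qj := pdeg_gt0 j.+1; nonneg.
have PE : P = 1 - flux K by rewrite /P sum_pdeg.
have X2 : 0 < X ^+ 2 by rewrite exprn_gt0.
have mX : m%:R + delta0 <= X by rewrite natrM; lra.
rewrite /wlim -/A -(ler_pM2l X2).
have -> : X ^+ 2 * (A - X^-1) = X ^+ 2 * A - X.
  by field; rewrite -natrM gt_eqF.
have -> : X ^+ 2 * (pdeg delta0 0 * m%:R ^+ 2 / ((m%:R + delta0) * X ^+ 2) - 2 / K.+1%:R)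
  = pdeg delta0 0 * m%:R ^+ 2 / (m%:R + delta0) - 2 * (X * (X / K.+1%:R)).
  by field; rewrite -natrM !gt_eqF.
have h5 : X * flux K <= X * (X / K.+1%:R).
  rewrite ler_pM2l //; apply: (le_trans fluxK).
  by apply: ler_wpM2r mX; rewrite invr_ge0.
rewrite PE in TT.
have key (Y A' F T U M' : R) : M' <= Y -> Y * F <= Y * U ->
  T <= Y ^+ 2 * A' - 2 * Y * (1 - F) + M' -> T - 2 * (Y * U) <= Y ^+ 2 * A' - Y.
  by move=> *; lra.
exact: key MX h5 TT.
Qed.

Lemma count_concentration j : exists2 C, 0 <= C &
  forall T t i, (2 <= t)%N -> (i <= m)%N ->
  nrm (law T t i) (fun G => vsum (ind j) t G - pdeg delta0 j * t%:R) <= C * err T t.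
Proof.
have ind_le l k : `|ind l k.+1 - ind l k| <= 1.
  by rewrite /ind; do 2!case: eqP => _ /=; rewrite ?subrr ?subr0 ?sub0r ?normrN ?normr0 ?normr1.
elim: j => [|j [C C0 IHj]].
  (* No vertex below the new one has degree less than m, so the lowest count has no inflow. *)
  apply: (coarse_step d0m d1m (fm := fun=> 0) (pm := 0) (k := m%:R) (km := 0)
    (g := gdeg 0) (Cm := 0)) => //.
  - by move=> x t i G; apply: drift_ind0.
  - exact: gdegE0.
  - exact: mgdeg.
  - move=> T t i t2 im; rewrite [_ * err _ _]mul0r.
    rewrite (@eq_nrm _ _ _ _ (fun=> 0)) => [|G]; last by rewrite /vsum big1 // ?mul0r subr0.
    by rewrite (nrm_cst (is_law_step (dseq_gt d0m d1m T) i t2)) normr0.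
apply: (coarse_step d0m d1m (fm := ind j) (pm := pdeg delta0 j) (k := m%:R + j.+1%:R)
  (km := m%:R + j%:R) (g := gdeg j.+1) (Cm := C)) => //.
- by move=> x t i G _; apply: drift_indS.
- by rewrite lerDl.
- exact: gdegES.
- exact: mgdeg.
Qed.

End DegreeProportions.

(** * Accumulated errors of the refined predictions *)

Section ErrorSums.
Context {R : realType}.

Lemma after_div_mono T s t : (1 <= s)%N -> (s <= t)%N ->
  (s - T)%N%:R / s%:R <= (T < s)%N%:R * ((t - T)%N%:R / t%:R) :> R.
Proof.
move=> s1 st; have s0 : 0 < s%:R :> R by rewrite ltr0n.
have t0 : 0 < t%:R :> R by rewrite ltr0n (leq_trans s1).
rewrite mulrA ler_pdivrMr // mulrAC ler_pdivlMr // -!natrM ler_nat.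
case: ltnP => h; last by move: h; rewrite -subn_eq0 => /eqP ->.
by rewrite mul1n !mulnBl [(t * s)%N]mulnC leq_sub2l // leq_mul2l st orbT.
Qed.

(** Feeding the coarse error back through a drift divides it by s. As (s - T) / s increases with s,
    the part after the changepoint adds up to order (t - T)^2 / t, that is n^(2 gamma - 1),
    negligible against n^gamma. *)
Lemma sum_err_div T t : (1 <= t)%N ->
  \sum_(2 <= s < t.+1) err T s / s%:R <=
  2 * (Num.sqrt t%:R + (t - T)%N%:R ^+ 2 / t%:R) :> R.
Proof.
move=> t1; apply: (@le_trans _ _ (\sum_(2 <= s < t.+1)
   ((Num.sqrt s%:R)^-1 + (T < s)%N%:R * ((t - T)%N%:R / t%:R)))).
  apply: ler_sum_nat => s /andP[s2 st].
  rewrite mulrDl sqrt_div_nat ?lerD2l ?after_div_mono // ltnW //.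
rewrite big_split /= -mulr_suml mulrDr; apply: lerD; first exact: sum_inv_sqrt.
have h : 0 <= (t - T)%N%:R / t%:R :> R by nonneg.
apply: (le_trans (ler_wpM2r h (sum_after T t))).
by rewrite mulrA -expr2 ler_peMl ?ler1n // divr_ge0 // sqr_ge0.
Qed.

End ErrorSums.

(** * Prediction of N_m across the changepoint *)

Section Predictions.
Context {R : realType}.
Variable m : nat.
Hypothesis m1 : (1 <= m)%N.
Variables delta0 delta1 dmin dmax : R.
Hypothesis dminm : - m%:R < dmin.
Hypothesis d0min : dmin <= delta0.
Hypothesis d0max : delta0 <= dmax.
Hypothesis d1min : dmin <= delta1.
Hypothesis d1max : delta1 <= dmax.

Let d0m : - m%:R < delta0 := lt_le_trans dminm d0min.
Let d1m : - m%:R < delta1 := lt_le_trans dminm d1min.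
Local Notation x := (dseq delta0 delta1).
Local Notation law T t i := (step_law m (x T) t i).
Local Notation mu := (m%:R + dmin).
Local Notation X d := ((2 * m)%:R + d).

Let mu_gt0 : 0 < mu.
Proof. by rewrite -ltrBlDl sub0r. Qed.

Lemma dseq_range T t : dmin <= x T t <= dmax.
Proof. by rewrite /dseq; case: ifP => _; apply/andP. Qed.

Lemma mu_le_X y : dmin <= y -> mu <= X y.
Proof. by move=> ydmin; have := ler0n R m; rewrite natrM; lra. Qed.

Lemma Snorm_mu t i y : dmin <= y -> (2 <= t)%N -> t%:R * mu <= Snorm m t i y.
Proof.
move=> ydmin t2; apply: le_trans (Snorm_ge m i y t2).
by apply: ler_wpM2l => //; lra.
Qed.

Lemma ratio_Snorm t i y : dmin <= y -> (2 <= t)%N -> (i <= m)%N ->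
  `|t%:R / Snorm m t i y - (X y)^-1| <= (2 * m)%:R / mu ^+ 2 / t%:R.
Proof.
move=> ydmin t2 im; have t0 : 0 < t%:R :> R by rewrite ltr0n ltnW.
have tS := Snorm_mu i ydmin t2; have Xmu := mu_le_X ydmin.
have tmu : 0 < t%:R * mu by rewrite mulr_gt0.
have S0 := lt_le_trans tmu tS; have X0 := lt_le_trans mu_gt0 Xmu.
have -> : t%:R / Snorm m t i y - (X y)^-1 =
    ((2 * m)%:R - i%:R) / (Snorm m t i y * X y).
  have SE := SnormE m i y (ltnW t2).
  have -> : (2 * m)%:R - i%:R = t%:R * X y - Snorm m t i y by rewrite SE; ring.
  by move: (Snorm _ _ _ _) S0 (X y) X0 => S S0 Y Y0; field; rewrite !gt_eqF.
have i0 : 0 <= i%:R :> R by [].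
have i1 : i%:R <= (2 * m)%:R :> R by rewrite ler_nat (leq_trans im) // leq_pmull.
have SX : 0 < Snorm m t i y * X y by rewrite mulr_gt0.
rewrite ger0_norm; last by apply: divr_ge0; [lra|exact: ltW].
rewrite -mulrA -invfM; apply: ler_pM => //; first lra.
- by rewrite invr_ge0 ltW.
- lra.
rewrite lef_pV2 ?posrE // ?mulr_gt0 ?exprn_gt0 //.
have -> : mu ^+ 2 * t%:R = t%:R * mu * mu by ring.
by apply: ler_pM => //; apply: ltW.
Qed.

(** The increment per edge of the number of vertices of degree m when the parameter is [d] while
    their proportion is still p_m(delta0). *)
Definition gleaf d : R := - ((m%:R + d) * p_m m delta0 / X d).

Definition leaf_target T t i : R :=
  p_m m delta0 * t%:R +
  \sum_(2 <= s < t) m%:R * (gleaf (x T s) - gleaf delta0) + i%:R * gleaf (x T t).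

(** Bootstraps [count_concentration]: the drift uses the true parameter but freezes the proportion
    at p_m(delta0), which costs err / s per step instead of a constant. *)
Lemma leaf_concentration : exists2 C, 0 <= C &
  forall T t i, (2 <= t)%N -> (i <= m)%N ->
  nrm (law T t i) (fun G => vsum (ind m 0) t G - leaf_target T t i)
  <= C * (Num.sqrt t%:R + (t - T)%N%:R ^+ 2 / t%:R).
Proof.
have [C0 C00 HC0] := count_concentration m1 d0m d1m 0.
pose p := p_m m delta0.
have p0 : 0 < p := pdeg_gt0 m1 d0m 0.
(* Along the m edges of a step 1 - p vertices leave degree m, and the new vertex enters it. *)
have mg : m%:R * gleaf delta0 = p - 1.
  have := gdegE0 m1 d0m; have := mgdeg m1 delta0 0.
  rewrite ind_m /= -/p => mg0 Xg.
  have X0 := X_gt0 m1 d0m; rewrite -mg0; congr (_ * _).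
  by apply: (mulfI (lt0r_neq0 X0)); rewrite Xg /gleaf -/p; field; rewrite -natrM gt_eqF.
pose Dm := m%:R + dmax.
have Dm0 : 0 < Dm by have := d0max; have := d0min; have := mu_gt0; rewrite /Dm; lra.
pose D := Dm * (C0 / mu + p * ((2 * m)%:R / mu ^+ 2)).
have mu0 := mu_gt0.
have D0 : 0 <= D by rewrite /D; nonneg.
have gb T s : `|gleaf (x T s)| <= p.
  have /andP[x1 x2] := dseq_range T s.
  have X0 := lt_le_trans mu0 (mu_le_X x1).
  have mx : 0 <= m%:R + x T s by lra.
  rewrite /gleaf normrN normrM normrV ?unitfE ?gt_eqF // normrM -/p.
  rewrite (gtr0_norm p0) (gtr0_norm X0) (ger0_norm mx) ler_pdivrMr // mulrC.
  by rewrite ler_pM2l // natrM; have := ler0n R m; lra.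
pose e T s : R := D * (err T s / s%:R).
have e0 T s : 0 <= e T s by rewrite /e /err; nonneg.
have cS T t i : leaf_target T t i.+1 - leaf_target T t i = gleaf (x T t).
  by rewrite /leaf_target -natr1; ring.
pose b : R := `|2 * ind m 0 m - p * 2|.
exists ((1 + p) * Num.sqrt m%:R + b + m%:R * (D * 2)); first by rewrite /b; nonneg.
move=> T t i t2 im; have tt1 := ltnW t2.
have := @L2_growth R m (x T) (dseq_gt d0m d1m T) (ind m 0) (leaf_target T) (e T) (1 + p).
move=> /(_ (e0 T) _ _ _ _ t i t2 im) H.
apply: (le_trans (H _ _ _ _)) => {H}.
- by rewrite addr_ge0 // ltW.
- move=> s s2; rewrite /leaf_target big_nat_recr //= ind_m /= mulrBr mg -natr1.
  by rewrite -/p; ring.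
- move=> s j k s2 jm mk; rewrite cS; apply: (le_trans (ler_normB _ _)).
  apply: lerD (gb _ _); rewrite /ind; do 2!case: eqP => _ /=;
  by rewrite ?subrr ?subr0 ?sub0r ?normrN ?normr0 ?normr1.
- move=> s j s2 jm; have laws := is_law_step (dseq_gt d0m d1m T) j s2.
  have s1 := ltnW s2; have s0 : 0 < s%:R :> R by rewrite ltr0n.
  apply: (@le_trans _ _ (expect (law T s j) (fun G => `|vsum (ind m 0) s G - leaf_target T s j| *
     (Dm / (s%:R * mu) * `|vsum (ind m 0) s G - p * s%:R| + Dm * p * ((2 * m)%:R / mu ^+ 2 / s%:R))))).
    apply: (expect_le laws) => G iG; rewrite cS.
    apply: (le_trans (ler_norm _)); rewrite normrM; apply: ler_wpM2l => //.
    have /andP[x1 x2] := dseq_range T s.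
    have SS := Snorm_mu j x1 s2.
    have S0 : 0 < Snorm m s j (x T s) by apply: lt_le_trans SS; rewrite mulr_gt0.
    rewrite (drift_ind0 _ iG).
    have -> : vsum (fun=> 0 : R) s G = 0 by rewrite /vsum big1.
    rewrite /gleaf -/p; set V := vsum _ _ _; set S := Snorm _ _ _ _ in SS S0 *.
    have -> : ((0 + x T s) * 0 - (m%:R + x T s) * V) / S - - ((m%:R + x T s) * p / X (x T s))
      = - ((m%:R + x T s) * ((V - p * s%:R) / S + p * (s%:R / S - (X (x T s))^-1))).
      by ring.
    rewrite normrN normrM.
    have mx : 0 <= m%:R + x T s by lra.
    rewrite (ger0_norm mx).
    apply: (@le_trans _ _ (Dm * (`|V - p * s%:R| / (s%:R * mu) + p * ((2 * m)%:R / mu ^+ 2 / s%:R)))); last first.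
      by rewrite le_eqVlt; apply/orP; left; apply/eqP; ring.
    apply: ler_pM => //; first by rewrite /Dm; lra.
    apply: (le_trans (ler_normD _ _)); apply: lerD.
      rewrite normrM normfV (gtr0_norm S0); apply: ler_wpM2l => //.
      by rewrite lef_pV2 ?posrE ?mulr_gt0.
    rewrite normrM (gtr0_norm p0); apply: ler_wpM2l; first exact: ltW.
    by apply: ratio_Snorm => //; apply: ltnW.
  apply: (le_trans (cauchy_schwarz laws _ _)); rewrite nrm_norm.
  apply: ler_wpM2l; first exact: nrm_ge0.
  apply: (le_trans (nrmD laws _ _)); rewrite (nrm_cst laws) nrmZ nrm_norm.
  have n1 : 0 <= Dm / (s%:R * mu) by nonneg.
  have n2 : 0 <= Dm * p * ((2 * m)%:R / mu ^+ 2 / s%:R) by nonneg.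
  rewrite (ger0_norm n1) (ger0_norm n2).
  apply: (le_trans (lerD (ler_wpM2l n1 (HC0 T s j s2 (ltnW jm))) (lexx _))).
  have h1 := @err_ge1 R T s s1.
  have -> : e T s = Dm / (s%:R * mu) * (C0 * err T s) + Dm * p * ((2 * m)%:R / mu ^+ 2 / s%:R) * err T s.
    by rewrite /e /D; field; rewrite !gt_eqF.
  by rewrite lerD2l ler_peMr.
have q0 : 0 <= (t - T)%N%:R ^+ 2 / t%:R :> R by nonneg.
have l1 : 1 <= Num.sqrt (t%:R : R) := sqrt_nat_ge1 tt1.
have h1 : (1 + p) * Num.sqrt (m * t)%:R <=
   (1 + p) * Num.sqrt m%:R * (Num.sqrt t%:R + (t - T)%N%:R ^+ 2 / t%:R).
  rewrite natrM sqrtrM // mulrA; apply: ler_wpM2l; first by nonneg.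
  by rewrite lerDl.
have h2 : `|2 * ind m 0 m - leaf_target T 2 0| <= b * (Num.sqrt t%:R + (t - T)%N%:R ^+ 2 / t%:R).
  rewrite /leaf_target big_geq // mul0r !addr0 -/p -/b ler_peMr ?normr_ge0 //; lra.
have h3 : m%:R * \sum_(2 <= s < t.+1) e T s <=
   m%:R * (D * 2) * (Num.sqrt t%:R + (t - T)%N%:R ^+ 2 / t%:R).
  rewrite -mulr_sumr -mulrA; apply: ler_wpM2l => //; rewrite -(mulrA D).
  by apply: (ler_wpM2l D0); apply: sum_err_div.
by apply: (le_trans (lerD (lerD h1 h2) h3)); rewrite -!mulrDl.
Qed.

End Predictions.

(** * The score *)

Lemma ind_sum (R : realType) m (a : nat -> R) K k : (m <= k)%N ->
  \sum_(0 <= j < K) ind m j k / a j =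
  if (k < m + K)%N then (a (k - m)%N)^-1 else 0.
Proof.
move=> mk; have [kK|Kk] := ltnP k (m + K).
  rewrite (bigD1_seq (k - m)%N) ?iota_uniq ?mem_index_iota //=; last by lia.
  rewrite big1 => [|j jk]; first by rewrite /ind subnKC // eqxx addr0 mul1r.
  by rewrite /ind (_ : (k == m + j)%N = false) ?mul0r //; lia.
apply: big1_seq => j /andP[_]; rewrite mem_index_iota => jK.
by rewrite /ind (_ : (k == m + j)%N = false) ?mul0r //; lia.
Qed.

Section Score.
Context {R : realType}.
Variable m : nat.
Variables delta0 delta1 dmin dmax : R.
Hypothesis dminm : - m%:R < dmin.
Hypothesis d0min : dmin <= delta0.
Hypothesis d0max : delta0 <= dmax.
Hypothesis d1min : dmin <= delta1.
Hypothesis d1max : delta1 <= dmax.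

Let d0m : - m%:R < delta0 := lt_le_trans dminm d0min.
Local Notation x := (dseq delta0 delta1).
Local Notation mu := (m%:R + dmin).
Local Notation X d := ((2 * m)%:R + d).

Let mu_gt0 : 0 < mu.
Proof. by rewrite -ltrBlDl sub0r. Qed.

(** The derivative of the log-likelihood contribution of a vertex of degree k. It makes the first
    half of the score a [vsum]. *)
Definition hsum (y : R) (k : nat) : R := \sum_(m <= l < k) (l%:R + y)^-1.

Lemma hsumS y k : (m <= k)%N -> hsum y k.+1 - hsum y k = (k%:R + y)^-1.
Proof. by move=> mk; rewrite /hsum big_nat_recr //= addrAC subrr add0r. Qed.

(** The first term is exactly what the log-normalizer subtracts in the score, so the second one
    alone is the predicted drift of the score; it vanishes when y is the true parameter. *)
Definition score_incr K T y s j : R :=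
  s%:R / Snorm m s j y + (x T s - y) * wlim m delta0 K / X (x T s).

Definition score_target K T y t i : R :=
  \sum_(2 <= s < t) \sum_(0 <= j < m) score_incr K T y s j
  + \sum_(0 <= j < i) score_incr K T y t j.

Lemma inv_diff_le (a b c : R) : 0 < c -> c <= a -> c <= b ->
  `|a^-1 - b^-1| <= `|a - b| / c ^+ 2.
Proof.
move=> c0 ca cb; have a0 := lt_le_trans c0 ca; have b0 := lt_le_trans c0 cb.
have -> : a^-1 - b^-1 = (b - a) / (a * b) by field; rewrite !gt_eqF.
rewrite normrM distrC normfV (gtr0_norm (mulr_gt0 a0 b0)); apply: ler_wpM2l => //.
rewrite lef_pV2 ?posrE ?mulr_gt0 ?exprn_gt0 //.
by rewrite expr2; apply: ler_pM => //; apply: ltW.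
Qed.

(* The degrees below m + K are counted exactly; each of the others contributes
   at most 1 / K. *)
Lemma inv_degree_sum K t i G y : (1 <= K)%N -> (2 <= t)%N -> dmin <= y ->
  inv m t i G ->
  `|vsum (fun k => (k%:R + y)^-1) t G / t%:R
    - \sum_(0 <= j < K) pdeg m delta0 j / (m%:R + j%:R + delta0)| <=
  `|y - delta0| / mu ^+ 2 + K%:R^-1 +
  \sum_(0 <= j < K) `|vsum (ind m j) t G - pdeg m delta0 j * t%:R| / (mu * t%:R).
Proof.
move=> K1 t2 ymin iG; have t0 : 0 < t%:R :> R by rewrite ltr0n ltnW.
have mu0 := mu_gt0; have K0 : 0 < K%:R :> R by rewrite ltr0n.
pose B (z : R) := vsum (fun k => (k%:R + z)^-1) t G.
pose S := \sum_(0 <= j < K) vsum (ind m j) t G / (m%:R + j%:R + delta0).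
pose A := \sum_(0 <= j < K) pdeg m delta0 j / (m%:R + j%:R + delta0).
have vle (f : nat -> R) (M : R) : (forall k, (m <= k)%N -> `|f k| <= M) ->
    `|vsum f t G| <= M * t%:R.
  move=> fM; apply: (le_trans (ler_norm_sum _ _ _)).
  rewrite mulr_natr -[t in _ *+ t]subn0 -sumr_const_nat; apply: ler_sum_nat => v /= vt.
  by apply: fM; apply: inv_deg_ge iG vt.
have b1 : `|B y - B delta0| <= `|y - delta0| / mu ^+ 2 * t%:R.
  rewrite /B /vsum -sumrB; apply: (vle (fun k => (k%:R + y)^-1 - (k%:R + delta0)^-1)).
  move=> k mk; have mk' : m%:R <= k%:R :> R by rewrite ler_nat.
  apply: (le_trans (inv_diff_le mu0 _ _)); rewrite ?lerD //.
  by have -> : k%:R + y - (k%:R + delta0) = y - delta0 by ring.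
have b2 : `|B delta0 - S| <= K%:R^-1 * t%:R.
  have -> : B delta0 - S = vsum (fun k => (k%:R + delta0)^-1 -
      \sum_(0 <= j < K) ind m j k / (m%:R + j%:R + delta0)) t G.
    rewrite /S /B /vsum sumrB; congr (_ - _).
    rewrite exchange_big /=; apply: eq_bigr => j _.
    by rewrite mulr_suml.
  apply: vle => k mk; have mk' : m%:R <= k%:R :> R by rewrite ler_nat.
  rewrite (ind_sum _ K mk); have [kK|Kk] := ltnP k (m + K).
    rewrite natrB //.
    have -> : m%:R + (k%:R - m%:R) + delta0 = k%:R + delta0 by ring.
    by rewrite subrr normr0 invr_ge0.
  rewrite subr0.
  have kd : K%:R <= k%:R + delta0.
    have : (m + K)%:R <= k%:R :> R by rewrite ler_nat.
    by rewrite natrD; have := d0m; lra.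
  by rewrite ger0_norm ?invr_ge0 ?lef_pV2 ?posrE //; lra.
have b3 : `|S - A * t%:R| <=
   \sum_(0 <= j < K) `|vsum (ind m j) t G - pdeg m delta0 j * t%:R| / mu.
  rewrite /S /A mulr_suml -sumrB; apply: (le_trans (ler_norm_sum _ _ _)).
  apply: ler_sum => j _.
  have -> : vsum (ind m j) t G / (m%:R + j%:R + delta0) -
     pdeg m delta0 j / (m%:R + j%:R + delta0) * t%:R =
    (vsum (ind m j) t G - pdeg m delta0 j * t%:R) / (m%:R + j%:R + delta0) by ring.
  have j0 : 0 <= j%:R :> R by [].
  have mj : mu <= m%:R + j%:R + delta0 by have := d0min; lra.
  rewrite normrM normfV ; apply: ler_wpM2l => //.
  by rewrite ger0_norm ?lef_pV2 ?posrE //; lra.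
have -> : B y / t%:R - A = (B y - A * t%:R) / t%:R by field; rewrite gt_eqF.
rewrite normrM normfV (gtr0_norm t0) ler_pdivrMr //.
have -> : B y - A * t%:R = (B y - B delta0) + (B delta0 - S) + (S - A * t%:R) by ring.
rewrite mulrDl mulrDl; apply: (le_trans (ler_normD _ _)); apply: lerD.
  by apply: (le_trans (ler_normD _ _)); apply: lerD.
apply: (le_trans b3); rewrite mulr_suml; apply: ler_sum => j _.
by rewrite le_eqVlt; apply/orP; left; apply/eqP; field; rewrite !gt_eqF.
Qed.

(** Apply (k + z) / (k + y) = 1 + (z - y) / (k + y) at each vertex. *)
Lemma drift_hsum z y t i G : - m%:R < y -> - m%:R < z -> (2 <= t)%N -> inv m t i G ->
  drift m z (hsum y) t i G =
  (t%:R + (z - y) * vsum (fun k => (k%:R + y)^-1) t G) / Snorm m t i z.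
Proof.
move=> ym zm t2 iG; rewrite /drift mulrC; congr (_ / _).
have -> : (t%:R : R) = \sum_(0 <= v < t) 1 by rewrite sumr_const_nat subn0.
rewrite /vsum mulr_sumr -big_split /=; apply: eq_big_nat => v /= vt.
have mv := inv_deg_ge iG vt; rewrite hsumS //.
have mv' : m%:R <= (deg G v)%:R :> R by rewrite ler_nat.
by field; rewrite gt_eqF //; lra.
Qed.

(** The whole error carries the factor x - y, because drift and prediction agree exactly at y = x;
    this is the martingale property of the score at the true parameter. [D] is uniform in [K], whose
    cost appears as 1 / K and as K count deviations. *)
Lemma score_drift_error : exists2 D, 0 <= D & forall K T y t i G,
  (1 <= K)%N -> dmin <= y -> y <= dmax -> (2 <= t)%N -> (i <= m)%N -> inv m t i G ->
  `|drift m (x T t) (hsum y) t i G - score_incr K T y t i| <=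
  `|x T t - y| * (D * (t%:R^-1 + `|y - delta0| + K%:R^-1 +
    \sum_(0 <= j < K) `|vsum (ind m j) t G - pdeg m delta0 j * t%:R| / t%:R)).
Proof.
have mu0 := mu_gt0.
pose r : R := (2 * m)%:R / mu ^+ 2.
have r0 : 0 <= r by rewrite /r; nonneg.
pose D1 := 2 / mu * r + r / mu.
pose D := D1 + 2 / mu ^+ 2 / mu + mu^-1 + mu^-1 / mu.
exists D; first by rewrite /D /D1; nonneg.
move=> K T y t i G K1 ymin ymax t2 im iG.
have t0 : 0 < t%:R :> R by rewrite ltr0n ltnW.
have /andP[x1 x2] := dseq_range d0min d0max d1min d1max T t.
set z := x T t in x1 x2 *.
have ym : - m%:R < y by lra.
have zm : - m%:R < z by lra.
rewrite drift_hsum // /score_incr -/z; set B := vsum _ _ _.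
have Sy := Snorm_mu m i ymin t2; have Sz := Snorm_mu m i x1 t2.
have ry := ratio_Snorm dminm ymin t2 im; have rz := ratio_Snorm dminm x1 t2 im.
have tmu : 0 < t%:R * mu by rewrite mulr_gt0.
have Sy0 := lt_le_trans tmu Sy; have Sz0 := lt_le_trans tmu Sz.
have Xz0 := mu_le_X m x1; have Xy0 := mu_le_X m ymin; have X00 := mu_le_X m d0min.
have hz : Snorm m t i z = Snorm m t i y + t%:R * (z - y) by rewrite /Snorm; ring.
(* The exact counterpart of [wlim]: since S_z = S_y + t (z - y), the drift minus t / S_y equals (z -
   y) W t / S_z. *)
pose W := B / t%:R - t%:R / Snorm m t i y.
set w := wlim _ _ _.
have -> : (t%:R + (z - y) * B) / Snorm m t i z -
    (t%:R / Snorm m t i y + (z - y) * w / X z) =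
   (z - y) * (W * (t%:R / Snorm m t i z - (X z)^-1) + (W - w) / X z).
  have e1 : (t%:R + (z - y) * B) / Snorm m t i z = t%:R / Snorm m t i y
      + (z - y) * (W * (t%:R / Snorm m t i z)).
    rewrite /W hz; rewrite hz in Sz0.
    by move: (Snorm _ _ _ _) Sy0 Sz0 => S S0 S1; field; rewrite !gt_eqF.
  by rewrite e1; ring.
rewrite normrM; apply: ler_wpM2l => //.
have Wb : `|W| <= 2 / mu.
  have h1 : `|B / t%:R| <= mu^-1.
    rewrite normrM normfV (gtr0_norm t0) ler_pdivrMr //.
    apply: (le_trans (ler_norm_sum _ _ _)).
    rewrite mulr_natr -[t in _ *+ t]subn0 -sumr_const_nat; apply: ler_sum_nat => v /= vt.
    have mv : m%:R <= (deg G v)%:R :> R by rewrite ler_nat (inv_deg_ge iG vt).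
    by rewrite ger0_norm ?invr_ge0 ?lef_pV2 ?posrE //; lra.
  have h2 : `|t%:R / Snorm m t i y| <= mu^-1.
    have q0 : 0 <= t%:R / Snorm m t i y by nonneg.
    by rewrite (ger0_norm q0) ler_pdivrMr // mulrC ler_pdivlMr.
  apply: (le_trans (ler_normB _ _)); lra.
have WwE : W - w = (B / t%:R - \sum_(0 <= j < K) pdeg m delta0 j / (m%:R + j%:R + delta0))
   - (t%:R / Snorm m t i y - (X y)^-1) - ((X y)^-1 - (X delta0)^-1).
  by rewrite /W /w /wlim; ring.
have h3 := inv_diff_le mu0 Xy0 X00.
have e3 : X y - X delta0 = y - delta0 by ring.
rewrite e3 in h3.
have h4 := inv_degree_sum K1 t2 ymin iG; rewrite -/B in h4.
set N := \sum_(0 <= j < K) _ / t%:R.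
have N0 : 0 <= N by rewrite /N; apply: sumr_ge0 => j _; nonneg.
have NE : \sum_(0 <= j < K) `|vsum (ind m j) t G - pdeg m delta0 j * t%:R| / (mu * t%:R) = N / mu.
  by rewrite /N mulr_suml; apply: eq_bigr => j _; field; rewrite !gt_eqF.
rewrite NE in h4.
have q0 : 0 <= `|y - delta0| by [].
have k0 : 0 <= K%:R^-1 :> R by rewrite invr_ge0.
have ti0 : 0 <= t%:R^-1 :> R by rewrite invr_ge0 ltW.
have Wwb : `|W - w| <= `|y - delta0| * (2 / mu ^+ 2) + K%:R^-1 + N / mu + r / t%:R.
  rewrite WwE; apply: (le_trans (ler_normB _ _)).
  have := ler_normB (B / t%:R - \sum_(0 <= j < K) pdeg m delta0 j / (m%:R + j%:R + delta0))
    (t%:R / Snorm m t i y - (X y)^-1).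
  rewrite -/r in ry; lra.
apply: (le_trans (ler_normD _ _)).
have g1 : `|W * (t%:R / Snorm m t i z - (X z)^-1)| <= 2 / mu * r / t%:R.
  by rewrite normrM -mulrA; apply: ler_pM.
have g2 : `|(W - w) / X z| <=
   (`|y - delta0| * (2 / mu ^+ 2) + K%:R^-1 + N / mu + r / t%:R) / mu.
  rewrite normrM normfV (gtr0_norm (lt_le_trans mu0 Xz0)); apply: ler_pM => //.
    by rewrite invr_ge0 ltW // (lt_le_trans mu0 Xz0).
  by rewrite lef_pV2 ?posrE // (lt_le_trans mu0 Xz0).
apply: (le_trans (lerD g1 g2)).
have p1 : 0 <= D1 by rewrite /D1; nonneg.
have p2 : 0 <= 2 / mu ^+ 2 / mu by nonneg.
have p3 : 0 <= mu^-1 by nonneg.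
have p4 : 0 <= mu^-1 / mu by nonneg.
have D1D : D1 <= D by rewrite /D; lra.
have D2D : 2 / mu ^+ 2 / mu <= D by rewrite /D; lra.
have D3D : mu^-1 <= D by rewrite /D; lra.
have D4D : mu^-1 / mu <= D by rewrite /D; lra.
have -> : 2 / mu * r / t%:R +
    (`|y - delta0| * (2 / mu ^+ 2) + K%:R^-1 + N / mu + r / t%:R) / mu =
  D1 * t%:R^-1 + 2 / mu ^+ 2 / mu * `|y - delta0| + mu^-1 * K%:R^-1 + mu^-1 / mu * N.
  by rewrite /D1; ring.
by rewrite !mulrDr; do !apply: lerD; apply: ler_wpM2r.
Qed.


End Score.

(** * L2 concentration of the score around its prediction *)

Section ScoreConcentration.
Context {R : realType}.
Variable m : nat.
Hypothesis m1 : (1 <= m)%N.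
Variables delta0 delta1 dmin dmax : R.
Hypothesis dminm : - m%:R < dmin.
Hypothesis d0min : dmin <= delta0.
Hypothesis d0max : delta0 <= dmax.
Hypothesis d1min : dmin <= delta1.
Hypothesis d1max : delta1 <= dmax.

Let d0m : - m%:R < delta0 := lt_le_trans dminm d0min.
Let d1m : - m%:R < delta1 := lt_le_trans dminm d1min.
Local Notation x := (dseq delta0 delta1).
Local Notation law T t i := (step_law m (x T) t i).
Local Notation mu := (m%:R + dmin).
Local Notation X d := ((2 * m)%:R + d).

Let mu_gt0 : 0 < mu.
Proof. by rewrite -ltrBlDl sub0r. Qed.

(** [D] is fixed before [K], and [C] after it. At the point used under the alternative the factor of
    [D] is of order n^gamma times |y - delta0| + 1 / K, so it is made small by taking [K] large;
    only then is the [C] term beaten by taking n large. *)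
Lemma score_concentration : exists2 D, 0 <= D &
  forall K, (1 <= K)%N -> exists2 C, 0 <= C &
  forall T y t i, dmin <= y -> y <= dmax -> (2 <= t)%N -> (i <= m)%N ->
  nrm (law T t i) (fun G => vsum (hsum m y) t G - score_target m delta0 delta1 K T y t i) <=
  C * (Num.sqrt t%:R + (t - T)%N%:R ^+ 2 / t%:R)
  + D * (`|y - delta0| * t%:R + `|y - delta1| * (t - T)%N%:R)
      * (`|y - delta0| + K%:R^-1).
Proof.
have [D D0 HD] := score_drift_error dminm d0min d0max d1min d1max; exists (m%:R * D) => [|K K1]; first by nonneg.
have mu0 := mu_gt0.
have [CK CK0 HCK] : exists2 C, 0 <= C & forall T t i, (2 <= t)%N -> (i <= m)%N ->
    nrm (law T t i) (fun G => \sum_(0 <= j < K)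
      `|vsum (ind m j) t G - pdeg m delta0 j * t%:R| / t%:R) <= C * (err T t / t%:R).
  elim: K {K1} => [|K [C C0 IHK]].
    exists 0 => // T t i t2 im; rewrite mul0r.
    rewrite (@eq_nrm _ _ _ _ (fun=> 0)) => [|G]; last by rewrite big_geq.
    by rewrite (nrm_cst (is_law_step (dseq_gt d0m d1m T) i t2)) normr0.
  have [C' C'0 HC'] := count_concentration m1 d0m d1m K.
  exists (C + C'); first by nonneg.
  move=> T t i t2 im; have lawt := is_law_step (dseq_gt d0m d1m T) i t2.
  have t0 : 0 < t%:R :> R by rewrite ltr0n ltnW.
  rewrite (eq_nrm _ (fun G => big_nat_recr K 0 (fun j =>
     `|vsum (ind m j) t G - pdeg m delta0 j * t%:R| / t%:R) (leq0n K))).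
  rewrite mulrDl; apply: (le_trans (nrmD lawt _ _)); apply: lerD; first exact: IHK.
  rewrite (@eq_nrm _ _ _ _ (fun G => t%:R^-1 * `|vsum (ind m K) t G - pdeg m delta0 K * t%:R|)) => [|G]; last by rewrite mulrC.
  rewrite nrmZ nrm_norm gtr0_norm ?invr_gt0 // mulrC mulrA.
  by apply: ler_wpM2r; [nonneg|apply: HC'].
pose w := wlim m delta0 K; pose Dl := dmax - dmin.
have Dl0 : 0 <= Dl by have := d0min; have := d0max; rewrite /Dl; lra.
pose U := mu^-1 + (mu^-1 + Dl * `|w| / mu).
have U0 : 0 <= U by rewrite /U; nonneg.
pose E := m%:R * (2 * Dl * D * (CK + 1) * 2).
exists (U * Num.sqrt m%:R + E); first by rewrite /E; nonneg.
move=> T y t i ymin ymax t2 im; have tt1 := ltnW t2.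
have xyD s : `|x T s - y| <= Dl.
  have /andP[x1 x2] := dseq_range d0min d0max d1min d1max T s.
  by rewrite ler_norml /Dl; lra.
pose e s : R := `|x T s - y| * (D * ((CK + 1) * (err T s / s%:R) + (`|y - delta0| + K%:R^-1))).
have e0 s : 0 <= e s by rewrite /e /err; nonneg.
have cS s j : score_target m delta0 delta1 K T y s j.+1 - score_target m delta0 delta1 K T y s j = score_incr m delta0 delta1 K T y s j.
  by rewrite /score_target [Y in _ + Y - _]big_nat_recr //=; ring.
have := @L2_growth R m (x T) (dseq_gt d0m d1m T) (hsum m y) (score_target m delta0 delta1 K T y) e U.
move=> /(_ e0 U0 _ _ _ t i t2 im) H.
apply: (le_trans (H _ _ _)) => {H}.
(* [hsum] vanishes at degree m, so a new vertex contributes nothing. *)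
- move=> s s2; rewrite /score_target /hsum !(@big_geq _ _ _ _ 0) // (@big_geq _ _ _ m) //.
  by rewrite big_nat_recr //= !addr0.
- move=> s j k s2 jm mk; rewrite cS hsumS //.
  have mk' : m%:R <= k%:R :> R by rewrite ler_nat.
  have mky : mu <= k%:R + y by lra.
  have /andP[x1 x2] := dseq_range d0min d0max d1min d1max T s.
  have Sy := Snorm_mu m j ymin s2; have Xx := mu_le_X m x1.
  have s0 : 0 < s%:R :> R by rewrite ltr0n ltnW.
  have S0 := lt_le_trans (mulr_gt0 s0 mu0) Sy; have X0 := lt_le_trans mu0 Xx.
  apply: (le_trans (ler_normB _ _)); apply: lerD.
    by rewrite ger0_norm ?invr_ge0 ?lef_pV2 ?posrE //; lra.
  apply: (le_trans (ler_normD _ _)); apply: lerD.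
    have q0 : 0 <= s%:R / Snorm m s j y by nonneg.
    by rewrite (ger0_norm q0) ler_pdivrMr // mulrC ler_pdivlMr.
  rewrite !normrM normfV (gtr0_norm X0); apply: ler_pM.
  - by nonneg.
  - by rewrite invr_ge0 ltW.
  - by apply: ler_wpM2r => //; apply: xyD.
  - by rewrite lef_pV2 ?posrE.
- move=> s j s2 jm; have laws := is_law_step (dseq_gt d0m d1m T) j s2.
  have s1 := ltnW s2; have s0 : 0 < s%:R :> R by rewrite ltr0n.
  pose N G := \sum_(0 <= l < K) `|vsum (ind m l) s G - pdeg m delta0 l * s%:R| / s%:R.
  pose a := `|x T s - y| * D.
  have a0 : 0 <= a by rewrite /a; nonneg.
  pose b := a * (s%:R^-1 + `|y - delta0| + K%:R^-1).
  have b0 : 0 <= b by rewrite /b; nonneg.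
  apply: (@le_trans _ _ (expect (law T s j) (fun G =>
     `|vsum (hsum m y) s G - score_target m delta0 delta1 K T y s j| * (a * N G + b)))).
    apply: (expect_le laws) => G iG; rewrite cS.
    apply: (le_trans (ler_norm _)); rewrite normrM; apply: ler_wpM2l => //.
    apply: (le_trans (HD K T y s j G K1 ymin ymax s2 (ltnW jm) iG)).
    by rewrite le_eqVlt; apply/orP; left; apply/eqP; rewrite /b /a /N; ring.
  apply: (le_trans (cauchy_schwarz laws _ _)); rewrite nrm_norm.
  apply: ler_wpM2l; first exact: nrm_ge0.
  apply: (le_trans (nrmD laws _ _)); rewrite (nrm_cst laws) nrmZ (ger0_norm a0) (ger0_norm b0).
  apply: (le_trans (lerD (ler_wpM2l a0 (HCK T s j s2 (ltnW jm))) (lexx _))).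
  have -> : e s = a * (CK * (err T s / s%:R)) + a * (err T s / s%:R + `|y - delta0| + K%:R^-1).
    by rewrite /e /a; ring.
  rewrite lerD2l /b; apply: (ler_wpM2l a0); rewrite !lerD2r ler_peMl ?invr_ge0 //.
  exact: err_ge1.
have q0 : 0 <= (t - T)%N%:R ^+ 2 / t%:R :> R by nonneg.
set Z := Num.sqrt t%:R + _; pose q : R := `|y - delta0| + K%:R^-1; rewrite -/q.
have qq0 : 0 <= q by rewrite /q; nonneg.
have h1 : U * Num.sqrt (m * t)%:R <= U * Num.sqrt m%:R * Z.
  rewrite natrM sqrtrM // mulrA; apply: ler_wpM2l; first by nonneg.
  by rewrite lerDl.
have h2 : `|2 * hsum m y m - score_target m delta0 delta1 K T y 2 0| = 0.
  by rewrite /hsum /score_target !big_geq // mulr0 addr0 subr0 normr0.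
have xy2 s : `|x T s - y| <= `|y - delta0| + `|y - delta1| * (T < s)%N%:R.
  rewrite /dseq; case: leqP => _; rewrite distrC ?mulr0 ?addr0 //.
  by rewrite mulr1 lerDr.
have h3 : m%:R * \sum_(2 <= s < t.+1) e s <= E * Z +
    m%:R * D * (`|y - delta0| * t%:R + `|y - delta1| * (t - T)%N%:R) * q.
  have -> : E * Z + m%:R * D * (`|y - delta0| * t%:R + `|y - delta1| * (t - T)%N%:R) * q =
    m%:R * (2 * Dl * D * (CK + 1) * (2 * Z) +
       D * q * (`|y - delta0| * t%:R + `|y - delta1| * (t - T)%N%:R)).
    by rewrite /E; ring.
  apply: ler_wpM2l => //.
  apply: (@le_trans _ _ (\sum_(2 <= s < t.+1) (Dl * D * (CK + 1) * (err T s / s%:R)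
     + D * q * (`|y - delta0| + `|y - delta1| * (T < s)%N%:R)))).
    apply: ler_sum_nat => s _; rewrite /e -/q.
    have -> : `|x T s - y| * (D * ((CK + 1) * (err T s / s%:R) + q)) =
      `|x T s - y| * (D * (CK + 1) * (err T s / s%:R)) + D * q * `|x T s - y| by ring.
    apply: lerD.
      rewrite -!(mulrA Dl) -(mulrA D); apply: ler_wpM2r (xyD s).
      by rewrite /err; nonneg.
    by apply: ler_wpM2l (xy2 s); nonneg.
  rewrite big_split /= -!mulr_sumr big_split /= -mulr_sumr.
  apply: lerD.
    have c0 : 0 <= Dl * D * (CK + 1) by nonneg.
    have z0 : 0 <= 2 * Z by rewrite /Z; nonneg.
    apply: (le_trans (ler_wpM2l c0 (sum_err_div T tt1))); rewrite -/Z.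
    have -> : 2 * Dl * D * (CK + 1) * (2 * Z) =
      Dl * D * (CK + 1) * (2 * Z) + Dl * D * (CK + 1) * (2 * Z) by ring.
    by rewrite lerDl; apply: mulr_ge0.
  apply: ler_wpM2l; first by nonneg.
  apply: lerD; last by apply: ler_wpM2l => //; apply: sum_after.
  rewrite sumr_const_nat -[leLHS]mulr_natr; apply: ler_wpM2l => //.
  by rewrite ler_nat subSS leq_subr.
rewrite h2 addr0; apply: (le_trans (lerD h1 h3)).
by rewrite (mulrDl _ E Z) addrA.
Qed.

End ScoreConcentration.

(** * The maximum likelihood estimator *)

Section FiniteSeries.
Context {R : realType}.

Lemma series_eq_sum a M (F : nat -> R) : (a <= M)%N ->
  (forall k, (M <= k)%N -> F k = 0) ->
  \big[+%R/0]_(a <= k <oo) F k = \sum_(a <= k < M) F k.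
Proof.
move=> aM F0; apply: lim_near_cst; first exact: Rhausdorff.
near=> N; have MN : (M <= N)%N by near: N; exists M.
rewrite (@big_cat_nat _ _ _ M) //= [Y in _ + Y]big1_seq ?addr0 // => k /andP[_].
by rewrite mem_index_iota => /andP[Mk _]; apply: F0.
Unshelve. all: by end_near. Qed.

Lemma N_eq_sum G j :
  (N_eq G j)%:R = \sum_(0 <= v < nvert G) (deg G v == j)%:R :> R.
Proof.
by rewrite /N_eq -natr_sum -sum1_count big_mkcond /index_iota subn0.
Qed.

Lemma deg_lt_total G v : (v < nvert G)%N ->
  (deg G v < (\sum_(0 <= u < nvert G) deg G u).+1)%N.
Proof.
move=> vG; rewrite ltnS (bigD1_seq v) ?iota_uniq ?mem_index_iota //=.
exact: leq_addr.
Qed.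

Lemma sum_eq_nat_range k M d : (k <= M)%N -> (d < M)%N ->
  \sum_(k <= j < M) ((d == j)%:R : R) = (k <= d)%N%:R.
Proof.
move=> kM dM; have [kd|dk] := leqP k d.
  rewrite (bigD1_seq d) ?iota_uniq ?mem_index_iota ?kd //= eqxx big1 ?addr0 //.
  by move=> j jd; rewrite eq_sym (negbTE jd).
apply: big1_seq => j /andP[_]; rewrite mem_index_iota => /andP[kj _].
by rewrite ltn_eqF // (leq_trans dk).
Qed.

Lemma N_gt_sum G k :
  N_gt G k = \sum_(0 <= v < nvert G) (k < deg G v)%N%:R :> R.
Proof.
pose M := (\sum_(0 <= u < nvert G) deg G u).+1.
rewrite /N_gt (@series_eq_sum _ (k.+1 + M)) ?leq_addr //.
  under eq_bigr do rewrite N_eq_sum.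
  rewrite exchange_big /=; apply: eq_big_nat => v /= vG.
  apply: sum_eq_nat_range; rewrite ?leq_addr //.
  by rewrite (leq_trans (deg_lt_total vG)) // leq_addl.
move=> j Mj; rewrite N_eq_sum; apply: big1_seq => v /andP[_].
rewrite mem_index_iota => /andP[_ vG].
by rewrite ltn_eqF // (leq_trans (deg_lt_total vG)) // (leq_trans _ Mj) // leq_addl.
Qed.

(** Exchange of summation: N_{>k} counts v exactly for k < D_v. This brings the likelihood into the
    vertex-sum form handled by [L2_growth]. *)
Lemma sum_N_gt (f : nat -> R) m G :
  \big[+%R/0]_(m <= k <oo) (f k * N_gt G k) =
  vsum (fun d => \sum_(m <= k < d) f k) (nvert G) G.
Proof.
pose M := (\sum_(0 <= u < nvert G) deg G u).+1.
rewrite (@series_eq_sum _ (m + M)) ?leq_addr //; last first.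
  move=> k Mk; rewrite N_gt_sum big1_seq ?mulr0 // => v /andP[_].
  rewrite mem_index_iota => /andP[_ vG].
  rewrite ltnNge (leq_trans (ltnW (deg_lt_total vG))) //.
  by rewrite (leq_trans _ Mk) // leq_addl.
under eq_bigr do rewrite N_gt_sum mulr_sumr.
rewrite exchange_big /=; apply: eq_big_nat => v /= vG.
have dM : (deg G v <= m + M)%N.
  by rewrite (leq_trans (ltnW (deg_lt_total vG))) // leq_addl.
have [md|dm] := leqP m (deg G v); last first.
  rewrite [RHS]big_geq 1?ltnW //; apply: big1_seq => k /andP[_].
  rewrite mem_index_iota => /andP[mk _].
  by rewrite ltnNge (leq_trans (ltnW dm)) // mulr0.
rewrite (@big_cat_nat _ _ _ (deg G v)) //= [Y in _ + Y]big1_seq ?addr0.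
  by apply: eq_big_nat => k /andP[_ kd]; rewrite kd mulr1.
move=> k /andP[_]; rewrite mem_index_iota => /andP[dk _].
by rewrite ltnNge dk mulr0.
Qed.

(** The filter [P] keeps the range of the index available, which is where positivity of the
    arguments of ln comes from. *)
Lemma is_derive_bigsum (I : Type) (r : seq I) (P : pred I) (F : I -> R -> R)
    (dF : I -> R) (x : R) :
  (forall i, P i -> is_derive x 1 (F i) (dF i)) ->
  is_derive x 1 (fun y => \sum_(i <- r | P i) F i y) (\sum_(i <- r | P i) dF i).
Proof.
move=> FP; elim: r => [|i r IHr].
  have -> : (fun y => \sum_(i <- [::] | P i) F i y) = cst 0.
    by apply/funext => y; rewrite big_nil.
  by rewrite big_nil; apply: is_derive_cst.
rewrite big_cons; have -> : (fun y => \sum_(j <- i :: r | P j) F j y) =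
    (if P i then F i + (fun y => \sum_(j <- r | P j) F j y)
     else (fun y => \sum_(j <- r | P j) F j y)).
  by apply/funext => y; rewrite big_cons; case: (P i).
by case Pi : (P i) => //; apply: is_deriveD; apply: FP.
Qed.

Lemma is_derive_ln_affine (a b y : R) : 0 < a * y + b ->
  is_derive y 1 (fun z => ln (a * z + b)) (a / (a * y + b)).
Proof.
move=> h; pose g : R -> R := fun z => a * z + b.
have dg : is_derive y 1 g a.
  have -> : g = (a \*: id) + cst b by apply/funext => z.
  by rewrite -[X in is_derive _ _ _ X]addr0; apply: is_deriveD; rewrite -[X in is_derive _ _ _ X]mulr1; apply: is_deriveZ.
have dl : is_derive (g y) 1 (@ln R) (g y)^-1 by apply: is_derive1_ln.
rewrite mulrC.
exact: (@is_derive1_comp R (@ln R) g y _ _ dl dg).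
Qed.

End FiniteSeries.

(** * Slope of the rescaled score and location of the maximizer *)

Section Estimator.
Context {R : realType}.
Variables (m n : nat) (dmin dmax : R) (G : multigraph).
Hypothesis m1 : (1 <= m)%N.
Hypothesis n2 : (2 <= n)%N.
Hypothesis dminm : - m%:R < dmin.
Hypothesis iG : inv m n m G.

Local Notation mu := (m%:R + dmin).
Local Notation X d := ((2 * m)%:R + d).

Let mu_gt0 : 0 < mu.
Proof. by rewrite -ltrBlDl sub0r. Qed.

Definition Lfun (y : R) : R :=
  vsum (fun d => \sum_(m <= k < d) ln (k%:R + y)) n.+1 G
  - \sum_(2 <= t < n.+1) \sum_(1 <= i < m.+1) ln (S_norm m t i.-1 y).

Definition Vsum (y : R) : R :=
  \sum_(2 <= t < n.+1) \sum_(0 <= j < m) t%:R / Snorm m t j y.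

Definition score (y : R) : R := vsum (hsum m y) n.+1 G - Vsum y.

Lemma loglikE y : loglik m n G y = n.+1%:R^-1 * Lfun y.
Proof.
rewrite /loglik /Lfun mulrBr (sum_N_gt (fun k => ln (k%:R + y))).
by have /and5P[/eqP -> _ _ _ _] := iG.
Qed.

Lemma S_normE t j (y : R) : S_norm m t j y = t%:R * y + (2 * m * t.-1 + j)%:R.
Proof. by rewrite /S_norm natrD addrA. Qed.

Lemma is_derive_Lfun y : dmin <= y -> is_derive y 1 Lfun (score y).
Proof.
move=> ymin; have mu0 := mu_gt0.
have pos k : (m <= k)%N -> 0 < 1 * y + k%:R.
  by move=> mk; have mk' : m%:R <= k%:R :> R; [rewrite ler_nat | lra].
have d1 : is_derive y 1 (fun y => vsum (fun d => \sum_(m <= k < d) ln (k%:R + y)) n.+1 G)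
    (vsum (hsum m y) n.+1 G).
  apply: is_derive_bigsum => v _; rewrite /hsum.
  have -> : (fun z : R => \sum_(m <= k < deg G v) ln (k%:R + z)) =
      (fun z : R => \sum_(k <- index_iota m (deg G v) | (m <= k)%N) ln (1 * z + k%:R)).
    apply/funext => z; rewrite big_seq_cond [RHS]big_seq_cond.
    apply: eq_big => [k|k _]; last by rewrite mul1r addrC.
    by rewrite mem_index_iota; case: (m <= k)%N.
  have -> : \sum_(m <= l < deg G v) (l%:R + y)^-1 =
      \sum_(l <- index_iota m (deg G v) | (m <= l)%N) 1 / (1 * y + l%:R).
    rewrite big_seq_cond [RHS]big_seq_cond.
    apply: eq_big => [k|k _]; last by rewrite !mul1r addrC.
    by rewrite mem_index_iota; case: (m <= k)%N.
  by apply: is_derive_bigsum => k mk; apply: is_derive_ln_affine; apply: pos.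
have d2 : is_derive y 1 (fun y => \sum_(2 <= t < n.+1) \sum_(1 <= i < m.+1) ln (S_norm m t i.-1 y)) (Vsum y).
  have -> : (fun y => \sum_(2 <= t < n.+1) \sum_(1 <= i < m.+1) ln (S_norm m t i.-1 y)) =
    (fun y : R => \sum_(t <- index_iota 2 n.+1 | (2 <= t)%N) \sum_(0 <= j < m)
       ln (t%:R * y + (2 * m * t.-1 + j)%:R)).
    apply/funext => z; rewrite big_seq_cond [RHS]big_seq_cond.
    apply: eq_big => [t|t _]; first by rewrite mem_index_iota; case: (2 <= t)%N.
    by rewrite big_add1 /=; apply: eq_bigr => j _; rewrite S_normE.
  have -> : Vsum y = \sum_(t <- index_iota 2 n.+1 | (2 <= t)%N)
      \sum_(0 <= j < m) t%:R / (t%:R * y + (2 * m * t.-1 + j)%:R).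
    rewrite /Vsum big_seq_cond [RHS]big_seq_cond.
    by apply: eq_big => [t|t _] //; rewrite mem_index_iota; case: (2 <= t)%N.
  apply: is_derive_bigsum => t t2; apply: is_derive_bigsum => j _.
  apply: is_derive_ln_affine; apply: (Snorm_gt0 j _ t2); lra.
exact: is_deriveB d1 d2.
Qed.

Definition Hfun (y : R) : R := X y ^+ 2 * score y.

(** The first term keeps, for each vertex of degree above m, only the summand l = m of [hsum], where
    (2m - l)^2 = m^2. The constant bounds the share of the normalizers: m edges, numerators at most
    (2m)^2, and the sum of 1 / s^2 over s >= 2 at most 1. *)
Definition curvature : R :=
  m%:R ^+ 2 / (m%:R + dmax) ^+ 2 * (n.+1%:R - (N_eq G m)%:R)
  - (4 * m%:R ^+ 3) / mu ^+ 2.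

Lemma sum_inv_square t : (1 <= t)%N ->
  \sum_(2 <= s < t.+1) ((s%:R : R) ^+ 2)^-1 <= 1 - t%:R^-1.
Proof.
case: t => // t _; elim: t => [|t IHt]; first by rewrite big_geq // invr1 subrr.
rewrite big_nat_recr //=; apply: (le_trans (lerD IHt (lexx _))).
rewrite -!natr1; have t0 : 0 <= t%:R :> R by [].
set a := t%:R + 1; have a1 : 1 <= a by rewrite /a; lra.
have -> : 1 - a^-1 + ((a + 1) ^+ 2)^-1 = 1 - (a + 1)^-1 - (a * (a + 1) ^+ 2)^-1.
  by field; rewrite !gt_eqF; lra.
by rewrite gerBl invr_ge0 mulr_ge0 ?sqr_ge0 //; lra.
Qed.

(** Each summand has difference quotient 1 minus a nonnegative fraction; the fraction is kept only
    at l = m, the one index common to all vertices of degree above m. *)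
Lemma hsum_slope (x y : R) k : dmin <= x -> x <= y -> y <= dmax -> (m <= k)%N ->
  X y ^+ 2 * hsum m y k - X x ^+ 2 * hsum m x k <=
  (y - x) * ((k%:R - m%:R) - m%:R ^+ 2 / (m%:R + dmax) ^+ 2 * (m < k)%N%:R).
Proof.
move=> xmin xy ymax mk; have mu0 := mu_gt0.
set c1 := m%:R ^+ 2 / _.
have q l : (m <= l)%N -> X y ^+ 2 / (l%:R + y) - X x ^+ 2 / (l%:R + x) =
    (y - x) * (1 - ((2 * m)%:R - l%:R) ^+ 2 / ((l%:R + y) * (l%:R + x))).
  move=> ml; have ml' : m%:R <= l%:R :> R by rewrite ler_nat.
  by field; apply/andP; split; rewrite gt_eqF //; lra.
have qle l : (m <= l)%N -> X y ^+ 2 / (l%:R + y) - X x ^+ 2 / (l%:R + x) <=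
    (y - x) * (1 - c1 * (l == m)%:R).
  move=> ml; have ml' : m%:R <= l%:R :> R by rewrite ler_nat.
  rewrite q //; apply: ler_wpM2l; first lra.
  rewrite lerD2l lerN2; have ly : 0 < l%:R + y by lra.
  have lx : 0 < l%:R + x by lra.
  case: eqP => [lm|_]; last by rewrite mulr0; nonneg.
  rewrite mulr1 /c1 lm.
  have -> : ((2 * m)%:R - m%:R) ^+ 2 = m%:R ^+ 2 :> R by ring.
  apply: ler_wpM2l; first by nonneg.
  rewrite lm in ly lx; have dm0 : 0 < m%:R + dmax by lra.
  rewrite lef_pV2 ?posrE ?mulr_gt0 ?exprn_gt0 //.
  by rewrite expr2; apply: ler_pM; lra.
rewrite /hsum !mulr_sumr -sumrB.
apply: (@le_trans _ _ (\sum_(m <= l < k) (y - x) * (1 - c1 * (l == m)%:R))).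
  by apply: ler_sum_nat => l /andP[ml _]; apply: qle.
rewrite -mulr_sumr; apply: ler_wpM2l; first lra.
rewrite sumrB -mulr_sumr sumr_const_nat -natrB // lerD2l lerN2.
have [mk'|km] := ltnP m k; last by rewrite mulr0; rewrite mulr_ge0 ?sumr_ge0 // divr_ge0 ?sqr_ge0.
rewrite big_ltn // eqxx mulr1 ler_peMr //; first by rewrite divr_ge0 ?sqr_ge0.
by rewrite lerDl sumr_ge0.
Qed.

(** The same identity with t X = S + a, a = 2m - j. The fraction now has the unfavourable sign and
    is bounded above; S >= t mu makes it summable in t. *)
Lemma Vsum_slope (x y : R) : dmin <= x -> x <= y ->
  (y - x) * (m%:R * n.-1%:R - (4 * m%:R ^+ 3) / mu ^+ 2) <=
  X y ^+ 2 * Vsum y - X x ^+ 2 * Vsum x.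
Proof.
move=> xmin xy; have mu0 := mu_gt0.
rewrite /Vsum !mulr_sumr -sumrB.
pose C := 4 * m%:R ^+ 2 / mu ^+ 2.
have C0 : 0 <= C by rewrite /C; apply: divr_ge0; [nonneg|apply: sqr_ge0].
apply: (@le_trans _ _ (\sum_(2 <= t < n.+1) (y - x) * (m%:R * (1 - C / t%:R ^+ 2)))).
  rewrite -mulr_sumr; apply: ler_wpM2l; first lra.
  rewrite -mulr_sumr sumrB sumr_const_nat -mulr_sumr subSS.
  have -> : 4 * m%:R ^+ 3 / mu ^+ 2 = m%:R * C by rewrite /C; ring.
  rewrite -mulrBr; apply: ler_wpM2l => //; rewrite -subn1 lerD2l lerN2.
  rewrite ler_piMr //; apply: (le_trans (sum_inv_square (ltnW n2))).
  by rewrite gerBl invr_ge0.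
apply: ler_sum_nat => t /andP[t2 _]; rewrite !mulr_sumr -sumrB.
have -> : (y - x) * (m%:R * (1 - C / t%:R ^+ 2)) =
    \sum_(0 <= j < m) (y - x) * (1 - C / t%:R ^+ 2).
  by rewrite sumr_const_nat subn0 -mulr_natl; ring.
apply: ler_sum_nat => j /= jm.
have t0 : 0 < t%:R :> R by rewrite ltr0n ltnW.
have ymin : dmin <= y by lra.
have Sx := Snorm_mu m j xmin t2; have Sy := Snorm_mu m j ymin t2.
have tm0 : 0 < t%:R * mu by rewrite mulr_gt0.
have Sx0 := lt_le_trans tm0 Sx; have Sy0 := lt_le_trans tm0 Sy.
pose a : R := (2 * m)%:R - j%:R.
have SxE := SnormE m j x (ltnW t2); have SyE := SnormE m j y (ltnW t2).
have -> : X y ^+ 2 * (t%:R / Snorm m t j y) - X x ^+ 2 * (t%:R / Snorm m t j x) =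
   (y - x) * (1 - a ^+ 2 / (Snorm m t j y * Snorm m t j x)).
  have Xy : X y = (Snorm m t j y + a) / t%:R by rewrite SyE /a; field; rewrite gt_eqF.
  have Xx : X x = (Snorm m t j x + a) / t%:R by rewrite SxE /a; field; rewrite gt_eqF.
  have yx : y - x = (Snorm m t j y - Snorm m t j x) / t%:R.
    by rewrite SyE SxE; field; rewrite gt_eqF.
  rewrite Xy Xx yx; move: (Snorm m t j y) (Snorm m t j x) Sy0 Sx0 => S S' S0 S'0.
  by field; rewrite !gt_eqF.
apply: ler_wpM2l; first lra.
rewrite lerD2l lerN2.
have -> : C / t%:R ^+ 2 = (2 * m)%:R ^+ 2 / (t%:R * mu * (t%:R * mu)).
  by rewrite /C natrM; field; rewrite !gt_eqF.
apply: ler_pM.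
- exact: sqr_ge0.
- by rewrite invr_ge0 mulr_ge0 // ltW.
- have jm' : j%:R <= m%:R :> R by rewrite ler_nat ltnW.
  have j0 : 0 <= j%:R :> R by [].
  by rewrite /a natrM lerXn2r ?nnegrE; lra.
rewrite lef_pV2 ?posrE ?mulr_gt0 ?exprn_gt0 //.
by apply: ler_pM => //; apply: ltW.
Qed.

(* The terms linear in y cancel because both sums range over the m (n - 1) edges
   added after G_1. *)
Lemma Hfun_slope (x y : R) : dmin <= x -> x <= y -> y <= dmax ->
  Hfun y <= Hfun x - (y - x) * curvature.
Proof.
move=> xmin xy ymax; have V := Vsum_slope xmin xy.
have U : X y ^+ 2 * vsum (hsum m y) n.+1 G - X x ^+ 2 * vsum (hsum m x) n.+1 G <=
   (y - x) * (m%:R * n.-1%:R - m%:R ^+ 2 / (m%:R + dmax) ^+ 2 * (n.+1%:R - (N_eq G m)%:R)).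
  rewrite /vsum !mulr_sumr -sumrB.
  apply: (@le_trans _ _ (\sum_(0 <= v < n.+1) (y - x) * (((deg G v)%:R - m%:R) -
      m%:R ^+ 2 / (m%:R + dmax) ^+ 2 * (m < deg G v)%N%:R))).
    apply: ler_sum_nat => v /= vn; apply: hsum_slope => //.
    have [vn'|] := ltnP v n; first exact: inv_deg_ge iG vn'.
    move=> nv; have -> : v = n by lia.
    by case/and5P: iG => _ _ /eqP -> _ _.
  rewrite -mulr_sumr sumrB -mulr_sumr; apply: ler_wpM2l; first lra.
  have -> : \sum_(0 <= v < n.+1) ((deg G v)%:R - m%:R) = m%:R * n.-1%:R :> R.
    rewrite sumrB sumr_const_nat -natr_sum big_nat_recr //=.
    case/and5P: iG => _ _ /eqP -> /eqP -> _.
    by case: (n) n2 => [|k] // _; rewrite subn0 /= -mulr_natr; ring.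
  have -> // : \sum_(0 <= v < n.+1) (m < deg G v)%N%:R = n.+1%:R - (N_eq G m)%:R :> R.
  rewrite N_eq_sum; have /and5P[/eqP -> _ /eqP dn _ _] := iG.
  have -> : n.+1%:R = \sum_(0 <= v < n.+1) 1 :> R by rewrite sumr_const_nat subn0.
  rewrite -sumrB; apply: eq_big_nat => v /= vn.
  have : (m <= deg G v)%N.
    have [vn'|] := ltnP v n; first exact: inv_deg_ge iG vn'.
    by move=> nv; rewrite (_ : v = n) ?dn //; lia.
  by rewrite leq_eqVlt eq_sym => /orP[/eqP ->|h];
     rewrite ?ltnn ?eqxx ?subrr // h gtn_eqF // subr0.
have -> : Hfun y = X y ^+ 2 * vsum (hsum m y) n.+1 G - X y ^+ 2 * Vsum y.
  by rewrite /Hfun /score mulrBr.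
have -> : Hfun x = X x ^+ 2 * vsum (hsum m x) n.+1 G - X x ^+ 2 * Vsum x.
  by rewrite /Hfun /score mulrBr.
have -> : (y - x) * curvature = (y - x) * (m%:R * n.-1%:R - (4 * m%:R ^+ 3) / mu ^+ 2) -
  (y - x) * (m%:R * n.-1%:R - m%:R ^+ 2 / (m%:R + dmax) ^+ 2 * (n.+1%:R - (N_eq G m)%:R)).
  by rewrite /curvature; ring.
by lra.
Qed.

Lemma Lfun_MVT (x y : R) : dmin <= x -> x < y ->
  exists2 z, x < z < y & Lfun y - Lfun x = score z * (y - x).
Proof.
move=> xmin xy.
have D z : z \in `]x, y[%R -> is_derive z 1 Lfun (score z).
  by rewrite in_itv /= => /andP[xz _]; apply: is_derive_Lfun; lra.
have Cn : {within `[x, y], continuous Lfun}.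
  apply: derivable_within_continuous => z; rewrite in_itv /= => /andP[xz _].
  have zmin : dmin <= z by lra.
  by have [] := is_derive_Lfun zmin.
by have [z zxy E] := MVT xy D Cn; exists z => //; move: zxy; rewrite in_itv.
Qed.

Lemma score_sign z : dmin <= z ->
  (Hfun z < 0 -> score z < 0) /\ (0 < Hfun z -> 0 < score z).
Proof.
move=> zmin; have Xz := lt_le_trans mu_gt0 (mu_le_X m zmin).
have X2 : 0 < X z ^+ 2 by rewrite exprn_gt0.
by rewrite /Hfun pmulr_rlt0 // pmulr_rgt0.
Qed.

(** The slope bound makes H, hence the score, negative beyond y, so a maximizer d > y would have a
    smaller likelihood than y. Comparing values instead of solving score = 0 also covers maximizers
    at the end points and several maximizers. *)
Lemma argmax_le (x y d : R) : dmin <= x -> x <= y -> y <= dmax ->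
  0 <= curvature -> Hfun x < (y - x) * curvature ->
  is_argmax_on `[dmin, dmax] (loglik m n G) d -> d <= y.
Proof.
move=> xmin xy ymax c0 Hx [dI dmaxi]; rewrite leNgt; apply/negP => yd.
have yI : `[dmin, dmax]%classic y.
  by rewrite /= in_itv /=; apply/andP; split; lra.
have := dmaxi _ yI; rewrite !loglikE ler_pM2l ?invr_gt0 ?ltr0n //.
have ymin : dmin <= y by lra.
move: dI; rewrite /= in_itv /= => /andP[_ dd].
have [z /andP[yz zd] E] := Lfun_MVT ymin yd.
have zmin : dmin <= z by lra.
have xz : x <= z by lra.
have zmax : z <= dmax by lra.
have := Hfun_slope xmin xz zmax.
have h1 : (y - x) * curvature <= (z - x) * curvature.
  by apply: ler_wpM2r => //; lra.
move=> h2; have Hz : Hfun z < 0 by lra.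
have sz := (score_sign zmin).1 Hz.
have : score z * (d - y) < 0 by rewrite nmulr_rlt0 // subr_gt0.
by rewrite -E; lra.
Qed.

Lemma argmax_ge (x y d : R) : dmin <= y -> y <= x -> x <= dmax ->
  0 <= curvature -> - Hfun x < (x - y) * curvature ->
  is_argmax_on `[dmin, dmax] (loglik m n G) d -> y <= d.
Proof.
move=> ymin yx xmax c0 Hx [dI dmaxi]; rewrite leNgt; apply/negP => dy.
have yI : `[dmin, dmax]%classic y.
  by rewrite /= in_itv /=; apply/andP; split; lra.
have := dmaxi _ yI; rewrite !loglikE ler_pM2l ?invr_gt0 ?ltr0n //.
move: dI; rewrite /= in_itv /= => /andP[dd _].
have [z /andP[dz zy] E] := Lfun_MVT dd dy.
have zmin : dmin <= z by lra.
have zx : z <= x by lra.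
have := Hfun_slope zmin zx xmax.
have h1 : (x - y) * curvature <= (x - z) * curvature.
  by apply: ler_wpM2r => //; lra.
move=> h2; have Hz : 0 < Hfun z by lra.
have sz := (score_sign zmin).2 Hz.
have : 0 < score z * (y - d) by rewrite mulr_gt0 // subr_gt0.
by rewrite -E; lra.
Qed.

End Estimator.

(** * Error probabilities *)

Section Rates.
Context {R : realType}.

Lemma sqrt4 : Num.sqrt (4 : R) = 2.
Proof.
have -> : (4 : R) = 2 ^+ 2 by ring.
by rewrite sqrtr_sqr ger0_norm.
Qed.

Lemma near_powR_ge (q M : R) : 0 < q -> \forall n \near \oo, M <= (n%:R : R) `^ q.
Proof.
move=> q0; have [M0|M0] := leP M 0; first by near=> n; apply: (le_trans M0); apply: powR_ge0.
have := nbhs_infty_ger (M `^ q^-1); apply: filterS => n Mn.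
have -> : M = (M `^ q^-1) `^ q by rewrite -powRrM mulVf ?gt_eqF // powRr1 // ltW.
by apply: ge0_ler_powR; rewrite ?nnegrE ?powR_ge0 // ltW.
Unshelve. all: by end_near. Qed.

Lemma near_powR_le (e f : nat -> R) (q eps : R) : 0 < q -> 0 < eps ->
  (\forall n \near \oo, e n + q <= f n) ->
  \forall n \near \oo, n%:R `^ e n <= eps * n%:R `^ f n.
Proof.
move=> q0 eps0 ef; near=> n.
have n0 : 0 < n%:R :> R by rewrite ltr0n; near: n; exists 1%N.
have n1 : 1 <= n%:R :> R by rewrite ler1n; near: n; exists 1%N.
have nq : eps^-1 <= n%:R `^ q by near: n; apply: near_powR_ge.
have nef : e n + q <= f n by near: n.
apply: (@le_trans _ _ (eps * n%:R `^ (e n + q))); last first.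
  by rewrite ler_pM2l // ler_powR.
rewrite powRD ?(gt_eqF n0) ?implybT // mulrCA ler_peMr ?powR_ge0 //.
by rewrite -ler_pdivrMl // mulr1.
Unshelve. all: by end_near. Qed.

Lemma near_eq_pow (a : nat -> R) (p f eps : R) : eq_pow_o1 a p -> p < f -> 0 < eps ->
  \forall n \near \oo, a n <= eps * n%:R `^ f.
Proof.
move=> [e e0 ae] pf eps0; pose q := (f - p) / 2.
have q0 : 0 < q by rewrite /q; lra.
have := @near_powR_le (fun n => p + e n) (fun=> f) q eps q0 eps0.
have eq : \forall n \near \oo, p + e n + q <= f.
  move/cvgrPdist_lt: e0 => /(_ q q0) e1; near=> n.
  have : `|0 - e n| < q by near: n.
  by rewrite sub0r normrN => /ltr_normlW; rewrite /q; lra.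
move=> /(_ eq) h; near=> n.
have -> : a n = n%:R `^ (p + e n) by near: n.
by near: n.
Unshelve. all: by end_near. Qed.

Lemma near_sqrtS (f eps : R) : 1 / 2 < f -> 0 < eps ->
  \forall n \near \oo, Num.sqrt (n.+1%:R : R) <= eps * n%:R `^ f.
Proof.
move=> f2 eps0; have h : \forall n \near \oo, (n%:R : R) `^ 2^-1 <= eps / 2 * n%:R `^ f.
  apply: (@near_powR_le (fun=> 2^-1) (fun=> f) (f - 1 / 2)); rewrite ?divr_gt0 //; first lra.
  by near=> n; lra.
near=> n; have n1 : (1 <= n)%N by near: n; exists 1%N.
have hn : (n%:R : R) `^ 2^-1 <= eps / 2 * n%:R `^ f by near: n.
rewrite powR12_sqrt // in hn.
apply: (@le_trans _ _ (2 * Num.sqrt n%:R)); last by lra.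
rewrite -sqrt4.
by rewrite -sqrtrM // ler_wsqrtr // -natrM ler_nat; lia.
Unshelve. all: by end_near. Qed.

Lemma near_pow_le_n (f eps : R) : f < 1 -> 0 < eps ->
  \forall n \near \oo, (n%:R : R) `^ f <= eps * n%:R.
Proof.
move=> f1 eps0; have h := @near_powR_le (fun=> f) (fun=> 1) (1 - f) eps.
have : \forall n \near \oo, f + (1 - f) <= 1 by near=> n; lra.
move=> h0; have {h0}h : \forall n \near \oo, (n%:R : R) `^ f <= eps * n%:R `^ 1.
  by apply: h => //; rewrite subr_gt0.
near=> n; rewrite -[n%:R in leRHS]powRr1 //; near: n; exact: h.
Unshelve. all: by end_near. Qed.

Lemma near_sqrt_omega (a : nat -> R) (eps : R) : (forall n, 0 < a n) ->
  omega a (fun n => Num.sqrt n%:R * ln n%:R) -> 0 < eps ->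
  \forall n \near \oo, Num.sqrt (n.+1%:R : R) <= eps * a n.
Proof.
move=> a0 om eps0; have l2 : 0 < ln (2 : R) by rewrite ln_gt0 // ltr1n.
(* The factor ln 2 comes from ln n >= ln 2, the 2 from sqrt (n + 1) <= 2 sqrt n. *)
pose q := eps * ln 2 / 2; have q0 : 0 < q by rewrite /q divr_gt0 // mulr_gt0.
move/cvgrPdist_lt: om => /(_ q q0) om.
near=> n; have n2 : (2 <= n)%N by near: n; exists 2%N.
have : `|0 - Num.sqrt n%:R * ln n%:R / a n| < q by near: n.
rewrite sub0r normrN => /ltr_normlW; rewrite ltr_pdivrMr // /q => h.
have n0 : 0 < n%:R :> R by rewrite ltr0n ltnW.
have ln2 : ln 2 <= ln (n%:R : R) by rewrite ler_ln ?posrE // ler_nat.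
have h2 : Num.sqrt n%:R * ln 2 <= Num.sqrt n%:R * ln (n%:R : R).
  by rewrite ler_wpM2l ?sqrtr_ge0.
have h3 : 2 * Num.sqrt n%:R <= eps * a n.
  by rewrite -(ler_pM2r l2); lra.
apply: le_trans h3.
rewrite -sqrt4.
by rewrite -sqrtrM // ler_wsqrtr // -natrM ler_nat; lia.
Unshelve. all: by end_near. Qed.

Lemma eq_PA_law m (d d' : nat -> R) n : d =1 d' -> PA_law m d n = PA_law m d' n.
Proof. by move=> dd'; congr PA_law; apply/funext. Qed.

(** The changepoint is an integer in the model and a natural number in [dseq]; they agree once n >=
    c n^gamma. *)
Lemma delta_altE (d0 d1 c gamma : R) n : 0 <= n%:R - c * n%:R `^ gamma ->
  delta_alt d0 d1 c gamma n =1 dseq d0 d1 `|tau c gamma n|%N.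
Proof.
move=> h t; rewrite /delta_alt /dseq.
have t0 : 0 <= tau c gamma n by rewrite /tau floor_ge0.
by rewrite -{1}(gez0_abs t0) lez_nat.
Qed.

Lemma tau_bounds (c gamma : R) n : 0 <= c -> 0 <= n%:R - c * n%:R `^ gamma ->
  let T := `|tau c gamma n|%N in
  [/\ (T <= n)%N, c * n%:R `^ gamma <= n%:R - T%:R &
      n%:R - T%:R <= c * n%:R `^ gamma + 1].
Proof.
move=> c0 h T; have t0 : 0 <= tau c gamma n by rewrite /tau floor_ge0.
have TE : (T%:R : R) = (tau c gamma n)%:~R by rewrite -[tau c gamma n in RHS](gez0_abs t0).
have := floor_itv (n%:R - c * n%:R `^ gamma); rewrite -/(tau c gamma n) intrD -TE.
move=> /andP[h1 h2]; have p0 := powR_ge0 (n%:R : R) gamma.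
have cp := mulr_ge0 c0 p0.
split; [|lra|lra].
by rewrite -(ler_nat R); lra.
Qed.

End Rates.

(** * The null model *)

Section TypeI.
Context {R : realType}.
Variable m : nat.
Hypothesis m1 : (1 <= m)%N.

Lemma mu_gt0_of (dmin : R) : - m%:R < dmin -> 0 < m%:R + dmin.
Proof. by rewrite -ltrBlDl sub0r. Qed.

(** G_n is read as the stage (n + 1, 0), where the range of [vsum] covers exactly the vertices 0,
    ..., n of G_n. *)
Lemma nrm_PA (d : nat -> R) n F : (1 <= n)%N ->
  nrm (step_law m d n.+1 0) F = nrm (PA_law m d n) (fun G => F (add_vertex G)).
Proof. by move=> n1; rewrite /nrm expect_step_vertex. Qed.

Lemma leaves_vsum n G : inv m n m G -> vsum (ind m 0) n.+1 G = (N_eq G m)%:R :> R.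
Proof.
move=> /and5P[/eqP nG _ _ _ _]; rewrite N_eq_sum nG; apply: eq_bigr => v _.
by rewrite /ind addn0.
Qed.

Lemma sum_dseq (d0 d1 : R) (f : R -> R) T n : (1 <= T)%N -> (T <= n)%N ->
  \sum_(2 <= s < n.+1) f (dseq d0 d1 T s) =
  (T%:R - 1) * f d0 + (n%:R - T%:R) * f d1.
Proof.
move=> T1 Tn; rewrite (@big_cat_nat _ _ _ T.+1) //=; congr (_ + _).
  rewrite (@eq_big_nat _ _ _ _ _ _ (fun=> f d0)) => [|s /andP[_ sT]].
    by rewrite sumr_const_nat subSS -[LHS]mulr_natl natrB.
  by rewrite /dseq -ltnS sT.
rewrite (@eq_big_nat _ _ _ _ _ _ (fun=> f d1)) => [|s /andP[Ts _]].
  by rewrite sumr_const_nat subSS -[LHS]mulr_natl natrB.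
by rewrite /dseq leqNgt Ts.
Qed.

Lemma score_target_end (d0 d1 : R) K T y n : (1 <= T)%N -> (T <= n)%N ->
  score_target m d0 d1 K T y n.+1 0 = Vsum m n y + m%:R * wlim m d0 K *
   ((T%:R - 1) * ((d0 - y) / ((2 * m)%:R + d0)) + (n%:R - T%:R) * ((d1 - y) / ((2 * m)%:R + d1))).
Proof.
move=> T1 Tn; rewrite /score_target /Vsum [Y in _ + Y]big_geq // addr0.
rewrite -(sum_dseq d0 d1 (fun z => (z - y) / ((2 * m)%:R + z)) T1 Tn) mulr_sumr -big_split /=.
apply: eq_bigr => s _; rewrite /score_incr big_split /=; congr (_ + _).
by rewrite sumr_const_nat subn0 -mulr_natl; ring.
Qed.

Lemma leaf_target_end (d0 d1 : R) T n : (1 <= T)%N -> (T <= n)%N ->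
  leaf_target m d0 d1 T n.+1 0 = p_m m d0 * n.+1%:R
   + m%:R * (n%:R - T%:R) * (gleaf m d0 d1 - gleaf m d0 d0).
Proof.
move=> T1 Tn; rewrite /leaf_target mul0r addr0.
by rewrite (sum_dseq d0 d1 (fun z => m%:R * (gleaf m d0 z - gleaf m d0 d0)) T1 Tn); ring.
Qed.

(** The denominator of p_m multiplied by m. *)
Definition qden (y : R) : R := (2 * m)%:R + y + m%:R * (m%:R + y).

Lemma qden_ge (y : R) : - m%:R < y -> m%:R <= qden y.
Proof.
move=> ym; have mp : 1 <= m%:R :> R by rewrite ler1n.
have : 0 <= m%:R * (m%:R + y) by rewrite mulr_ge0 //; lra.
by rewrite /qden natrM; lra.
Qed.

Lemma qden_gt0 (y : R) : - m%:R < y -> 0 < qden y.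
Proof. by move=> ym; apply: lt_le_trans (qden_ge ym); rewrite ltr0n. Qed.

Lemma p_mE (y : R) : - m%:R < y -> p_m m y = ((2 * m)%:R + y) / qden y.
Proof.
move=> ym; have q0 := qden_gt0 ym; have mp : 1 <= m%:R :> R by rewrite ler1n.
rewrite /p_m /qden natrM; field.
rewrite /qden natrM in q0.
by apply/andP; split; rewrite gt_eqF //; lra.
Qed.

Lemma p_m_diff (x y : R) : - m%:R < x -> - m%:R < y ->
  p_m m x - p_m m y = m%:R ^+ 2 * (y - x) / (qden x * qden y).
Proof.
move=> xm ym; have qx := qden_gt0 xm; have qy := qden_gt0 ym.
rewrite !p_mE //.
have -> : m%:R ^+ 2 * (y - x) = ((2 * m)%:R + x) * qden y - ((2 * m)%:R + y) * qden x.
  by rewrite /qden natrM; ring.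
by move: (qden x) (qden y) qx qy => a b a0 b0; field; rewrite !gt_eqF.
Qed.

Lemma p_m_lipschitz (x y : R) : - m%:R < x -> - m%:R < y ->
  `|p_m m x - p_m m y| <= `|x - y|.
Proof.
move=> xm ym; have qx := qden_gt0 xm; have qy := qden_gt0 ym.
rewrite p_m_diff // normrM (normrM (_ ^+ 2)) normfV (gtr0_norm (mulr_gt0 qx qy)) distrC.
rewrite (ger0_norm (sqr_ge0 _)) ler_pdivrMr ?mulr_gt0 // mulrC; apply: ler_wpM2l => //.
by rewrite expr2; apply: ler_pM => //; apply: qden_ge.
Qed.

Lemma p_m_bounds (y : R) : - m%:R < y -> 0 < p_m m y < 1.
Proof.
move=> ym; have q0 := qden_gt0 ym; have mp : 1 <= m%:R :> R by rewrite ler1n.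
rewrite p_mE // divr_gt0 //=; last by rewrite natrM; lra.
by rewrite ltr_pdivrMr // mul1r /qden ltrDl mulr_gt0 //; lra.
Qed.

(** A proportion 1 - p_m of the vertices has degree above m. One half is given up to the deviation
    of N_m, and half of the rest to the constant in [curvature]. *)
Definition kappa (d0 dmax : R) : R :=
  m%:R ^+ 2 / (m%:R + dmax) ^+ 2 * (1 - p_m m d0) / 4.

Lemma kappa_gt0 (d0 dmax : R) : - m%:R < d0 -> - m%:R < dmax -> 0 < kappa d0 dmax.
Proof.
move=> d0m dmaxm; have /andP[_ p1] := p_m_bounds d0m.
have dm0 : 0 < m%:R + dmax by rewrite -ltrBlDl sub0r.
apply: divr_gt0 => //; apply: mulr_gt0; last by rewrite subr_gt0.
by apply: divr_gt0; apply: exprn_gt0 => //; rewrite ltr0n.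
Qed.

Lemma curvature_ge (n : nat) (d0 dmin dmax : R) G :
  - m%:R < dmin -> dmin <= dmax ->
  (4 * m%:R ^+ 3) / (m%:R + dmin) ^+ 2 <= kappa d0 dmax * n%:R ->
  (N_eq G m)%:R <= n.+1%:R - (1 - p_m m d0) / 2 * n%:R ->
  kappa d0 dmax * n%:R <= curvature m n dmin dmax G.
Proof.
move=> dminm dd; rewrite /curvature /kappa; set c1 := _ / (m%:R + dmax) ^+ 2.
set C0 := _ / (m%:R + dmin) ^+ 2; set N := (N_eq G m)%:R; set p := p_m m d0 => hC hN.
have c10 : 0 <= c1 by apply: divr_ge0; apply: sqr_ge0.
have : c1 * ((1 - p) / 2 * n%:R) <= c1 * (n.+1%:R - N).
  by apply: ler_wpM2l => //; move: hN; clear => *; lra.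
by move: hC; clear => *; lra.
Qed.

(** Within radius b / (4n) of d0, n p_m moves by at most b / 4. The deviation of N_m and the extra
    p_m from n + 1 against n cost less than b / 4 each. *)
Lemma Q_null_lt (n : nat) (d0 dmin dmax b d : R) G :
  (2 <= n)%N -> - m%:R < dmin -> dmin <= d0 -> d0 <= dmax -> inv m n m G ->
  4 < b -> dmin <= d0 - b / (4 * n%:R) -> d0 + b / (4 * n%:R) <= dmax ->
  0 <= curvature m n dmin dmax G ->
  `|Hfun m n G d0| < b / (4 * n%:R) * curvature m n dmin dmax G ->
  `|(N_eq G m)%:R - p_m m d0 * n.+1%:R| < b / 4 ->
  is_argmax_on `[dmin, dmax] (loglik m n G) d ->
  `|(N_eq G m)%:R - n%:R * p_m m d| < b.
Proof.
move=> n2 dminm dmin0 d0max iG b4; set r := b / _ => lo hi cur0 HF f1 eG.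
have d0m : - m%:R < d0 by apply: lt_le_trans dmin0.
have np : 0 < n%:R :> R by rewrite ltr0n ltnW.
have rn : r * n%:R = b / 4 by rewrite /r; field; rewrite gt_eqF.
have r0 : 0 <= r.
  by apply: divr_ge0; [apply: ltW; apply: lt_trans b4|nonneg].
have dhi : d <= d0 + r.
  apply: (argmax_le m1 n2 dminm iG dmin0 _ hi cur0 _ eG); first by rewrite lerDl.
  by rewrite addrAC subrr add0r; apply: ltr_normlW.
have dlo : d0 - r <= d.
  apply: (argmax_ge m1 n2 dminm iG lo _ d0max cur0 _ eG); first by rewrite gerBl.
  by rewrite opprB addrC subrK; apply: ltr_normlW; rewrite normrN.
have dm : - m%:R < d by apply: lt_le_trans dlo; apply: lt_le_trans lo.
have pd : `|p_m m d0 - p_m m d| <= r.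
  apply: (le_trans (p_m_lipschitz d0m dm)).
  by rewrite ler_norml; move: dhi dlo; clear => *; lra.
set N := (N_eq G m)%:R in f1 *; set p := p_m m d0 in f1 pd *.
have /andP[p0 p1] : 0 < p < 1 by apply: p_m_bounds.
have -> : N - n%:R * p_m m d =
   (N - p * n.+1%:R) + p + n%:R * (p - p_m m d) by rewrite -natr1; ring.
apply: (le_lt_trans (ler_normD _ _)).
have h1 : `|N - p * n.+1%:R + p| < b / 4 + p.
  by apply: (le_lt_trans (ler_normD _ _)); rewrite (gtr0_norm p0) ltrD2r.
have h2 : `|n%:R * (p - p_m m d)| <= b / 4.
  by rewrite normrM normr_nat -rn mulrC; apply: ler_wpM2r.
by move: h1 h2 p1 b4; clear => *; lra.
Qed.

Lemma type_I_error (d0 dmin dmax : R) (dhat : nat -> multigraph -> R) (a : nat -> R) :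
  - m%:R < dmin -> dmin < d0 -> d0 < dmax ->
  is_estimator m dmin dmax dhat ->
  (forall n, 0 < a n) ->
  a n @[n --> \oo] --> +oo ->
  omega a (fun n => Num.sqrt n%:R * ln n%:R) ->
  eq_pow_o1 a (1 / 2) ->
  P_null m d0 n (fun G => test m dhat a n G != 0%N) @[n --> \oo] --> (0 : R).
Proof.
move=> dminm dmin0 d0max est a0 ainf om apow.
have d0m := lt_trans dminm dmin0.
have [C1 C10 H1] := count_concentration m1 d0m d0m 0.
have [D D0 HD] := score_concentration m1 dminm (ltW dmin0) (ltW d0max) (ltW dmin0) (ltW d0max).
have [C2 C20 H2] := HD 1%N isT => {HD}.
have /andP[p0 p1] := p_m_bounds d0m; have dmaxm := lt_trans d0m d0max.
have kap0 := kappa_gt0 d0m dmaxm.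
have X0 := lt_le_trans (mu_gt0_of dminm) (mu_le_X m (ltW dmin0)).
(* Chosen so that a score below eta a_n keeps the estimator within a_n / (4n) of d0 when the
   curvature is at least kappa n. *)
pose eta := kappa d0 dmax / (4 * ((2 * m)%:R + d0) ^+ 2).
have eta0 : 0 < eta.
  by apply: divr_gt0 => //; apply: mulr_gt0 => //; apply: exprn_gt0.
apply/cvgrPdist_lt => e e0.
(* As d <= 1, d^2 <= e / 3, and the two Chebyshev bounds add up to less than e. *)
have [d [d0' d1 de]] : exists d : R, [/\ 0 < d, d <= 1 & d <= e / 3].
  exists (Num.min 1 (e / 3)); rewrite lt_min ltr01 divr_gt0 //.
  by rewrite !ge_min !lexx orbT.
pose M := 4 * C1 + C2 / eta + 1.
have M0 : 0 < M.
  apply: ltr_wpDl => //; apply: addr_ge0; first by nonneg.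
  by apply: divr_ge0 => //; apply: ltW.
(* Eventually a_n <= sp n. The three bounds on sp keep enough vertices of degree above m and the
   interval d0 +/- a_n / (4n) inside [dmin, dmax]. *)
have [sp [sp0 s1 s2 s3]] : exists sp : R,
    [/\ 0 < sp, sp <= 1 - p_m m d0, sp <= (dmax - d0) * 4 & sp <= (d0 - dmin) * 4].
  exists (Num.min (1 - p_m m d0) (Num.min ((dmax - d0) * 4) ((d0 - dmin) * 4))).
  by rewrite !lt_min !subr_gt0 p1 !mulr_gt0 ?subr_gt0 // !ge_min !lexx ?orbT.
near=> n.
have n2 : (2 <= n)%N by near: n; exists 2%N.
have sa : Num.sqrt (n.+1%:R : R) <= d / M * a n.
  by near: n; apply: near_sqrt_omega => //; rewrite divr_gt0.
have an : a n <= sp * n%:R `^ 1.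
  by near: n; apply: near_eq_pow apow _ sp0; rewrite ltr_pdivrMr // mul1r ltr1n.
have a4 : 4 < a n by near: n; move/cvgryPgt : ainf; apply.
have nC0 : (4 * m%:R ^+ 3) / (m%:R + dmin) ^+ 2 <= kappa d0 dmax * n%:R.
  rewrite [leRHS]mulrC -ler_pdivrMr //; near: n; exact: nbhs_infty_ger.
have n1 := ltnW n2; have np : 0 < n%:R :> R by rewrite ltr0n.
rewrite powRr1 ?ler0n // in an.
have an0 := a0 n.
(* The null model as a changepoint at n + 1 with equal parameters: no step lies past it, so the
   window error is 0. *)
pose dd := dseq d0 d0 n.+1.
have dE : delta_null d0 =1 dd by move=> t; rewrite /dd /dseq /delta_null; case: ifP.
have dgt t : - m%:R < dd t by rewrite -dE.
have law := is_law_PA dgt n1.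
rewrite /P_null (eq_PA_law _ _ dE).
pose F1 G : R := vsum (ind m 0) n.+1 G - p_m m d0 * n.+1%:R.
pose F2 G : R := score m n G d0.
have N1 : nrm (PA_law m dd n) F1 <= C1 * Num.sqrt n.+1%:R.
  rewrite -(nrm_PA dd F1 n1); have := H1 n.+1 n.+1 0%N.
  by rewrite /err subnn addr0; apply.
(* At y = d0 the prediction reduces to [Vsum], so the deviation is the score itself, and the error
   terms in |y - d0| vanish. *)
have N2 : nrm (PA_law m dd n) F2 <= C2 * Num.sqrt n.+1%:R.
  rewrite -(nrm_PA dd F2 n1); have := H2 n.+1 d0 n.+1 0%N.
  rewrite subrr normr0 !mul0r subnn expr0n /= !mul0r !addr0 mulr0 mul0r addr0.
  move=> H; apply: le_trans (H (ltW dmin0) (ltW d0max) _ _) => //.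
  rewrite le_eqVlt; apply/orP; left; apply/eqP; apply: eq_nrm => G.
  rewrite /F2 /score; congr (_ - _).
  rewrite /score_target [Y in _ = _ + Y]big_geq // addr0; apply: eq_bigr => s _; apply: eq_bigr => j _.
  by rewrite /score_incr /dseq; case: ifP => _; rewrite subrr !mul0r addr0.
have key G : inv m n m G -> test m dhat a n G != 0%N ->
    (a n / 4 <= `|F1 G|) || (eta * a n <= `|F2 G|).
  move=> iG tG; apply/negP => /negP; rewrite negb_or -!ltNge => /andP[f1 f2].
  move: tG; rewrite /test eqb0 negbK leNgt => /negP; apply.
  rewrite /F1 leaves_vsum // in f1.
  have rn : a n / (4 * n%:R) * n%:R = a n / 4 by field; rewrite gt_eqF.
  have ran : a n / (4 * n%:R) * 4 <= sp.
    by rewrite -(ler_pM2r np) mulrAC rn; move: an; clear => *; lra.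
  have anp : a n <= (1 - p_m m d0) * n%:R by apply: (le_trans an); apply: ler_wpM2r.
  have cur : kappa d0 dmax * n%:R <= curvature m n dmin dmax G.
    apply: curvature_ge => //; first exact: le_trans (ltW dmin0) (ltW d0max).
    move: (ltr_normlW f1) anp p1 p0 an0; rewrite -(natr1 n).
    by move: (p_m m d0) ((N_eq G m)%:R) => p' N'; move: (n%:R) (a n) => n' a'; clear => *; lra.
  have cur0 : 0 <= curvature m n dmin dmax G by apply: le_trans cur; nonneg.
  apply: Q_null_lt (ltW dmin0) (ltW d0max) iG a4 _ _ cur0 _ f1 (est n G) => //.
  - by move: ran s3; clear => *; lra.
  - by move: ran s2; clear => *; lra.
  apply: (@lt_le_trans _ _ (a n / (4 * n%:R) * (kappa d0 dmax * n%:R))); last first.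
    by apply: ler_wpM2l => //; nonneg.
  rewrite /Hfun normrM (ger0_norm (sqr_ge0 _)).
  have -> : a n / (4 * n%:R) * (kappa d0 dmax * n%:R) =
      ((2 * m)%:R + d0) ^+ 2 * (eta * a n).
    rewrite mulrCA rn /eta; move: (_ + d0) X0 => X X0.
    by field; rewrite gt_eqF.
  by rewrite ltr_pM2l // exprn_gt0.
have sq u : 0 <= u -> u <= d -> u ^+ 2 <= e / 3.
  move=> u0 ud; apply: le_trans de; apply: (le_trans _ ud).
  by rewrite expr2 ler_piMr // (le_trans ud).
have Ma : Num.sqrt (n.+1%:R : R) * M <= d * a n.
  by rewrite -ler_pdivlMr // mulrAC.
have s0 : 0 <= Num.sqrt (n.+1%:R : R) by apply: sqrtr_ge0.
have b1 : nrm (PA_law m dd n) F1 / (a n / 4) <= d.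
  rewrite ler_pdivrMr ?divr_gt0 //; apply: (le_trans N1).
  have : 0 <= Num.sqrt n.+1%:R * (C2 / eta + 1).
    by apply: mulr_ge0 => //; apply: addr_ge0 => //; apply: divr_ge0 => //; apply: ltW.
  by move: Ma; rewrite /M; move: (Num.sqrt _) (a n) (C2 / eta) => u v w; clear => *; lra.
have b2 : nrm (PA_law m dd n) F2 / (eta * a n) <= d.
  rewrite (ler_pdivrMr _ _ (mulr_gt0 eta0 an0)); apply: (le_trans N2).
  have -> : d * (eta * a n) = eta * (d * a n) by ring.
  apply: (@le_trans _ _ (eta * (Num.sqrt n.+1%:R * M))); last by rewrite ler_pM2l.
  have -> : eta * (Num.sqrt n.+1%:R * M) = C2 * Num.sqrt n.+1%:R + eta * (Num.sqrt n.+1%:R * (4 * C1 + 1)).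
    by rewrite /M; field; rewrite gt_eqF.
  by rewrite lerDl; nonneg.
have P1 := chebyshev law F1 (divr_gt0 an0 (ltr0Sn R 3)).
have P2 := chebyshev law F2 (mulr_gt0 eta0 an0).
rewrite sub0r normrN (ger0_norm (prob_ge0 law _)).
apply: (le_lt_trans (prob_le2 law key)).
have q1 : (nrm (PA_law m dd n) F1 / (a n / 4)) ^+ 2 <= e / 3.
  by apply: sq => //; rewrite divr_ge0 ?nrm_ge0 // ltW // divr_gt0.
have q2 : (nrm (PA_law m dd n) F2 / (eta * a n)) ^+ 2 <= e / 3.
  by apply: sq => //; rewrite divr_ge0 ?nrm_ge0 // ltW // mulr_gt0.
by move: q1 q2 P1 P2 e0; clear => *; lra.
Unshelve. all: by end_near. Qed.

End TypeI.

(** * First-order shifts under the alternative *)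

Section TypeII.
Context {R : realType}.
Variable m : nat.
Hypothesis m1 : (1 <= m)%N.
Variables d0 d1 c : R.
Hypothesis d0m : - m%:R < d0.
Hypothesis d1m : - m%:R < d1.
Hypothesis c0 : 0 < c.
Hypothesis d01 : d0 <> d1.

Local Notation X d := ((2 * m)%:R + d).
Local Notation p := (p_m m d0).

(** The sign of d1 - d0; multiplying by it treats both directions of the change at once. *)
Definition side : R := if d0 < d1 then 1 else -1.

Lemma side_mul : side * (d1 - d0) = `|d1 - d0|.
Proof.
rewrite /side; case: ltP => h; first by rewrite mul1r ger0_norm // subr_ge0 ltW.
by rewrite mulN1r ler0_norm // subr_le0.
Qed.

Lemma sideV (z : R) : `|side * z| = `|z|.
Proof. by rewrite /side; case: ifP => _; rewrite ?mul1r ?mulN1r ?normrN. Qed.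

Lemma gap_gt0 : 0 < `|d1 - d0|.
Proof. by rewrite normr_gt0 subr_eq0; apply/eqP => h; apply: d01. Qed.

(* To first order the estimator moves to d0 + [shift1] n^(gamma - 1), while
   N_m = n p_m(d) would force d = d0 + [shift1] / p_m(d0) n^(gamma - 1). The
   comparison point is taken strictly in between. *)
Definition shift1 : R := c * (d1 - d0) * X d0 / X d1.
Definition shift : R := shift1 * (2 / (1 + p)).

Let X0_gt0 : 0 < X d0.
Proof. by have := X_gt0 m1 d0m. Qed.

Let X1_gt0 : 0 < X d1.
Proof. by have := X_gt0 m1 d1m. Qed.

Let p_gt0 : 0 < p.
Proof. by have /andP[] := p_m_bounds m1 d0m. Qed.

Let p_lt1 : p < 1.
Proof. by have /andP[] := p_m_bounds m1 d0m. Qed.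

Let abs_shift : R := c * `|d1 - d0| * X d0 / X d1 * (2 / (1 + p)).

Lemma side_shift : side * shift = abs_shift.
Proof. by rewrite /shift /shift1 /abs_shift -side_mul; ring. Qed.

Lemma abs_shift_ge0 : 0 <= abs_shift.
Proof.
have h : 0 <= 1 + p by apply: addr_ge0 => //; apply: ltW.
have h1 := ltW X0_gt0; have h2 := ltW X1_gt0; have h3 := ltW c0.
by rewrite /abs_shift; nonneg.
Qed.

Lemma norm_shift : `|shift| = abs_shift.
Proof. by rewrite -[LHS]sideV side_shift ger0_norm // abs_shift_ge0. Qed.

(** The factor 2 / (1 + p) in [shift], the harmonic mean of 1 and 1 / p, exceeds 1 by (1 - p) / (1 +
    p). This excess fixes the sign of the score at the comparison point. *)
Definition rate : R := c * `|d1 - d0| * ((1 - p) / (1 + p)) / X d1.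

Lemma rate_gt0 : 0 < rate.
Proof.
have h : 0 < 1 + p by apply: addr_gt0.
apply: divr_gt0 => //; apply: mulr_gt0; first by apply: mulr_gt0 => //; apply: gap_gt0.
by apply: divr_gt0 => //; rewrite subr_gt0.
Qed.

Definition drift_const : R := (c + 2) * abs_shift / X d0 + `|d1 - d0| / X d1.

(** * Drifts at the comparison point, with g = n^gamma, N = n and nu = n - T *)

Section Size.
Variables (g N nu eps : R).
Hypothesis g0 : 0 < g.
Hypothesis N0 : 0 < N.
Hypothesis eps0 : 0 < eps.
Hypothesis eps1 : eps <= 1.
Hypothesis gN : g <= eps * N.
Hypothesis g1 : 1 <= eps * g.
Hypothesis nu1 : c * g <= nu.
Hypothesis nu2 : nu <= c * g + 1.

Local Notation y := (d0 + shift * (g / N)).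

Lemma gN_le : g / N <= eps.
Proof. by rewrite ler_pdivrMr. Qed.

Lemma nuS_le : nu + 1 <= (c + 2) * g.
Proof.
have : eps * g <= g by rewrite ler_piMl // ltW.
by move: nu2 g1; move=> *; lra.
Qed.

Lemma nu_ge0 : 0 <= nu.
Proof. by apply: le_trans nu1; rewrite mulr_ge0 // ltW. Qed.

(** To first order the pull back to d0 is - [abs_shift] g / X d0 and the push after the changepoint
    c |d1 - d0| g / X d1; they sum to - [rate] g. The rest is smaller by a factor eps or has the
    good sign. *)
Lemma score_drift_sign :
  side * ((N - nu - 1) * ((d0 - y) / X d0) + nu * ((d1 - y) / X d1))
  <= (eps * drift_const - rate) * g.
Proof.
set u := g / N.
have u0 : 0 <= u by apply: divr_ge0; apply: ltW.
have -> : side * ((N - nu - 1) * ((d0 - (d0 + shift * u)) / X d0)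
    + nu * ((d1 - (d0 + shift * u)) / X d1)) =
  - (abs_shift * (N * u) / X d0) + (nu + 1) * u * (abs_shift / X d0)
  + nu * (`|d1 - d0| / X d1) - nu * u * (abs_shift / X d1).
  by rewrite -side_shift -side_mul; ring.
have Nu : N * u = g by rewrite /u mulrCA divff ?mulr1 // gt_eqF.
have S0 := abs_shift_ge0.
have h1 : (nu + 1) * u * (abs_shift / X d0) <= (c + 2) * g * eps * (abs_shift / X d0).
  apply: ler_wpM2r; first by apply: divr_ge0 => //; apply: ltW.
  apply: ler_pM => //; last exact: gN_le; last exact: nuS_le.
  by apply: addr_ge0 => //; apply: nu_ge0.
have A0 : 0 <= `|d1 - d0| / X d1 by apply: divr_ge0 => //; apply: ltW.
have h2 : nu * (`|d1 - d0| / X d1) <= (c * g + eps * g) * (`|d1 - d0| / X d1).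
  by apply: ler_wpM2r => //; apply: (le_trans nu2); rewrite lerD2l.
have h3 : 0 <= nu * u * (abs_shift / X d1).
  have := nu_ge0 => n0; apply: mulr_ge0; first exact: mulr_ge0.
  by apply: divr_ge0 => //; apply: ltW.
have h4 : abs_shift * (N * u) / X d0 = (c * `|d1 - d0| / X d1 + rate) * g.
  have := p_gt0; have := X0_gt0; have := X1_gt0 => x1 x0 p'.
  rewrite Nu /abs_shift /rate; move: (X d0) (X d1) (p) x1 x0 p' => a b q a0 b0 q0.
  by field; rewrite !gt_eqF //; apply: addr_gt0.
rewrite h4 /drift_const; move: h1 h2 h3.
have -> : (eps * ((c + 2) * abs_shift / X d0 + `|d1 - d0| / X d1) - rate) * g =
  (c + 2) * g * eps * (abs_shift / X d0) + (c * g + eps * g) * (`|d1 - d0| / X d1)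
  - (c * `|d1 - d0| / X d1 + rate) * g by ring.
move: (nu * u * _) ((nu + 1) * u * _) (nu * _) ((c + 2) * g * eps * _) => v1 v2 v3 v4.
by move: ((c * g + _) * _) ((c * _ / _ + rate) * g) => v5 v6; move=> *; lra.
Qed.

(** The margin on the other side of the harmonic mean: 1 - 2p / (1 + p) is again (1 - p) / (1 +
    p). *)
Definition leaf_rate : R :=
  m%:R ^+ 2 * p * c * `|d1 - d0| * ((1 - p) / (1 + p)) / (X d0 * X d1).

Definition leaf_const : R := 1 + (1 + m%:R) * m%:R ^+ 2 * abs_shift ^+ 2.

(** The drift of N_m past the changepoint outweighs the change of n p_m from d0 to y. Using p = X d0
    / [qden] at d0, the leading terms differ by [leaf_rate] g; replacing [qden] at y by its value at
    d0 costs a factor eps. *)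
Lemma leaf_gap : - m%:R < y ->
  side * (p + m%:R * nu * (gleaf m d0 d1 - gleaf m d0 d0) + N * (p - p_m m y))
  <= (eps * leaf_const - leaf_rate) * g.
Proof.
move=> ym; have q0 := qden_gt0 m1 d0m; have qy := qden_gt0 m1 ym.
have S0 := abs_shift_ge0; have mp : 1 <= m%:R :> R by rewrite ler1n.
set u := g / N.
have u0 : 0 <= u by apply: divr_ge0; apply: ltW.
have Nu : N * u = g by rewrite /u mulrCA divff ?mulr1 // gt_eqF.
have pE : p = X d0 / qden m d0 by apply: p_mE.
have gE : gleaf m d0 d1 - gleaf m d0 d0 = - (p * m%:R * (d1 - d0) / (X d0 * X d1)).
  rewrite /gleaf; have := X0_gt0; have := X1_gt0; rewrite natrM => x1 x0.
  by field; rewrite !gt_eqF.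
have -> : p - p_m m y = m%:R ^+ 2 * (shift * u) / (qden m d0 * qden m y).
  by rewrite p_m_diff // addrAC subrr add0r.
have -> : side * (p + m%:R * nu * (gleaf m d0 d1 - gleaf m d0 d0)
    + N * (m%:R ^+ 2 * (shift * u) / (qden m d0 * qden m y))) =
  side * p - m%:R ^+ 2 * p * nu * `|d1 - d0| / (X d0 * X d1)
    + m%:R ^+ 2 * abs_shift * (N * u) / (qden m d0 * qden m y).
  by rewrite gE -side_mul -side_shift; ring.
rewrite Nu.
have h1 : side * p <= eps * g.
  apply: le_trans g1; rewrite /side; have := p_lt1; have := p_gt0.
  by case: ifP => _; move=> *; lra.
have XX : 0 <= (X d0 * X d1)^-1 by rewrite invr_ge0 mulr_ge0 // ltW.
have h2 : m%:R ^+ 2 * p * (c * g) * `|d1 - d0| / (X d0 * X d1) <=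
    m%:R ^+ 2 * p * nu * `|d1 - d0| / (X d0 * X d1).
  apply: ler_wpM2r => //; apply: ler_wpM2r => //; apply: ler_wpM2l => //.
  by apply: mulr_ge0; [apply: sqr_ge0|apply: ltW].
have qq : (qden m d0 * qden m y)^-1 <= (qden m d0 ^+ 2)^-1 + (1 + m%:R) * (abs_shift * u).
  have -> : (qden m d0 * qden m y)^-1 = (qden m d0 ^+ 2)^-1
      + (qden m d0 - qden m y) / (qden m d0 ^+ 2 * qden m y).
    by move: (qden m d0) (qden m y) q0 qy => a b a0 b0; field; rewrite !gt_eqF.
  rewrite lerD2l; apply: (le_trans (ler_norm _)).
  have Q1 : 1 <= qden m d0 ^+ 2 * qden m y.
    rewrite -[1]mulr1; apply: ler_pM => //.
      rewrite -(expr1n _ 2) lerXn2r ?nnegrE //; first exact: ltW.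
      exact: le_trans mp (qden_ge m1 d0m).
    exact: le_trans mp (qden_ge m1 ym).
  have Q0 := lt_le_trans ltr01 Q1.
  rewrite normrM normfV (gtr0_norm Q0) ler_pdivrMr //.
  have -> : qden m d0 - qden m y = - ((1 + m%:R) * (shift * u)) by rewrite /qden -/u; ring.
  rewrite normrN normrM normrM norm_shift (ger0_norm u0) (ger0_norm (_ : 0 <= 1 + m%:R)) ?addr_ge0 //.
  by rewrite ler_peMr //; nonneg.
have h3 : m%:R ^+ 2 * abs_shift * g / (qden m d0 * qden m y) <=
   m%:R ^+ 2 * abs_shift * g * ((qden m d0 ^+ 2)^-1 + (1 + m%:R) * (abs_shift * eps)).
  apply: ler_wpM2l; first by have := ltW g0 => ?; nonneg.
  apply: (le_trans qq); rewrite lerD2l; apply: ler_wpM2l; first by nonneg.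
  by apply: ler_wpM2l => //; apply: gN_le.
have h4 : m%:R ^+ 2 * abs_shift * g / qden m d0 ^+ 2 =
   m%:R ^+ 2 * p * (c * g) * `|d1 - d0| / (X d0 * X d1) - leaf_rate * g.
  have -> : (m%:R ^+ 2 * abs_shift * g / qden m d0 ^+ 2 : R) =
     m%:R ^+ 2 * abs_shift * g * (p / X d0) ^+ 2.
    rewrite pE; have := X0_gt0; move: (X d0) (qden m d0) q0 => a b b0 a0.
    by field; rewrite !gt_eqF.
  have := p_gt0; have := X0_gt0; have := X1_gt0 => x1 x0 p'.
  rewrite /leaf_rate /abs_shift; move: (X d0) (X d1) (p) x1 x0 p' => a b q a0 b0 q0'.
  by field; rewrite !gt_eqF //; apply: addr_gt0.
rewrite [leRHS]mulrDr h4 in h3; move: h1 h2 h3; rewrite /leaf_const.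
have -> : m%:R ^+ 2 * abs_shift * g * ((1 + m%:R) * (abs_shift * eps)) =
  eps * ((1 + m%:R) * m%:R ^+ 2 * abs_shift ^+ 2) * g by ring.
move: (_ / (X d0 * X d1)) (_ / (X d0 * X d1)) (_ / (qden m d0 * _)) => v1 v2 v3.
by move=> *; lra.
Qed.

End Size.

Lemma leaf_rate_gt0 : 0 < leaf_rate.
Proof.
have mp : 0 < m%:R :> R by rewrite ltr0n.
have h : 0 < 1 + p by apply: addr_gt0.
have h1 := gap_gt0; have h2 : 0 < 1 - p by rewrite subr_gt0.
by rewrite /leaf_rate; do ![apply: mulr_gt0 => //]; rewrite ?invr_gt0 ?mulr_gt0.
Qed.

End TypeII.

(** * Detection of the change *)

Section Detection.
Context {R : realType}.
Implicit Types (c g eps b d dmin dmax w : R).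

Lemma sign_le_norm (s z : R) : s = 1 \/ s = -1 -> s * z <= `|z|.
Proof.
case=> ->; first by rewrite mul1r ler_norm.
by rewrite mulN1r -normrN ler_norm.
Qed.

Lemma argmax_side m n dmin dmax (s y : R) d (G : multigraph) :
  (1 <= m)%N -> (2 <= n)%N -> - m%:R < dmin -> inv m n m G ->
  dmin <= y -> y <= dmax -> 0 <= curvature m n dmin dmax G ->
  s = 1 \/ s = -1 -> s * score m n G y < 0 ->
  is_argmax_on `[dmin, dmax] (loglik m n G) d -> s * (d - y) <= 0.
Proof.
move=> m1 n2 dminm iG ymin ymax cur0 s1 sy eG.
have X2 : 0 < ((2 * m)%:R + y) ^+ 2.
  by rewrite exprn_gt0 // (lt_le_trans (mu_gt0_of dminm)) // mu_le_X.
have H : s * Hfun m n G y < 0 by rewrite /Hfun mulrCA pmulr_rlt0.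
case: s1 H => ->; rewrite ?mul1r ?mulN1r ?oppr_le0 ?subr_le0 ?subr_ge0 => H.
  apply: (argmax_le m1 n2 dminm iG ymin (lexx y) ymax cur0 _ eG).
  by rewrite subrr mul0r.
apply: (argmax_ge m1 n2 dminm iG ymin (lexx y) ymax cur0 _ eG).
by rewrite subrr mul0r.
Qed.

Lemma curvature_alt m (n : nat) (d0 nu gap B : R) dmin dmax c g eps (G : multigraph) :
  (1 <= m)%N -> - m%:R < d0 -> - m%:R < dmin -> dmin <= dmax ->
  4 * m%:R ^+ 3 / (m%:R + dmin) ^+ 2 <= kappa m d0 dmax * n%:R ->
  0 < g -> g <= eps * n%:R -> 0 <= nu -> nu <= (c + 2) * g -> 0 <= c -> 0 <= B ->
  eps * (m%:R * (c + 2) * `|gap| + B) <= (1 - p_m m d0) / 2 ->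
  `|(N_eq G m)%:R - (p_m m d0 * n.+1%:R + m%:R * nu * gap)| < B * g ->
  0 <= curvature m n dmin dmax G.
Proof.
move=> m1 d0m dminm dd hk g0 gn nu0 nu2 c0 B0 he hN.
have /andP[p0 p1] := p_m_bounds m1 d0m.
have dmaxm : - m%:R < dmax by apply: lt_le_trans dminm dd.
have k0 := kappa_gt0 m1 d0m dmaxm.
apply: le_trans (curvature_ge dminm dd hk _); first by nonneg.
set N := (N_eq G m)%:R in hN *; set p := p_m m d0 in hN he p0 p1 *.
have h1 : m%:R * nu * gap <= m%:R * (c + 2) * `|gap| * g.
  apply: (@le_trans _ _ (m%:R * nu * `|gap|)).
    by apply: ler_wpM2l; [nonneg|apply: ler_norm].
  have -> : m%:R * (c + 2) * `|gap| * g = m%:R * ((c + 2) * g) * `|gap| by ring.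
  by apply: ler_wpM2r => //; apply: ler_wpM2l.
have h2 : (m%:R * (c + 2) * `|gap| + B) * g <= (1 - p) / 2 * n%:R.
  apply: (@le_trans _ _ ((m%:R * (c + 2) * `|gap| + B) * (eps * n%:R))).
    by apply: ler_wpM2l gn; nonneg.
  by rewrite mulrA [_ * eps]mulrC; apply: ler_wpM2r.
move: (ltr_normlW hN) h1 h2 p1; rewrite -(natr1 n).
by move: (m%:R * nu * gap) (m%:R * (c + 2) * `|gap|) => v1 v2; clear => *; lra.
Qed.

(** Only a one-sided location of the estimator is used. The sign of the score at y puts it on the d0
    side of y, and since p_m is decreasing this can only widen the gap between N_m and n p_m(y). Of
    the margin [leaf_rate] g, one quarter goes to second-order terms and one to the deviation of
    N_m. *)
Lemma Q_alt_ge m (n T : nat) (d0 d1 : R) c g eps w b d dmin dmax (G : multigraph) :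
  let y := d0 + shift m d0 d1 c * (g / n%:R) in
  let nu := n%:R - T%:R in
  (1 <= m)%N -> (2 <= n)%N -> - m%:R < dmin -> - m%:R < d0 -> - m%:R < d1 ->
  0 < c -> d0 <> d1 -> inv m n m G -> dmin <= y -> y <= dmax ->
  0 < g -> 0 < eps -> eps <= 1 -> g <= eps * n%:R -> 1 <= eps * g ->
  c * g <= nu -> nu <= c * g + 1 -> 0 < w ->
  eps * drift_const m d0 d1 c <= rate m d0 d1 c / 4 ->
  eps * leaf_const m d0 d1 c <= leaf_rate m d0 d1 c / 4 ->
  0 <= curvature m n dmin dmax G ->
  `|score m n G y - m%:R * w * ((T%:R - 1) * ((d0 - y) / ((2 * m)%:R + d0))
     + nu * ((d1 - y) / ((2 * m)%:R + d1)))| < m%:R * w * (rate m d0 d1 c / 2) * g ->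
  `|(N_eq G m)%:R - (p_m m d0 * n.+1%:R + m%:R * nu * (gleaf m d0 d1 - gleaf m d0 d0))|
     < leaf_rate m d0 d1 c / 4 * g ->
  b <= leaf_rate m d0 d1 c / 2 * g ->
  is_argmax_on `[dmin, dmax] (loglik m n G) d ->
  b <= `|(N_eq G m)%:R - n%:R * p_m m d|.
Proof.
move=> y nu m1 n2 dminm d0m d1m c0 d01 iG ymin ymax g0 eps0 eps1 gN g1 nu1 nu2 w0.
move=> he1 he2 cur0 hs hN hb eG.
have np : 0 < n%:R :> R by rewrite ltr0n ltnW.
have mp : 0 < m%:R :> R by rewrite ltr0n.
have S1 : side d0 d1 = 1 \/ side d0 d1 = -1 by rewrite /side; case: ifP; [left|right].
have hd := score_drift_sign m1 d0m d1m c0 g0 np eps1 gN g1 nu1 nu2.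
rewrite -/y in hd; set s := side d0 d1 in S1 hd.
have hTn : (T%:R : R) - 1 = n%:R - nu - 1 by rewrite /nu; ring.
rewrite hTn in hs.
have sn z : s * z <= `|z| := sign_le_norm z S1.
have r0 := rate_gt0 m1 d0m d1m c0 d01.
have sc : s * score m n G y < 0.
  set L := (_ + nu * _) in hs hd.
  have -> : s * score m n G y = s * (score m n G y - m%:R * w * L) + m%:R * w * (s * L) by ring.
  have mw : 0 < m%:R * w by rewrite mulr_gt0.
  have h1 := le_lt_trans (sn (score m n G y - m%:R * w * L)) hs.
  have h2 : m%:R * w * (s * L) <= m%:R * w * (- (3 / 4) * rate m d0 d1 c * g).
    rewrite ler_pM2l //; apply: (le_trans hd); rewrite ler_pM2r //.
    by move: he1; clear => *; lra.
  have h3 : 0 < m%:R * w * (rate m d0 d1 c * g) by do 2!apply: mulr_gt0 => //.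
  move: h1 h2 h3; move: (s * _) (m%:R * w * (s * L)) (m%:R * w) => v1 v2 v3.
  by clear => *; lra.
have sdy := argmax_side m1 n2 dminm iG ymin ymax cur0 S1 sc eG.
have ym : - m%:R < y by apply: lt_le_trans ymin.
have dm : - m%:R < d.
  by case: eG => + _; rewrite /= in_itv /= => /andP[+ _]; apply: lt_le_trans.
have hp : s * (n%:R * (p_m m y - p_m m d)) <= 0.
  rewrite p_m_diff //.
  have -> : s * (n%:R * (m%:R ^+ 2 * (d - y) / (qden m y * qden m d))) =
    n%:R * m%:R ^+ 2 / (qden m y * qden m d) * (s * (d - y)) by ring.
  apply: mulr_ge0_le0 => //.
  have q1 := qden_gt0 m1 ym; have q2 := qden_gt0 m1 dm.
  by nonneg.
have lg := leaf_gap m1 d0m d1m c0 g0 np gN g1 nu1 ym.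
rewrite -/y -/s in lg.
set N := (N_eq G m)%:R in hN *; set tgt := (_ + _ * (gleaf _ _ _ - _)) in hN.
have QE : s * (N - n%:R * p_m m d) = s * (N - tgt) +
   s * (p_m m d0 + m%:R * nu * (gleaf m d0 d1 - gleaf m d0 d0) + n%:R * (p_m m d0 - p_m m y))
   + s * (n%:R * (p_m m y - p_m m d)).
  by rewrite /tgt -(natr1 n); ring.
have h1 := le_lt_trans (sn (N - tgt)) hN.
have h2 : - (s * (N - n%:R * p_m m d)) <= `|N - n%:R * p_m m d|.
  by rewrite -mulrN -[X in _ <= X]normrN; apply: sn.
apply: le_trans h2; rewrite QE.
have h3 : (eps * leaf_const m d0 d1 c - leaf_rate m d0 d1 c) * g <=
   - (3 / 4) * leaf_rate m d0 d1 c * g.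
  by rewrite ler_pM2r //; move: he2; clear => *; lra.
move: hb h1 lg h3 hp.
move: (s * (N - tgt)) (s * (_ + _ + _)) (s * (n%:R * _)) => v1 v2 v3.
move: (leaf_rate _ _ _ _) ((_ - _) * g) => v4 v5.
by clear => *; lra.
Qed.

Lemma near_small (A b : R) : 0 < b -> \forall e \near (0 : R)^'+, e * A <= b.
Proof.
move=> b0; have A0 : 0 < `|A| + 1 by apply: ltr_wpDl.
near=> e; have e0 : 0 < e by near: e; apply: nbhs_right_gt.
have eb : e < b / (`|A| + 1) by near: e; apply: nbhs_right_lt; rewrite divr_gt0.
rewrite ltr_pdivlMr // in eb; apply: le_trans (ltW eb).
by rewrite ler_pM2l //; apply: (le_trans (ler_norm _)); rewrite lerDl.
Unshelve. all: by end_near. Qed.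

Lemma near_inv_small (A b : R) : 0 < b -> \forall K \near \oo, A / K.+1%:R <= b.
Proof.
move=> b0; have := nbhs_infty_ger (A / b); apply: filterS => K AK.
rewrite ler_pdivrMr // mulrC -ler_pdivrMr //; apply: (le_trans AK).
by rewrite ler_nat.
Qed.

(** The square of the window, of order g^2, divided by n is at most of order eps g because g <= eps
    n. *)
Lemma window_error n T g eps c : (1 <= n)%N -> (T <= n)%N -> 0 < g -> 0 < eps ->
  eps <= 1 -> g <= eps * n%:R -> 1 <= eps * g ->
  n%:R - T%:R <= c * g + 1 -> 0 <= c ->
  Num.sqrt (n.+1%:R : R) <= eps * g ->
  Num.sqrt (n.+1%:R : R) + (n.+1 - T)%N%:R ^+ 2 / n.+1%:R <= eps * (1 + (c + 2) ^+ 2) * g.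
Proof.
move=> n1 Tn g0 eps0 eps1 gn g1 nu2 c0 sq.
have np : 0 < n%:R :> R by rewrite ltr0n.
have -> : ((n.+1 - T)%N%:R : R) = n%:R - T%:R + 1.
  by rewrite subSn // -natr1 natrB.
have h1 := nuS_le g0 eps1 g1 nu2.
have nu0 : 0 <= n%:R - T%:R + 1 :> R.
  by apply: addr_ge0 => //; rewrite subr_ge0 ler_nat.
have h2 : (n%:R - T%:R + 1) ^+ 2 / n.+1%:R <= ((c + 2) * g) ^+ 2 / n%:R.
  apply: ler_pM; rewrite ?sqr_ge0 ?invr_ge0 //.
    by rewrite lerXn2r ?nnegrE //; nonneg.
  by rewrite lef_pV2 ?posrE ?ltr0n // ler_nat.
have h3 : ((c + 2) * g) ^+ 2 / n%:R <= eps * (c + 2) ^+ 2 * g.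
  rewrite ler_pdivrMr // exprMn.
  have -> : eps * (c + 2) ^+ 2 * g * n%:R = (c + 2) ^+ 2 * (g * (eps * n%:R)) by ring.
  apply: ler_wpM2l; first exact: sqr_ge0.
  by rewrite expr2 ler_pM2l.
have := le_trans h2 h3; move: sq; move: (_ / _) (Num.sqrt _) => v1 v2.
by clear => *; lra.
Qed.

End Detection.

Lemma type_II_error (R : realType) (m : nat) (d0 d1 c gamma dmin dmax : R)
    (dhat : nat -> multigraph -> R) (a : nat -> R) :
  (1 <= m)%N -> - m%:R < dmin -> dmin < d0 -> d0 < dmax -> dmin < d1 -> d1 < dmax ->
  0 < c -> d0 <> d1 -> 1 / 2 < gamma -> gamma < 1 ->
  is_estimator m dmin dmax dhat ->
  (forall n, 0 < a n) ->
  eq_pow_o1 a (1 / 2) ->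
  P_alt m d0 d1 c gamma n (fun G => test m dhat a n G == 0%N) @[n --> \oo] --> (0 : R).
Proof.
move=> m1 dminm dmin0 d0max dmin1 d1max c0 d01 gam2 gam1 est a0 apow.
have d0m := lt_trans dminm dmin0; have d1m := lt_trans dminm dmin1.
have [C1 C10 H1] := leaf_concentration m1 dminm (ltW dmin0) (ltW d0max) (ltW dmin1) (ltW d1max).
have [D D0 HD] := score_concentration m1 dminm (ltW dmin0) (ltW d0max) (ltW dmin1) (ltW d1max).
have r0 := rate_gt0 m1 d0m d1m c0 d01; have lr0 := leaf_rate_gt0 m1 d0m d1m c0 d01.
have dmm := ltW (lt_trans dmin0 d0max); have dmaxm := lt_trans d0m d0max.
have /andP[p0 p1] := p_m_bounds m1 d0m; have k0 := kappa_gt0 m1 d0m dmaxm.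
have mp : 0 < m%:R :> R by rewrite ltr0n.
have [w0 [w00 Hw]] : exists w0 : R, 0 < w0 /\ \forall K \near \oo, w0 <= wlim m d0 K.+1.
  pose P : R := p_m m d0 * m%:R ^+ 2 / ((m%:R + d0) * ((2 * m)%:R + d0) ^+ 2).
  have P0 : 0 < P.
    apply: divr_gt0; first by apply: mulr_gt0 => //; apply: exprn_gt0.
    apply: mulr_gt0; first by rewrite -ltrBlDl sub0r.
    by apply: exprn_gt0; apply: X_gt0.
  exists (P / 2); split; first exact: divr_gt0.
  have := near_inv_small 2 (divr_gt0 P0 (ltr0Sn R 1)); apply: filterS => K hK.
  have hw : P - 2 / K.+1%:R <= wlim m d0 K.+1 := wlim_ge m1 d0m K.
  by apply: le_trans hw; move: hK; move: (P) (2 / _) => v1 v2; clear => *; lra.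
apply/cvgrPdist_lt => e e0.
have [d [dpos dle1 de]] : exists d : R, [/\ 0 < d, d <= 1 & d <= e / 3].
  exists (Num.min 1 (e / 3)); rewrite lt_min ltr01 divr_gt0 //.
  by rewrite !ge_min !lexx orbT.
pose eta1 : R := leaf_rate m d0 d1 c / 4.
(* The threshold uses the uniform lower bound [w0] instead of [wlim], since K is still to be chosen
   in terms of it. *)
pose eta2 : R := m%:R * w0 * (rate m d0 d1 c / 2).
have eta10 : 0 < eta1 by apply: divr_gt0.
have eta20 : 0 < eta2 by apply: mulr_gt0; [apply: mulr_gt0|apply: divr_gt0].
pose S : R := `|shift m d0 d1 c|; have S0 : 0 <= S by apply: normr_ge0.
(* Bounds, in units of n^gamma, the [D] term of [score_concentration]: |y - d0| (n + 1) gives 2S and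
   |y - d1| (n + 1 - T) gives (dmax - dmin)(c + 2). *)
pose B : R := D * (2 * S + (dmax - dmin) * (c + 2)).
have B0 : 0 <= B.
  have h : 0 <= dmax - dmin by rewrite subr_ge0.
  by have := ltW c0 => c0'; rewrite /B; nonneg.
have [K [hK1 hK2]] : exists K, w0 <= wlim m d0 K.+1 /\ B / K.+1%:R <= d * eta2 / 3.
  have q0 : 0 < d * eta2 / 3 by apply: divr_gt0 => //; apply: mulr_gt0.
  have [K _ hK] := filterI Hw (near_inv_small B q0).
  by exists K; apply: (hK K) => /=.
have [C2 C20 H2] := HD K.+1 isT => {HD Hw}.
pose Zc : R := 1 + (c + 2) ^+ 2.
pose gap : R := gleaf m d0 d1 - gleaf m d0 d0.
(* The first group makes the L2 norms small against the thresholds, the second secures the signs and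
   the curvature, the third keeps y in [dmin, dmax] and T positive. *)
have [eps [[eps0 eps1] [e1 e2 e3] [e4 e5 e6] [e7 e8 e9]]] : exists eps : R,
  [/\ 0 < eps /\ eps <= 1,
     [/\ eps * (C1 * Zc) <= d * eta1, eps * (C2 * Zc) <= d * eta2 / 3 &
         eps * (B * S) <= d * eta2 / 3],
     [/\ eps * drift_const m d0 d1 c <= rate m d0 d1 c / 4,
         eps * leaf_const m d0 d1 c <= leaf_rate m d0 d1 c / 4 &
         eps * (m%:R * (c + 2) * `|gap| + eta1) <= (1 - p_m m d0) / 2] &
     [/\ eps * S <= d0 - dmin, eps * S <= dmax - d0 & eps * (2 * (c + 1)) <= 1]].
  have q1 : 0 < d * eta1 by apply: mulr_gt0.
  have q2 : 0 < d * eta2 / 3 by apply: divr_gt0 => //; apply: mulr_gt0.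
  have q3 : 0 < rate m d0 d1 c / 4 by apply: divr_gt0.
  have q4 : 0 < (1 - p_m m d0) / 2 by apply: divr_gt0 => //; rewrite subr_gt0.
  have q5 : 0 < d0 - dmin by rewrite subr_gt0.
  have q6 : 0 < dmax - d0 by rewrite subr_gt0.
  near (0 : R)^'+ => eps; exists eps; split; split.
  - by near: eps; apply: nbhs_right_gt.
  - by rewrite -[eps]mulr1; near: eps; apply: near_small.
  - by near: eps; apply: near_small.
  - by near: eps; apply: near_small.
  - by near: eps; apply: near_small.
  - by near: eps; apply: near_small.
  - by near: eps; apply: near_small.
  - by near: eps; apply: near_small.
  - by near: eps; apply: near_small.
  - by near: eps; apply: near_small.
  - by near: eps; apply: near_small.
near=> n.
have n2 : (2 <= n)%N by near: n; exists 2%N.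
have n1 := ltnW n2; have np : 0 < n%:R :> R by rewrite ltr0n.
pose g : R := n%:R `^ gamma.
have g0 : 0 < g by apply: powR_gt0.
have gn : g <= eps * n%:R by rewrite /g; near: n; apply: near_pow_le_n.
have g1 : 1 <= eps * g.
  rewrite mulrC -ler_pdivrMr // mul1r /g; near: n; apply: near_powR_ge.
  by apply: lt_trans gam2; apply: divr_gt0.
have sg : Num.sqrt (n.+1%:R : R) <= eps * g by rewrite /g; near: n; apply: near_sqrtS.
have ag : a n <= leaf_rate m d0 d1 c / 2 * g.
  by rewrite /g; near: n; apply: near_eq_pow apow gam2 _; apply: divr_gt0.
have kn : 4 * m%:R ^+ 3 / (m%:R + dmin) ^+ 2 <= kappa m d0 dmax * n%:R.
  rewrite [leRHS]mulrC -ler_pdivrMr //; near: n; exact: nbhs_infty_ger.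
have cg : (c + 1) * g <= n%:R / 2.
  have h : (c + 1) * g <= (c + 1) * (eps * n%:R).
    by apply: ler_wpM2l gn; apply: addr_ge0 => //; apply: ltW.
  have h2 : eps * (2 * (c + 1)) * n%:R <= 1 * n%:R by apply: ler_wpM2r.
  by move: h h2; clear => *; lra.
have g1' : 1 <= g by apply: (le_trans g1); rewrite ler_piMl // ltW.
have tpos : 0 <= n%:R - c * n%:R `^ gamma.
  by rewrite -/g; move: cg g1' np; clear => *; lra.
have [Tn nu1 nu2] := tau_bounds (ltW c0) tpos.
have := delta_altE d0 d1 tpos; move: Tn nu1 nu2.
set T := `|_|%N; rewrite -/g => Tn nu1 nu2 dE.
(* The sums over steps start at s = 2, so T - 1 of their terms precede the changepoint. *)
have T1 : (1 <= T)%N.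
  rewrite -(ltr0n R); move: nu2 cg g1' np; clear => *; lra.
pose dd := dseq d0 d1 T.
have dgt t : - m%:R < dd t by apply: dseq_gt.
have law := is_law_PA dgt n1.
rewrite /P_alt (eq_PA_law m n dE) -/dd.
pose y : R := d0 + shift m d0 d1 c * (g / n%:R).
have gne := gN_le np gn.
have gn0 : 0 <= g / n%:R by apply: divr_ge0; apply: ltW.
have yd : `|y - d0| <= eps * S.
  rewrite /y addrAC subrr add0r normrM (ger0_norm gn0) -/S mulrC.
  exact: ler_wpM2r.
have ymin : dmin <= y.
  by move: yd e7; rewrite ler_norml => /andP[+ _]; clear => *; lra.
have ymax : y <= dmax.
  by move: yd e8; rewrite ler_norml => /andP[_]; clear => *; lra.
pose w : R := wlim m d0 K.+1; have wpos : 0 < w by apply: lt_le_trans hK1.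
pose F1 G : R := vsum (ind m 0) n.+1 G - leaf_target m d0 d1 T n.+1 0.
pose F2 G : R := vsum (hsum m y) n.+1 G - score_target m d0 d1 K.+1 T y n.+1 0.
have Z := window_error n1 Tn g0 eps0 eps1 gn g1 nu2 (ltW c0) sg.
rewrite -/Zc in Z.
have N1 : nrm (PA_law m dd n) F1 <= d * eta1 * g.
  rewrite -(nrm_PA m dd F1 n1); apply: (le_trans (H1 T n.+1 0%N n1 (leq0n m))).
  apply: (le_trans (ler_wpM2l C10 Z)).
  have -> : C1 * (eps * Zc * g) = eps * (C1 * Zc) * g by ring.
  by apply: ler_wpM2r => //; apply: ltW.
have nuS := nuS_le g0 eps1 g1 nu2.
have N2 : nrm (PA_law m dd n) F2 <= d * eta2 * g.
  rewrite -(nrm_PA m dd F2 n1).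
  apply: (le_trans (H2 T y n.+1 0%N ymin ymax n1 (leq0n m))).
  have h1 : C2 * (Num.sqrt n.+1%:R + (n.+1 - T)%N%:R ^+ 2 / n.+1%:R) <= d * eta2 / 3 * g.
    apply: (le_trans (ler_wpM2l C20 Z)).
    have -> : C2 * (eps * Zc * g) = eps * (C2 * Zc) * g by ring.
    by apply: ler_wpM2r => //; apply: ltW.
  have h2 : `|y - d0| * n.+1%:R <= 2 * S * g.
    rewrite /y addrAC subrr add0r normrM (ger0_norm gn0) -/S.
    have -> : S * (g / n%:R) * n.+1%:R = S * g * (n.+1%:R / n%:R) by ring.
    have -> : 2 * S * g = S * g * 2 by ring.
    apply: ler_wpM2l; first by apply: mulr_ge0 => //; apply: ltW.
    by rewrite ler_pdivrMr // -natrM ler_nat; move: n1; clear; lia.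
  have h3 : `|y - d1| * (n.+1 - T)%N%:R <= (dmax - dmin) * (c + 2) * g.
    rewrite subSn // -natr1 natrB // -(mulrA (dmax - dmin)); apply: ler_pM => //.
      by apply: addr_ge0 => //; rewrite subr_ge0 ler_nat.
    rewrite ler_norml; move: ymin ymax dmin1 d1max; clear => *.
    by apply/andP; split; lra.
  have h4 : D * (`|y - d0| * n.+1%:R + `|y - d1| * (n.+1 - T)%N%:R) <= B * g.
    have -> : B * g = D * (2 * S * g + (dmax - dmin) * (c + 2) * g) by rewrite /B; ring.
    by apply: ler_wpM2l => //; apply: lerD.
  have h5 : D * (`|y - d0| * n.+1%:R + `|y - d1| * (n.+1 - T)%N%:R)
      * (`|y - d0| + K.+1%:R^-1) <= B * g * (eps * S + K.+1%:R^-1).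
    by apply: ler_pM; [nonneg|nonneg|exact: h4|rewrite lerD2r].
  have h6 : B * g * (eps * S + K.+1%:R^-1) <= (d * eta2 / 3 + d * eta2 / 3) * g.
    have -> : B * g * (eps * S + K.+1%:R^-1) = (eps * (B * S) + B / K.+1%:R) * g by ring.
    by apply: ler_wpM2r; [apply: ltW|apply: lerD].
  apply: (le_trans (lerD h1 (le_trans h5 h6))).
  by rewrite le_eqVlt; apply/orP; left; apply/eqP; field.
(* The event of acceptance is contained in two deviation events; outside them the lower bound on |Q|
   holds for every graph satisfying [inv]. *)
have key G : inv m n m G -> test m dhat a n G == 0%N ->
    (eta1 * g <= `|F1 G|) || (eta2 * g <= `|F2 G|).
  move=> iG tG; apply/negP => /negP; rewrite negb_or -!ltNge => /andP[f1 f2].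
  move: tG; rewrite /test eqb0 => /negP; apply.
  rewrite /F1 leaves_vsum // leaf_target_end // in f1.
  rewrite /F2 score_target_end // opprD addrA -/(score m n G y) -/w in f2.
  have cur : 0 <= curvature m n dmin dmax G.
    apply: (curvature_alt m1 d0m dminm dmm kn g0 gn _ _ (ltW c0) (ltW eta10) e6 f1).
      by rewrite subr_ge0 ler_nat.
    by apply: le_trans nuS; rewrite lerDl.
  rewrite /Q; apply: (Q_alt_ge m1 n2 dminm d0m d1m c0 d01 iG ymin ymax g0 eps0 eps1 gn g1
    nu1 nu2 wpos e4 e5 cur _ f1 ag (est n G)).
  apply: (lt_le_trans f2); apply: ler_wpM2r; first exact: ltW.
  by apply: ler_wpM2r; [apply: divr_ge0 => //; apply: ltW|apply: ler_wpM2l => //; apply: ltW].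
have l1 : 0 < eta1 * g by apply: mulr_gt0.
have l2 : 0 < eta2 * g by apply: mulr_gt0.
have P1 := chebyshev law F1 l1; have P2 := chebyshev law F2 l2.
have sq u : 0 <= u -> u <= d -> u ^+ 2 <= e / 3.
  move=> u0 ud; apply: le_trans de; apply: (le_trans _ ud).
  by rewrite expr2 ler_piMr // (le_trans ud).
rewrite sub0r normrN (ger0_norm (prob_ge0 law _)).
apply: (le_lt_trans (prob_le2 law key)).
have q1 : (nrm (PA_law m dd n) F1 / (eta1 * g)) ^+ 2 <= e / 3.
  apply: sq; first by rewrite divr_ge0 ?nrm_ge0 // ltW.
  by rewrite (ler_pdivrMr _ _ l1) mulrA.
have q2 : (nrm (PA_law m dd n) F2 / (eta2 * g)) ^+ 2 <= e / 3.
  apply: sq; first by rewrite divr_ge0 ?nrm_ge0 // ltW.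
  by rewrite (ler_pdivrMr _ _ l2) mulrA.
by move: q1 q2 P1 P2 e0; clear => *; lra.
Unshelve. all: by end_near. Qed.

Theorem theorem3p4 (R : realType) (m : nat)
    (delta0 delta1 c gamma dmin dmax : R)
    (dhat : nat -> multigraph -> R) (a : nat -> R) :
  (1 <= m)%N ->
  - m%:R < delta0 -> - m%:R < delta1 ->
  0 < c -> 0 < gamma -> gamma < 1 ->
  - m%:R < dmin -> dmin <= dmax ->
  dmin < delta0 -> delta0 < dmax ->
  dmin < delta1 -> delta1 < dmax ->
  is_estimator m dmin dmax dhat ->
  (forall n, 0 < a n) ->
  a n @[n --> \oo] --> +oo ->
  omega a (fun n => Num.sqrt n%:R * ln n%:R) ->
  eq_pow_o1 a (1 / 2) ->
  (P_null m delta0 n (fun G => test m dhat a n G != 0%N)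
     @[n --> \oo] --> (0 : R)) /\
  (delta0 <> delta1 -> 1 / 2 < gamma ->
   P_alt m delta0 delta1 c gamma n (fun G => test m dhat a n G == 0%N)
     @[n --> \oo] --> (0 : R)).
Proof.
move=> m1 _ _ c0 _ gam1 dminm _ dmin0 d0max dmin1 d1max est a0 ainf om apow.
split; first exact: (type_I_error m1 dminm dmin0 d0max est a0 ainf om apow).
by move=> d01 gam2; apply: (@type_II_error R m delta0 delta1 c gamma dmin dmax).
Qed.
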